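(* Let $G\in\mathrm{Gl}_n(\mathbb{R})$, $D\in\mathbb{R}^{n\times n}$ with $D=D^\top\ge 0$, $B\in\mathbb{R}^{n\times m}$ with $\operatorname{rank}B=m$, and $$\mathcal{A}=\begin{bmatrix}0&G^\top\\-G&-D\end{bmatrix}\in\mathbb{R}^{2n\times 2n},\qquad \mathcal{B}=\begin{bmatrix}0\\ B\end{bmatrix}=\mathcal{C}^\top ,$$ and suppose that the system $[\mathcal{A},\mathcal{B},\mathcal{C}]$ is stabilizable. Let $q^\pm, r^\pm$ be admissible truncation indices and let $[\widetilde{\mathcal{A}},\widetilde{\mathcal{B}},\widetilde{\mathcal{C}}]=[W^\top\mathcal{A}V,W^\top\mathcal{B},\mathcal{C}V]$ be the reduced system, with $\Sigma_1=\operatorname{diag}(\Sigma_1^-,\Sigma_1^+)$, all constructed as described in the context. Then: a) $\mathcal{W}_{[\widetilde{\mathcal{A}},\widetilde{\mathcal{B}},\widetilde{\mathcal{C}},0]}(\Sigma_1)\le 0$ and $\mathcal{W}_{[\widetilde{\mathcal{A}}^\top,\widetilde{\mathcal{C}}^\top,\widetilde{\mathcal{B}}^\top,0]}(\Sigma_1)\le 0$. In particular, $[\widetilde{\mathcal{A}},\widetilde{\mathcal{B}},\widetilde{\mathcal{C}}]$ is passive. b) $\operatorname{diag}(-I_{r^-},I_{r^+})\,\widetilde{\mathcal{A}}\,\operatorname{diag}(-I_{r^-},I_{r^+})=\widetilde{\mathcal{A}}^\top$ and $\widetilde{\mathcal{B}}=\operatorname{diag}(-I_{r^-},I_{r^+})\widetilde{\mathcal{B}}=\widetilde{\mathcal{C}}^\top$.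 c) The gap metric between the transfer functions $\mathbf{G}(s)$ of $[\mathcal{A},\mathcal{B},\mathcal{C}]$ and $\widetilde{\mathbf{G}}(s)$ of $[\widetilde{\mathcal{A}},\widetilde{\mathcal{B}},\widetilde{\mathcal{C}}]$ satisfies $$\delta_g(\mathbf{G}(s),\widetilde{\mathbf{G}}(s))\le 2\sum_{i=q^-+1}^{h^-}\sigma_i^-+2\sum_{i=q^++1}^{h^+}\sigma_i^+ .$$ d) If $\sigma^-_{q^-+1}=0=\sigma^+_{q^++1}$, then $[\widetilde{\mathcal{A}},\widetilde{\mathcal{B}},\widetilde{\mathcal{C}}]$ is a minimal positive real balanced realization of $\mathbf{G}(s)$.
   Context: $[\mathcal{A},\mathcal{B},\mathcal{C},\mathcal{D}]$ denotes the system $\dot x=\mathcal{A}x+\mathcal{B}u$, $y=\mathcal{C}x+\mathcal{D}u$, with transfer function $\mathcal{C}(sI-\mathcal{A})^{-1}\mathcal{B}+\mathcal{D}$ (of which it is called a realization); $[\mathcal{A},\mathcal{B},\mathcal{C}]$ means $\mathcal{D}=0$. It is minimal if controllable and observable. For symmetric $P$, $$\mathcal{W}_{[\mathcal{A},\mathcal{B},\mathcal{C},\mathcal{D}]}(P):=\begin{bmatrix}\mathcal{A}^\top P+P\mathcal{A}&P\mathcal{B}-\mathcal{C}^\top\\ \mathcal{B}^\top P-\mathcal{C}&-\mathcal{D}-\mathcal{D}^\top\end{bmatrix}.$$ The inequality $\mathcal{W}(P)\le0$ is the KYP inequality; a minimal solution $P_{\min}\ge0$ is a positive semidefinite solution with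 $P_{\min}\le P$ for all positive semidefinite solutions $P$. The system is passive if there is $P>0$ such that $x(t)^\top Px(t)\le x(0)^\top Px(0)+\int_0^t y(\tau)^\top u(\tau)\,d\tau$ for all locally square integrable solutions $(x,u,y)$ and $t>0$. It is positive real balanced if the minimal solutions $P_{\min},Q_{\min}$ of $\mathcal{W}_{[\mathcal{A},\mathcal{B},\mathcal{C},\mathcal{D}]}(P)\le0$ and $\mathcal{W}_{[\mathcal{A}^\top,\mathcal{C}^\top,\mathcal{B}^\top,\mathcal{D}^\top]}(Q)\le 0$ satisfy $P_{\min}=Q_{\min}=\operatorname{diag}(\sigma_1I_{n_1},\dots,\sigma_hI_{n_h})$ with distinct $\sigma_i\in(0,1]$ (in no prescribed order). Construction of the reduced system. Put $\mathcal{S}_n=\operatorname{diag}(-I_n,I_n)$. Let $P_{\min}\ge0$ be the minimal solution of $\mathcal{W}_{[\mathcal{A},\mathcal{B},\mathcal{C},0]}(P)\le0$ (which exists under the present assumptions) and $P_{\min}=L^\top L$ with $L\in\mathbb{R}^{2n\times2n}$. Take an eigendecomposition $L\mathcal{S}_nL^\top=U\mathcal{S}_n\Sigma U^\top$ with $U=[U^-\ U^+]\in\mathbb{R}^{2n\times 2n}$ orthogonal, $\Sigma=\operatorname{diag}(\Sigma^-,\Sigma^+)$, $\Sigma^\pm\in\mathbb{R}^{n\times n}$, $$\Sigma^-=\operatorname{diag}(\sigma_1^-I_{n_1^-},\dots,\sigma^-_{h^-}I_{n^-_{h^-}}),\qquad \Sigma^+=\operatorname{diag}(\sigma^+_{h^+}I_{n^+_{h^+}},\dots,\sigma_1^+I_{n_1^+}),$$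 $0\le\sigma^\pm_{h^\pm}<\dots<\sigma^\pm_1\le1$. Admissible truncation indices: $1\le q^\pm\le h^\pm$ with $\sigma^\pm_{q^\pm}>0$, $r^\pm=\sum_{j=1}^{q^\pm}n_j^\pm$, and $\sigma^-_{q^-+j^-}\ne\sigma^+_{i^+}$, $\sigma^+_{q^++j^+}\neq\sigma^-_{i^-}$ for all $i^\pm=1,\dots,q^\pm$, $j^\pm=1,\dots,h^\pm-q^\pm$. Let $U_1^-$ consist of the first $r^-$ columns of $U^-$, $U_1^+$ of the last $r^+$ columns of $U^+$, and let $\Sigma_1^-=\operatorname{diag}(\sigma_1^-I_{n_1^-},\dots,\sigma_{q^-}^-I_{n^-_{q^-}})$, $\Sigma_1^+=\operatorname{diag}(\sigma^+_{q^+}I_{n^+_{q^+}},\dots,\sigma_1^+I_{n_1^+})$, $\Sigma_1=\operatorname{diag}(\Sigma_1^-,\Sigma_1^+)$, $U_1=[U_1^-\ U_1^+]$. Set $$W^\top:=\Sigma_1^{-1/2}\operatorname{diag}(-I_{r^-},I_{r^+})U_1^\top L,\qquad V:=\mathcal{S}_nL^\top U_1\Sigma_1^{-1/2}.$$ Gap metric. $\mathcal{R}H^\infty$ denotes the proper real rational matrix functions without poles in the closed right half-plane $\overline{\mathbb{C}^+}$; $\mathcal{R}H^2(\mathbb{C}^k)$ the strictly proper real rational $\mathbb{C}^k$-valued functions without poles in $\overline{\mathbb{C}^+}$, with norm $\|u\|_2^2=\int_{\mathbb{R}}\|u(\mathrm{i}\omega)\|^2d\omega$. A normalized (right) coprime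 factorization of $\mathbf{G}(s)\in\mathbb{R}(s)^{p\times m}$ is $\begin{bmatrix}\mathbf{M}\\\mathbf{N}\end{bmatrix}$ with $\mathbf{M},\mathbf{N}$ in $\mathcal{R}H^\infty$, $\mathbf{G}=\mathbf{N}\mathbf{M}^{-1}$, $\mathbf{X}\mathbf{M}+\mathbf{Y}\mathbf{N}=I_m$ for some $\mathbf{X},\mathbf{Y}$ in $\mathcal{R}H^\infty$, and $\mathbf{M}^\top(-s)\mathbf{M}(s)+\mathbf{N}^\top(-s)\mathbf{N}(s)=I_m$, where $\mathbf M^{-1}(s)$ is proper. If $\Pi_i$ ($i=1,2$) is the orthogonal projector in $\mathcal{R}H^2(\mathbb{C}^{m+p})$ onto $\begin{bmatrix}\mathbf{M}_i\\\mathbf{N}_i\end{bmatrix}\cdot\mathcal{R}H^2(\mathbb{C}^m)$ for normalized coprime factorizations of $\mathbf{G}_1,\mathbf{G}_2$, then $\delta_g(\mathbf{G}_1,\mathbf{G}_2):=\|\Pi_1-\Pi_2\|$ (operator norm).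
   Formalization: In d), ''positive real balanced'' is read as: P_min = Q_min is diagonal with entries in (0,1] in any order, equal entries not necessarily in one block; with one contiguous block per distinct σ_i, d) fails, since both σ_1^- and σ_1^+ equal 1 and stand at opposite ends of Σ_1. *)

(* Defs.v *)
From HB Require Import structures.
From mathcomp Require Export all_boot all_order all_algebra.
From mathcomp Require Export complex.
From mathcomp Require Export all_classical all_reals all_analysis.

Set Implicit Arguments.
Unset Strict Implicit.
Unset Printing Implicit Defensive.

Import Order.TTheory GRing.Theory Num.Theory.
Import numFieldNormedType.Exports.

Local Open Scope classical_set_scope.
Local Open Scope ring_scope.

Section Definite.
Variables (R : realType).

Definition psdmx N (P : 'M[R]_N) : Prop :=
  P^T = P /\ forall x : 'cV[R]_N, 0 <= (x^T *m P *m x) 0 0.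

Definition pdmx N (P : 'M[R]_N) : Prop :=
  P^T = P /\ forall x : 'cV[R]_N, x != 0 -> 0 < (x^T *m P *m x) 0 0.

Definition nsdmx N (P : 'M[R]_N) : Prop := psdmx (- P).

(* Loewner order *)
Definition mxle N (P Q : 'M[R]_N) : Prop := psdmx (Q - P).

End Definite.

Section Systems.
Variables (R : realType).
Notation mu := (@lebesgue_measure R).

Definition locally_L2 k (f : R -> 'cV[R]_k) : Prop :=
  forall i : 'I_k,
    measurable_fun `[(0 : R), +oo[ (fun t => f t i 0) /\
    forall t, 0 < t -> (\int[mu]_(s in `[0%R, t]) ((f s i 0) ^+ 2)%:E < +oo)%E.

(* Caratheodory solutions on [0, +oo[: the differential equation is imposed in
   integrated form, so that x is the absolutely continuous representative. *)
Definition is_solution N m p (A : 'M[R]_N) (B : 'M[R]_(N, m))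
    (C : 'M[R]_(p, N)) (D : 'M[R]_(p, m))
    (x : R -> 'cV[R]_N) (u : R -> 'cV[R]_m) (y : R -> 'cV[R]_p) : Prop :=
  [/\ [/\ locally_L2 x, locally_L2 u & locally_L2 y],
      forall t, 0 <= t ->
        x t = x 0 +
          \col_i \int[mu]_(s in `[0, t]) (A *m x s + B *m u s) i 0 &
      {ae mu, forall t, 0 <= t -> y t = C *m x t + D *m u t}].

Definition hurwitz N (A : 'M[R]_N) : Prop :=
  forall z : R[i], eigenvalue (map_mx (real_complex R) A) z -> complex.Re z < 0.

Definition stabilizable N m (A : 'M[R]_N) (B : 'M[R]_(N, m)) : Prop :=
  exists F : 'M[R]_(m, N), hurwitz (A + B *m F).

Definition controllable N m p (A : 'M[R]_N) (B : 'M[R]_(N, m))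
    (C : 'M[R]_(p, N)) (D : 'M[R]_(p, m)) : Prop :=
  forall (x0 x1 : 'cV[R]_N) (T : R), 0 < T ->
    exists x u y, [/\ is_solution A B C D x u y, x 0 = x0 & x T = x1].

Definition observable N m p (A : 'M[R]_N) (B : 'M[R]_(N, m))
    (C : 'M[R]_(p, N)) (D : 'M[R]_(p, m)) : Prop :=
  forall (T : R) x u y x' u' y', 0 < T ->
    is_solution A B C D x u y -> is_solution A B C D x' u' y' ->
    {ae mu, forall t, 0 <= t <= T -> u t = u' t /\ y t = y' t} ->
    x 0 = x' 0.

Definition minimal N m p (A : 'M[R]_N) (B : 'M[R]_(N, m))
    (C : 'M[R]_(p, N)) (D : 'M[R]_(p, m)) : Prop :=
  controllable A B C D /\ observable A B C D.

Definition passive N m (A : 'M[R]_N) (B : 'M[R]_(N, m))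
    (C : 'M[R]_(m, N)) (D : 'M[R]_m) : Prop :=
  exists2 P : 'M[R]_N, pdmx P &
    forall x u y, is_solution A B C D x u y -> forall t, 0 < t ->
      ((x t)^T *m P *m x t) 0 0 <=
      ((x 0)^T *m P *m x 0) 0 0 +
        \int[mu]_(s in `[0, t]) ((y s)^T *m u s) 0 0.

Definition kyp N m (A : 'M[R]_N) (B : 'M[R]_(N, m))
    (C : 'M[R]_(m, N)) (D : 'M[R]_m) (P : 'M[R]_N) : 'M[R]_(N + m) :=
  block_mx (A^T *m P + P *m A) (P *m B - C^T)
           (B^T *m P - C)      (- D - D^T).

Definition is_kyp_min N m (A : 'M[R]_N) (B : 'M[R]_(N, m))
    (C : 'M[R]_(m, N)) (D : 'M[R]_m) (P : 'M[R]_N) : Prop :=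
  [/\ psdmx P, nsdmx (kyp A B C D P) &
      forall P' : 'M[R]_N, psdmx P' -> nsdmx (kyp A B C D P') -> mxle P P'].

(* The sequence s_1 (k_1 times), s_2 (k_2 times), ... of diagonal entries of
   diag(s_1 I_{k_1}, s_2 I_{k_2}, ...). *)
Definition repeat_seq (s : seq R) (k : seq nat) : seq R :=
  flatten [seq nseq p.2 p.1 | p <- zip s k].

Definition diag_seq N (s : seq R) : 'M[R]_N := diag_mx (\row_i s`_i).

(* The order of the diagonal entries is not prescribed, so equal entries need
   not be contiguous: the distinct values s and their multiplicities k describe the
   diagonal up to permutation only. *)
Definition pr_balanced N m (A : 'M[R]_N) (B : 'M[R]_(N, m))
    (C : 'M[R]_(m, N)) (D : 'M[R]_m) : Prop :=
  exists P Q : 'M[R]_N,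
    [/\ is_kyp_min A B C D P, is_kyp_min A^T C^T B^T D^T Q, P = Q &
      exists (s : seq R) (k : seq nat) (d : seq R),
        [/\ uniq s, all (fun x => 0 < x <= 1) s,
            size k = size s /\ all (leq 1) k,
            perm_eq d (repeat_seq s k) &
            size d = N /\ P = diag_seq N d]].

End Systems.

Section RationalFunctions.
Variables (R : realType).
Notation mu := (@lebesgue_measure R).

Definition ratfun : fieldType := {fraction {poly R}}.

(* numerator and denominator in lowest terms *)
Definition rnum (f : ratfun) : {poly R} :=
  let: (p, q) := frac (repr f) in p %/ gcdp p q.

Definition rden (f : ratfun) : {poly R} :=
  let: (p, q) := frac (repr f) in q %/ gcdp p q.

Definition rconst (a : R) : ratfun := @tofrac _ a%:P.

(* f(s) |-> f(-s) *)
Definition rflip (f : ratfun) : ratfun :=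
  @tofrac _ (rnum f \Po - 'X) / @tofrac _ (rden f \Po - 'X).

Definition polyC_eval (p : {poly R}) (z : R[i]) : R[i] :=
  (map_poly (real_complex R) p).[z].

Definition reval (f : ratfun) (z : R[i]) : R[i] :=
  polyC_eval (rnum f) z / polyC_eval (rden f) z.

Definition is_pole (f : ratfun) (z : R[i]) : Prop := polyC_eval (rden f) z = 0.

Definition proper (f : ratfun) : Prop := (size (rnum f) <= size (rden f))%N.

Definition strictly_proper (f : ratfun) : Prop :=
  (size (rnum f) < size (rden f))%N.

Definition no_rhp_pole (f : ratfun) : Prop :=
  forall z : R[i], 0 <= complex.Re z -> ~ is_pole f z.

Definition RHinf p m (M : 'M[ratfun]_(p, m)) : Prop :=
  forall i j, proper (M i j) /\ no_rhp_pole (M i j).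

Definition RH2 k (u : 'cV[ratfun]_k) : Prop :=
  forall i, strictly_proper (u i 0) /\ no_rhp_pole (u i 0).

(* The inner product inducing the H^2-norm, \int_R v(i w)^* u(i w) dw. For real
   rational u and v the integrand has an odd imaginary part, so that the
   integral is that of the real part. *)
Definition rh2_dot k (u v : 'cV[ratfun]_k) : R :=
  \int[mu]_(w in setT)
    \sum_(i < k) complex.Re (reval (u i 0) (Complex 0 w) *
                     conjc (reval (v i 0) (Complex 0 w))).

Definition rh2_norm k (u : 'cV[ratfun]_k) : R := Num.sqrt (rh2_dot u u).

Definition is_orth_proj k (S : set 'cV[ratfun]_k)
    (Pi : 'cV[ratfun]_k -> 'cV[ratfun]_k) : Prop :=
  forall u, RH2 u -> S (Pi u) /\ forall v, S v -> rh2_dot (u - Pi u) v = 0.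

Definition rh2_opnorm k (T : 'cV[ratfun]_k -> 'cV[ratfun]_k) : \bar R :=
  ereal_sup [set (rh2_norm (T u))%:E | u in [set u | RH2 u /\ rh2_norm u <= 1]].

Definition is_ncf p m (G : 'M[ratfun]_(p, m))
    (M : 'M[ratfun]_m) (N : 'M[ratfun]_(p, m)) : Prop :=
  [/\ RHinf M /\ RHinf N,
      [/\ M \in unitmx, forall i j, proper (invmx M i j) & G = N *m invmx M],
      exists (X : 'M[ratfun]_m) (Y : 'M[ratfun]_(m, p)),
        [/\ RHinf X, RHinf Y & X *m M + Y *m N = 1%:M] &
      map_mx rflip M^T *m M + map_mx rflip N^T *m N = 1%:M].

Definition is_ncf_proj p m (G : 'M[ratfun]_(p, m))
    (Pi : 'cV[ratfun]_(m + p) -> 'cV[ratfun]_(m + p)) : Prop :=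
  exists M N, is_ncf G M N /\
    is_orth_proj [set col_mx M N *m w | w in @RH2 m] Pi.

(* The value does not depend on the chosen factorizations. The default +oo,
   taken if no factorizations or projectors existed, makes an upper bound on
   the gap metric include their existence. *)
Definition gap_metric p m (G1 G2 : 'M[ratfun]_(p, m)) : \bar R :=
  xget +oo%E [set d | exists Pi1 Pi2,
    [/\ is_ncf_proj G1 Pi1, is_ncf_proj G2 Pi2 &
        d = rh2_opnorm (fun u => Pi1 u - Pi2 u)]].

Definition transfer N m p (A : 'M[R]_N) (B : 'M[R]_(N, m))
    (C : 'M[R]_(p, N)) (D : 'M[R]_(p, m)) : 'M[ratfun]_(p, m) :=
  map_mx rconst C *m invmx ((@tofrac _ 'X)%:M - map_mx rconst A)
    *m map_mx rconst B + map_mx rconst D.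

End RationalFunctions.

Section Reduction.
Variables (R : realType).

(* diag(-I_a, I_b) *)
Definition sgnmx a b : 'M[R]_(a + b) := block_mx (- 1%:M) 0 0 1%:M.

(* the r consecutive columns of M from (0-based) column k on *)
Definition colrange p n (k r : nat) (M : 'M[R]_(p, n)) : 'M[R]_(p, r) :=
  \matrix_(i, j) oapp (M i) 0 (insub (k + j)%N).

(* sv = [:: sigma_1; ...; sigma_h], mult = [:: n_1; ...; n_h] *)
Definition is_sv_list (n : nat) (sv : seq R) (mult : seq nat) : Prop :=
  [/\ sorted >%R sv, all (fun x => 0 <= x <= 1) sv,
      size mult = size sv, all (leq 1) mult & sumn mult = n].

Definition Sigma_minus n (sv : seq R) (mult : seq nat) : 'M[R]_n :=
  diag_seq n (repeat_seq sv mult).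

(* blocks in the order sigma_h, ..., sigma_1 *)
Definition Sigma_plus n (sv : seq R) (mult : seq nat) : 'M[R]_n :=
  diag_seq n (rev (repeat_seq sv mult)).

Definition is_eigendecomposition n (L U : 'M[R]_(n + n))
    (svm svp : seq R) (nm np : seq nat) : Prop :=
  [/\ is_sv_list n svm nm, is_sv_list n svp np, U^T *m U = 1%:M &
      L *m sgnmx n n *m L^T =
      U *m sgnmx n n *m block_mx (Sigma_minus n svm nm) 0 0
                                 (Sigma_plus n svp np) *m U^T].

Definition rank_trunc (q : nat) (mult : seq nat) : nat := sumn (take q mult).

(* 0-based: sv`_j is sigma_{j+1} *)
Definition admissible (svm svp : seq R) (qm qp : nat) : Prop :=
  [/\ (1 <= qm <= size svm)%N /\ (1 <= qp <= size svp)%N,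
      0 < svm`_qm.-1 /\ 0 < svp`_qp.-1,
      forall i j, (i < qp)%N -> (qm <= j < size svm)%N -> svm`_j != svp`_i &
      forall i j, (i < qm)%N -> (qp <= j < size svp)%N -> svp`_j != svm`_i].

Section Reduced.
Variables (n : nat) (L U : 'M[R]_(n + n)).
Variables (svm svp : seq R) (nm np : seq nat) (qm qp : nat).

Local Notation rm := (rank_trunc qm nm).
Local Notation rp := (rank_trunc qp np).

Definition Sigma1 : 'M[R]_(rm + rp) :=
  block_mx (Sigma_minus rm (take qm svm) (take qm nm)) 0
           0 (Sigma_plus rp (take qp svp) (take qp np)).

(* As 1/sqrt 0 = 0 here, taking entrywise inverse square roots of a diagonal
   matrix leaves the off-diagonal entries equal to 0. *)
Definition Sigma1_invsqrt : 'M[R]_(rm + rp) :=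
  map_mx (fun x => (Num.sqrt x)^-1) Sigma1.

(* first rm columns of U^-, last rp columns of U^+ *)
Definition U1 : 'M[R]_(n + n, rm + rp) :=
  row_mx (colrange 0 rm (lsubmx U)) (colrange (n - rp) rp (rsubmx U)).

Definition WT : 'M[R]_(rm + rp, n + n) :=
  Sigma1_invsqrt *m sgnmx rm rp *m U1^T *m L.

Definition Vmx : 'M[R]_(n + n, rm + rp) :=
  sgnmx n n *m L^T *m U1 *m Sigma1_invsqrt.

End Reduced.
End Reduction.

(* Main.v *)
(* Write [S = diag(-I, I)]. In the coordinates of the eigendecomposition the KYP
   inequality of [Pmin] and its mirror image under [S] say that both [Sigma] and
   its inverse are storage functions of the balanced system, whose input matrix
   is fixed by [S], [Sigma] and [Sigma^-1]. Compression to the kept coordinates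
   preserves this, which gives a) and b).

   For c), [(1 + G)^-1] maps [e = u + y] to [u]. Adding the dissipation inequality
   of [Sigma] along the difference and that of [sigma^2 Sigma^-1] along the sum of
   the trajectories of two consecutive truncations bounds the change of this map
   by the removed value [sigma]. A point [(u, y)] of the graph is determined by
   [e], hence the gap is at most twice the sum of the removed values.

   For d), [Pmin] is the available storage, obtained by value iteration for the
   Cayley-transformed system; this carries the minimality of [Pmin] over to
   [Sigma_1]. A definite minimal solution excludes unobservable subspaces, [S]
   exchanges observability and controllability, and prescribed end points are
   joined by polynomial trajectories. *)

Require Import Defs.
From HB Require Import structures.
From mathcomp Require Import polydiv polyrcf polyorder measurable_realfun.
From mathcomp Require Import ring lra zify.
Import Order.TTheory GRing.Theory Num.Theory.
Import numFieldNormedType.Exports.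
Local Open Scope classical_set_scope.
Local Open Scope ring_scope.
Set Implicit Arguments.
Unset Strict Implicit.
Unset Printing Implicit Defensive.

(** * Quadratic forms and the KYP inequality *)

Section Dot.
Variable R : realType.

(** Stability is never read off eigenvalues. A dissipation inequality evaluated at a point with
    positive real part bounds a transfer function there, and a bound at all but finitely many such
    points excludes poles in the closed half-plane. This is why [(1 + G)^-1] is compared and not
    [G], which may have poles on the imaginary axis.

    The main obstacle is that [Pmin] may be singular. The balancing map then is not invertible and
    does not intertwine the systems on the whole space; inverses become pseudo-inverses, and
    comparisons take place on the range of [S Pmin S], which is invariant under [A] and contains the
    range of [B].

    A bound on the gap metric includes the existence of normalized coprime factorizations and of
    projectors in a space that is not complete. The former come from a Riccati equation, solved by
    the value iteration that also yields the minimal KYP solution. The latter come from splitting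
    rational functions into stable and antistable parts; their orthogonality is Cauchy's theorem,
    obtained by partial fractions and real antiderivatives. *)

Definition dot N (x y : 'cV[R]_N) : R := (x^T *m y) 0 0.

Lemma dotE N (x y : 'cV[R]_N) : dot x y = \sum_i x i 0 * y i 0.
Proof. by rewrite /dot mxE; apply: eq_bigr => i _; rewrite mxE. Qed.

Lemma dotC N (x y : 'cV[R]_N) : dot x y = dot y x.
Proof. by rewrite !dotE; apply: eq_bigr => i _; rewrite mulrC. Qed.

Lemma dotDl N (x y z : 'cV[R]_N) : dot (x + y) z = dot x z + dot y z.
Proof. by rewrite /dot linearD mulmxDl mxE. Qed.

Lemma dotZl N a (x z : 'cV[R]_N) : dot (a *: x) z = a * dot x z.
Proof. by rewrite /dot linearZ -scalemxAl mxE. Qed.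

Lemma dotDr N (x y z : 'cV[R]_N) : dot z (x + y) = dot z x + dot z y.
Proof. by rewrite /dot mulmxDr mxE. Qed.

Lemma dotZr N a (x z : 'cV[R]_N) : dot z (a *: x) = a * dot z x.
Proof. by rewrite /dot -scalemxAr mxE. Qed.

Lemma dotNl N (x z : 'cV[R]_N) : dot (- x) z = - dot x z.
Proof. by rewrite -scaleN1r dotZl mulN1r. Qed.

Lemma dotNr N (x z : 'cV[R]_N) : dot z (- x) = - dot z x.
Proof. by rewrite -scaleN1r dotZr mulN1r. Qed.

Lemma dot0l N (z : 'cV[R]_N) : dot 0 z = 0.
Proof. by rewrite -[X in dot X _](scale0r 0) dotZl mul0r. Qed.

Lemma dot0r N (z : 'cV[R]_N) : dot z 0 = 0.
Proof. by rewrite dotC dot0l. Qed.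

Definition dot_lin := (dotDl, dotDr, dotNl, dotNr, dotZl, dotZr, dot0l, dot0r).

Lemma dot_mull N M (A : 'M[R]_(M, N)) (x : 'cV[R]_N) y :
  dot (A *m x) y = dot x (A^T *m y).
Proof. by rewrite /dot trmx_mul mulmxA. Qed.

Lemma dot_mulr N M (A : 'M[R]_(M, N)) (x : 'cV[R]_N) y :
  dot y (A *m x) = dot (A^T *m y) x.
Proof. by rewrite dot_mull trmxK. Qed.

Lemma qfE N (P : 'M[R]_N) x : (x^T *m P *m x) 0 0 = dot x (P *m x).
Proof. by rewrite /dot mulmxA. Qed.

Lemma dot_sym N (P : 'M[R]_N) x y : P^T = P ->
  dot x (P *m y) = dot y (P *m x).
Proof. by move=> sP; rewrite dot_mulr sP dotC. Qed.

Lemma dot_ge0 N (x : 'cV[R]_N) : 0 <= dot x x.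
Proof. by rewrite dotE sumr_ge0 // => i _; rewrite -expr2 sqr_ge0. Qed.

Lemma dot_eq0 N (x : 'cV[R]_N) : dot x x = 0 -> x = 0.
Proof.
rewrite dotE => /eqP; rewrite psumr_eq0; last first.
  by move=> i _; rewrite -expr2 sqr_ge0.
move=> /allP h; apply/colP => i; rewrite mxE.
by move: (h i (mem_index_enum _)); rewrite /= mulf_eq0 orbb => /eqP.
Qed.

Lemma dot_nondeg N (x : 'cV[R]_N) : (forall y, dot y x = 0) -> x = 0.
Proof. by move=> h; apply: dot_eq0. Qed.

Lemma dot_col_mx N M (x x' : 'cV[R]_N) (y y' : 'cV[R]_M) :
  dot (col_mx x y) (col_mx x' y') = dot x x' + dot y y'.
Proof. by rewrite /dot tr_col_mx mul_row_col mxE. Qed.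

(** Serves to test a form along [x + t *: y] for all real [t]: a cross term linear in [t] has to
    vanish. *)
Lemma linear_ge0 (a b : R) : (forall t, 0 <= a + t * b) -> b = 0.
Proof.
move=> h; apply/eqP; apply: contraT => b0.
have := h (- (a + 1) / b); rewrite divfK //; lra.
Qed.

Lemma psd_ker N (P : 'M[R]_N) x : P^T = P -> (forall y, 0 <= dot y (P *m y)) ->
  dot x (P *m x) = 0 -> P *m x = 0.
Proof.
move=> sP P0 Px0; apply: dot_nondeg => y.
have h t : 0 <= dot y (P *m y) + t * (2 * dot y (P *m x)).
  have := P0 (y + t *: x).
  rewrite mulmxDr -scalemxAr !dot_lin Px0 (dot_sym x y sP); lra.
by have := linear_ge0 h; lra.
Qed.

Lemma psdmx_dot N (P : 'M[R]_N) :
  psdmx P <-> P^T = P /\ forall x, 0 <= dot x (P *m x).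
Proof. by split=> -[sP h]; split=> // x; move: (h x); rewrite qfE. Qed.

Lemma pdmx_dot N (P : 'M[R]_N) :
  pdmx P <-> P^T = P /\ forall x, x != 0 -> 0 < dot x (P *m x).
Proof. by split=> -[sP h]; split=> // x /h; rewrite qfE. Qed.

Lemma pdmx_psd N (P : 'M[R]_N) : pdmx P -> psdmx P.
Proof.
move=> [sP h]; split=> // x; have [->|/h/ltW//] := eqVneq x 0.
by rewrite mulmx0 mxE.
Qed.

Lemma mxle_dot N (P Q : 'M[R]_N) : P^T = P -> Q^T = Q ->
  mxle P Q <-> forall x, dot x (P *m x) <= dot x (Q *m x).
Proof.
move=> sP sQ; rewrite /mxle psdmx_dot; split.
  by move=> [_ h] x; have := h x; rewrite mulmxBl !dot_lin subr_ge0.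
by move=> h; split=> [|x]; rewrite ?linearB/= ?sP ?sQ// mulmxBl !dot_lin subr_ge0.
Qed.

(** With zero feedthrough the lower right block vanishes, so semidefiniteness forces the
    off-diagonal block to vanish as well. What remains is a Lyapunov inequality and the equation
    [P *m B = C^T], the form in which the KYP inequality is used below. *)
Lemma nsd_kypP N m (A : 'M[R]_N) (B : 'M[R]_(N, m)) C P : P^T = P ->
  nsdmx (kyp A B C 0 P) <->
  (forall x, dot x (P *m (A *m x)) <= 0) /\ P *m B = C^T.
Proof.
move=> sP; rewrite /nsdmx /kyp trmx0 oppr0 addr0.
have E x v : dot (col_mx x v) (- block_mx (A^T *m P + P *m A) (P *m B - C^T)
    (B^T *m P - C) 0 *m col_mx x v) =
    - 2 * dot x (P *m (A *m x)) - 2 * dot x ((P *m B - C^T) *m v).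
  rewrite mulNmx mul_block_col opp_col_mx dot_col_mx mul0mx addr0.
  rewrite [(A^T *m P + P *m A) *m x]mulmxDl !dot_lin -!mulmxA.
  rewrite [dot x (A^T *m _)]dot_mulr trmxK [dot (A *m x) _](dot_sym _ _ sP).
  rewrite [dot v _]dotC dot_mull linearB /= trmx_mul trmxK sP; lra.
split.
- move=> /psdmx_dot[_ h].
  have hB : P *m B = C^T.
    apply/eqP; rewrite -subr_eq0; apply/eqP.
    apply/matrixP => i j; rewrite [RHS]mxE.
    have -> : (P *m B - C^T) i j =
        dot (delta_mx i 0) ((P *m B - C^T) *m delta_mx j 0).
      by rewrite -colE /dot trmx_delta -rowE !mxE.
    set x := delta_mx i 0; set v := delta_mx j 0.
    have hh t : 0 <= - 2 * dot x (P *m (A *m x)) +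
        t * (- 2 * dot x ((P *m B - C^T) *m v)).
      by have := h (col_mx x (t *: v)); rewrite E -scalemxAr dotZr; lra.
    by have := linear_ge0 hh; lra.
  split=> // x; have := h (col_mx x 0); rewrite E mulmx0 dot0r; lra.
- move=> [h hB]; apply/psdmx_dot; split.
    rewrite linearN /= tr_block_mx !linearB/= !linearD/= !trmx_mul !trmxK sP trmx0.
    by rewrite [P *m A + _]addrC.
  move=> xv; rewrite -[xv]vsubmxK E hB subrr mul0mx dot0r.
  by have := h (usubmx xv); lra.
Qed.

End Dot.

(** * Value iteration with quadratic value functions *)

Section Bellman.
Variable R : realType.

(** Completion of the square. The upper bound makes the block [c] negative semidefinite and forces
    [b] to vanish on its kernel, so [b = Z *m c]; the maximizer is [- (Z^T *m x)] and the maximum is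
    the generalized Schur complement [a - Z *m c *m Z^T]. *)
Lemma quadratic_max N m (H : 'M[R]_(N + m)) (Pup : 'M[R]_N) : H^T = H ->
  (forall x v, dot (col_mx x v) (H *m col_mx x v) <= dot x (Pup *m x)) ->
  exists P1 : 'M[R]_N, [/\ P1^T = P1,
    forall x v, dot (col_mx x v) (H *m col_mx x v) <= dot x (P1 *m x) &
    forall x, exists v, dot (col_mx x v) (H *m col_mx x v) = dot x (P1 *m x)].
Proof.
move=> sH up.
pose a := ulsubmx H; pose b := ursubmx H; pose c := drsubmx H.
have sa : a^T = a by rewrite /a -{1}sH -trmx_ulsub trmxK.
have sc : c^T = c by rewrite /c -{1}sH -trmx_drsub trmxK.
have sb : dlsubmx H = b^T by rewrite /b -[in RHS]sH -trmx_dlsub trmxK.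
have E x v : dot (col_mx x v) (H *m col_mx x v) =
    dot x (a *m x) + 2 * dot x (b *m v) + dot v (c *m v).
  rewrite -[H]submxK mul_block_col dot_col_mx -/a -/b -/c sb !dot_lin.
  rewrite [dot v (b^T *m x)]dotC dot_mull trmxK; lra.
have c0 v : 0 <= dot v (- c *m v).
  by have := up 0 v; rewrite E mulmx0 mulNmx !dot_lin; lra.
have kb (v : 'cV_m) : c *m v = 0 -> b *m v = 0.
  move=> cv; apply: dot_nondeg => x.
  have h t : 0 <= (dot x (Pup *m x) - dot x (a *m x)) + t * (- 2 * dot x (b *m v)).
    have := up x (t *: v); rewrite E -!scalemxAr cv scaler0 dot0r dotZr; lra.
  by have := linear_ge0 h; lra.
(* A kernel inclusion is a row space inclusion: [b] is tested on the columns of the cokernel of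
   [c]. *)
have /submxP[Z bZ] : (b <= c)%MS.
  rewrite submxE; apply/eqP/matrixP => i j.
  have /kb : c *m col j (cokermx c) = 0 by rewrite colE mulmxA mulmx_coker mul0mx.
  by rewrite colE mulmxA -colE => /colP /(_ i); rewrite !mxE.
have E2 x v : dot (col_mx x v) (H *m col_mx x v) =
    dot x ((a - Z *m c *m Z^T) *m x) - dot (v + Z^T *m x) (- c *m (v + Z^T *m x)).
  rewrite E bZ mulmxBl mulNmx mulmxDr !dot_lin -!mulmxA.
  rewrite (dot_mulr Z) (dot_mulr Z) [dot v (c *m (Z^T *m x))](dot_sym _ _ sc); lra.
exists (a - Z *m c *m Z^T); split.
- by rewrite linearB /= !trmx_mul trmxK sa sc mulmxA.
- by move=> x v; rewrite E2; have := c0 (v + Z^T *m x); lra.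
- by move=> x; exists (- (Z^T *m x)); rewrite E2 addNr mulmx0 dot0r subr0.
Qed.

(** The quadratic forms converge by monotonicity. By polarization every matrix entry is a
    combination of two of them, so the limit is again the form of a matrix. *)
Lemma symmx_cvg N (P : nat -> 'M[R]_N) (Pup : 'M[R]_N) :
  (forall k, (P k)^T = P k) ->
  (forall k x, dot x (P k *m x) <= dot x (P k.+1 *m x)) ->
  (forall k x, dot x (P k *m x) <= dot x (Pup *m x)) ->
  exists2 Q : 'M[R]_N, Q^T = Q &
    forall x, (fun k => dot x (P k *m x)) @ \oo --> dot x (Q *m x).
Proof.
move=> sP incr up.
have cq x : cvgn (fun k => dot x (P k *m x)).
  apply: nondecreasing_is_cvgn; first by apply/nondecreasing_seqP => k; exact: incr.
  by exists (dot x (Pup *m x)) => _ [k _ <-].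
have polar k i j : P k i j =
    (dot (delta_mx i 0 + delta_mx j 0) (P k *m (delta_mx i 0 + delta_mx j 0)) -
     dot (delta_mx i 0 - delta_mx j 0) (P k *m (delta_mx i 0 - delta_mx j 0))) / 4.
  rewrite !mulmxDr !mulmxN !dot_lin [dot (delta_mx j 0) (_ *m delta_mx i 0)](dot_sym _ _ (sP k)).
  have -> : P k i j = dot (delta_mx i 0) (P k *m delta_mx j 0).
    by rewrite -colE /dot trmx_delta -rowE !mxE.
  by lra.
have cP i j : cvgn (fun k => P k i j).
  under eq_fun do rewrite polar.
  apply: cvgP; apply: cvgM; last exact: cvg_cst.
  by apply: cvgB; [exact: (cq (delta_mx i 0 + delta_mx j 0))|
    exact: (cq (delta_mx i 0 - delta_mx j 0))].
exists (\matrix_(i, j) limn (fun k => P k i j)).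
  apply/matrixP => i j; rewrite !mxE.
  have -> // : (fun k => P k j i) = (fun k => P k i j).
  by apply/funext => k; rewrite -[in RHS](sP k) mxE.
move=> x; rewrite dotE; under eq_fun do rewrite dotE.
apply: cvg_big => [|i _]; first exact: add_continuous.
apply: cvgM; first exact: cvg_cst.
rewrite mxE; under eq_fun do rewrite mxE.
apply: cvg_big => [|j _]; first exact: add_continuous.
apply: cvgM; last exact: cvg_cst.
by rewrite mxE; exact: cP.
Qed.

Variables (N m : nat) (A : 'M[R]_N) (B : 'M[R]_(N, m)) (W : 'M[R]_(N + m)).
Hypothesis sW : W^T = W.

(** The implicit midpoint step [x_next - x = A *m (x_next + x) + B *m v], solved for the sum
    [x_next + x]. In discrete time one step of value iteration is the maximization of a quadratic
    form. *)
Definition cayley_mid (x : 'cV[R]_N) (v : 'cV[R]_m) : 'cV[R]_N :=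
  invmx (1%:M - A) *m (2 *: x + B *m v).

Definition cayley_next x v := cayley_mid x v - x.

(** The increment of a storage function over one step is half of its KYP quadratic form at the
    midpoint, whence the factor 1/2. *)
Definition stage_gain x v : R :=
  dot (col_mx (cayley_mid x v) v) (W *m col_mx (cayley_mid x v) v) / 2.

Definition bellman (P : 'M[R]_N) x v : R :=
  dot (cayley_next x v) (P *m cayley_next x v) + stage_gain x v.

Lemma bellman_quadratic P : P^T = P -> exists2 H : 'M[R]_(N + m), H^T = H &
  forall x v, bellman P x v = dot (col_mx x v) (H *m col_mx x v).
Proof.
move=> sP; pose J := invmx (1%:M - A).
pose X : 'M[R]_(N, N + m) := row_mx (2 *: J) (J *m B).
pose Y : 'M[R]_(N + m) := col_mx X (row_mx 0 1%:M).
pose E : 'M[R]_(N, N + m) := X - row_mx 1%:M 0.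
have XE x v : X *m col_mx x v = cayley_mid x v.
  by rewrite mul_row_col /cayley_mid -/J mulmxDr -scalemxAl -scalemxAr mulmxA.
have YE x v : Y *m col_mx x v = col_mx (cayley_mid x v) v.
  by rewrite mul_col_mx XE mul_row_col mul0mx mul1mx add0r.
have EE x v : E *m col_mx x v = cayley_next x v.
  by rewrite mulmxBl XE mul_row_col mul0mx mul1mx addr0.
exists (E^T *m P *m E + 2^-1 *: (Y^T *m W *m Y)).
  by rewrite linearD linearZ /= !trmx_mul !trmxK sP sW !mulmxA.
move=> x v; rewrite mulmxDl -scalemxAl !dot_lin -!mulmxA !(dot_mulr _^T) !trmxK.
by rewrite EE YE mulrC.
Qed.

(* With [xi] the midpoint [x + x_next], the increment of a storage function
   along the Cayley-transformed system is [xi^T P (A xi + B v)], so that the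
   continuous and the discrete dissipation inequality have the same solutions. *)
Lemma cayley_incr (x : 'cV[R]_N) v (P : 'M[R]_N) : 1%:M - A \in unitmx -> P^T = P ->
  dot (cayley_next x v) (P *m cayley_next x v) - dot x (P *m x) =
  dot (cayley_mid x v) (P *m (A *m cayley_mid x v + B *m v)).
Proof.
move=> uA sP; set xi := cayley_mid x v.
have -> : A *m xi + B *m v = xi - 2 *: x.
  have : (1%:M - A) *m xi = 2 *: x + B *m v by rewrite mulKVmx.
  rewrite mulmxBl mul1mx; move: (A *m xi) (B *m v) => a b h.
  by apply/colP => i; move/colP/(_ i): h; rewrite !mxE; lra.
rewrite /cayley_next -/xi !mulmxBr -scalemxAr !dot_lin (dot_sym x xi sP); lra.
Qed.

(** Value iteration from the subsolution [Plo] increases, stays below the supersolution [Pup] and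
    remains quadratic by [quadratic_max]. The last clause is a comparison principle: [g] need not be
    quadratic and [S] is any invariant set, so that trajectories in a subspace can be compared with
    another system. *)
Theorem bellman_fixpoint (Plo Pup : 'M[R]_N) : Plo^T = Plo -> Pup^T = Pup ->
  (forall x, dot x (Plo *m x) <= dot x (Pup *m x)) ->
  (forall x, exists v, dot x (Plo *m x) <= bellman Plo x v) ->
  (forall x v, bellman Pup x v <= dot x (Pup *m x)) ->
  exists P : 'M[R]_N,
  [/\ P^T = P, forall x, dot x (Plo *m x) <= dot x (P *m x) <= dot x (Pup *m x),
    forall x v, bellman P x v <= dot x (P *m x),
    forall x, exists v, bellman P x v = dot x (P *m x) &
    forall (S : 'cV[R]_N -> Prop) (g : 'cV[R]_N -> R),
      (forall x, S x -> dot x (Plo *m x) <= g x) ->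
      (forall x v, S x -> S (cayley_next x v) /\
         g (cayley_next x v) + stage_gain x v <= g x) ->
      forall x, S x -> dot x (P *m x) <= g x].
Proof.
move=> slo sup lo_up sub super.
pose bell P P1 := [/\ P1^T = P1, forall x v, bellman P x v <= dot x (P1 *m x) &
  forall x, exists v, bellman P x v = dot x (P1 *m x)].
(* [xget] selects the form of the one-step maximum; its default 0 is never met below [Pup]. *)
pose T P := xget 0 [set P1 | bell P P1]%classic.
have mono P P' x v : (forall x, dot x (P *m x) <= dot x (P' *m x)) ->
    bellman P x v <= bellman P' x v by move=> h; rewrite lerD2r.
have TP P : P^T = P -> (forall x, dot x (P *m x) <= dot x (Pup *m x)) -> bell P (T P).
  move=> sP up; have [H sH EH] := bellman_quadratic sP.
  have [|P1 [s1 h1 h1']] := @quadratic_max _ _ H Pup sH.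
    by move=> x v; rewrite -EH (le_trans (mono _ _ _ _ up)).
  apply: (@xgetPex _ 0 [set P1 | bell P P1]%classic); exists P1; split => //.
    by move=> x v; rewrite EH.
  by move=> x; have [v <-] := h1' x; exists v; rewrite EH.
pose Ps k := iter k T Plo.
have Pinv k : [/\ (Ps k)^T = Ps k, forall x, dot x (Ps k *m x) <= dot x (Pup *m x) &
    bell (Ps k) (Ps k.+1)].
  elim: k => [|k [sk upk [s1 h1 h1']]]; first by split=> //; exact: TP.
  have up1 x : dot x (Ps k.+1 *m x) <= dot x (Pup *m x).
    by have [v <-] := h1' x; rewrite (le_trans (mono _ _ _ _ upk)).
  by split=> //; exact: TP.
have incr k x : dot x (Ps k *m x) <= dot x (Ps k.+1 *m x).
  elim: k x => [|k IH] x.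
    have [_ _ [_ h _]] := Pinv 0%N; have [v hv] := sub x.
    by rewrite (le_trans hv).
  have [_ _ [_ _ /(_ x)[v <-]]] := Pinv k; have [_ _ [_ h _]] := Pinv k.+1.
  by rewrite (le_trans _ (h x v)) // mono.
have [| | |P sP cP] := @symmx_cvg N Ps Pup => //.
- by move=> k; have [] := Pinv k.
- by move=> k; have [] := Pinv k.
have leP k x : dot x (Ps k *m x) <= dot x (P *m x).
  rewrite -(cvg_lim _ (cP x)) //.
  apply: (@nondecreasing_cvgn_le _ (fun k => dot x (Ps k *m x))).
    by apply/nondecreasing_seqP => j; exact: incr.
  by apply: cvgP (cP x).
have Ple x b : (forall k, dot x (Ps k *m x) <= b) -> dot x (P *m x) <= b.
  move=> h; rewrite -(cvg_lim _ (cP x)) //; apply: limr_le; first exact: cvgP (cP x).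
  by apply: nearW.
have Psup x v : bellman P x v <= dot x (P *m x).
  suff : dot (cayley_next x v) (P *m cayley_next x v) <= dot x (P *m x) - stage_gain x v.
    by rewrite /bellman; lra.
  apply: Ple => k; have [_ _ [_ /(_ x v) h _]] := Pinv k.
  by move: h; rewrite /bellman; have := leP k.+1 x; lra.
have Pup' x : dot x (P *m x) <= dot x (Pup *m x).
  by apply: Ple => k; have [] := Pinv k.
exists P; split=> //.
- by move=> x; rewrite Pup' (leP 0%N).
(* The maximizer for [T P] works: every iterate lies below [T P], hence so does their limit [P]. *)
- move=> x; have [s1 h1 h1'] := TP P sP Pup'.
  have [v hv] := h1' x; exists v; apply/eqP; rewrite eq_le Psup /= hv.
  apply: Ple => -[|k]; last first.
    have [_ _ [_ _ /(_ x)[w <-]]] := Pinv k.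
    by rewrite (le_trans _ (h1 x w)) // mono.
  have [w /le_trans] := sub x; apply; rewrite (le_trans _ (h1 x w)) // mono // => y.
  exact: (leP 0%N).
- move=> S g g0 gS x Sx; apply: Ple => k.
  elim: k x Sx => [|k IH] x Sx; first exact: g0.
  have [_ _ [_ _ /(_ x)[v <-]]] := Pinv k.
  have [Sn] := gS x v Sx; apply: le_trans; rewrite /bellman lerD2r; exact: IH.
Qed.

End Bellman.

Section Riccati.
Variable R : realType.

(** * Minimal solutions as value functions *)

Lemma inj_unitmx (F : fieldType) N (M : 'M[F]_N) :
  (forall x : 'cV_N, M *m x = 0 -> x = 0) -> M \in unitmx.
Proof.
move=> h; rewrite -unitmx_tr -row_free_unit -kermx_eq0; apply/eqP/row_matrixP => i.
rewrite row0 -[row _ _]trmxK; apply: trmx_inj; rewrite trmxK trmx0; apply: h.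
by apply: trmx_inj; rewrite trmx_mul trmxK trmx0 -row_mul mulmx_ker row0.
Qed.

Definition dissipative N (P A : 'M[R]_N) := forall x, dot x (P *m (A *m x)) <= 0.

(** If [x = A *m x - B *m (C *m x)], then [x^T P x = x^T P A x - |C x|^2 <= 0], so [x = 0]. *)
Lemma dissipative_unit N m (P A : 'M[R]_N) (B : 'M[R]_(N, m)) (C : 'M[R]_(m, N)) :
  pdmx P -> dissipative P A -> P *m B = C^T -> 1%:M - A + B *m C \in unitmx.
Proof.
move=> /pdmx_dot[sP pP] dA BC; apply: inj_unitmx => x.
rewrite mulmxDl mulmxBl mul1mx => h; apply/eqP; apply: contraT => /pP.
have -> : x = A *m x - B *m (C *m x).
  rewrite mulmxA; move: (A *m x) (B *m C *m x) h => a b h.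
  by apply/colP => i; move/colP/(_ i): h; rewrite !mxE; lra.
set y := A *m x - _; have {2}-> : y = x.
  rewrite /y mulmxA; move: (A *m x) (B *m C *m x) h => a b h.
  by apply/colP => i; move/colP/(_ i): h; rewrite !mxE; lra.
rewrite (dot_sym _ _ sP) /y mulmxBr !dot_lin [P *m (B *m _)]mulmxA BC -dot_mull.
by have := dA x; have := dot_ge0 (C *m x); lra.
Qed.

Lemma dissipative_unit1 N (P A : 'M[R]_N) :
  pdmx P -> dissipative P A -> 1%:M - A \in unitmx.
Proof.
move=> pP dA.
have := @dissipative_unit N 0 P A 0 0 pP dA.
by rewrite mulmx0 mul0mx addr0 => -> //; apply/matrixP => i j; case: j.
Qed.

Lemma cayley_mid_eq N m (A : 'M[R]_N) (B : 'M[R]_(N, m)) x xi v :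
  1%:M - A \in unitmx -> (1%:M - A) *m xi = 2 *: x + B *m v ->
  cayley_mid A B x v = xi.
Proof. by move=> uA h; rewrite /cayley_mid -h mulKmx. Qed.

Lemma cayley_midK N m (A : 'M[R]_N) (B : 'M[R]_(N, m)) xi v :
  1%:M - A \in unitmx ->
  cayley_mid A B (2^-1 *: (xi - A *m xi - B *m v)) v = xi.
Proof.
move=> uA; apply: cayley_mid_eq => //.
by rewrite scalerA divff ?scale1r ?pnatr_eq0// subrK mulmxBl mul1mx.
Qed.

(** Linear-quadratic control by value iteration: the negative of the cost [(|C x|^2 + |v|^2) / 2] is
    maximized between the subsolution [- P] and the supersolution [0], and [X] is minus the limit.
    The Riccati residual [ric] is positive semidefinite because the limit is a supersolution, and
    attainment of the maximum makes it vanish on vectors that span the space. *)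
Theorem riccati N m (P A : 'M[R]_N) (B : 'M[R]_(N, m)) (C : 'M[R]_(m, N)) :
  pdmx P -> dissipative P A -> P *m B = C^T ->
  exists X : 'M[R]_N, [/\ X^T = X,
    forall x, 0 <= dot x (X *m x) <= dot x (P *m x) &
    A^T *m X + X *m A - X *m B *m B^T *m X + C^T *m C = 0].
Proof.
move=> pP dA BC; have /pdmx_dot[sP pP'] := pP.
have uA := dissipative_unit1 pP dA.
have uAC := dissipative_unit pP dA BC.
pose W : 'M[R]_(N + m) := block_mx (- (C^T *m C)) 0 0 (- 1%:M).
have sW : W^T = W by rewrite tr_block_mx !linearN /= trmx_mul !trmx1 !trmx0 trmxK.
have gE x v : stage_gain A B W x v =
    - (dot (C *m cayley_mid A B x v) (C *m cayley_mid A B x v) + dot v v) / 2.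
  rewrite /stage_gain; set xi := cayley_mid _ _ _ _.
  rewrite mul_block_col dot_col_mx !mul0mx addr0 add0r !mulNmx mul1mx !dot_lin.
  rewrite -!mulmxA [dot _ (C^T *m _)]dot_mulr trmxK; lra.
have bE Y x v : Y^T = Y -> bellman A B W Y x v - dot x (Y *m x) =
    dot (cayley_mid A B x v) (Y *m (A *m cayley_mid A B x v + B *m v)) -
    (dot (C *m cayley_mid A B x v) (C *m cayley_mid A B x v) + dot v v) / 2.
  by move=> sY; rewrite /bellman gE -(cayley_incr _ _ _ uA sY); lra.
have [||x|x|x v|Y [sY bY YB Yat _]] := bellman_fixpoint (A := A) (B := B) sW (Plo := - P) (Pup := 0).
- by rewrite linearN /= sP.
- by rewrite trmx0.
- rewrite mul0mx dot0r mulNmx dotNr oppr_le0.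
  by have [->|/pP'/ltW//] := eqVneq x 0; rewrite mulmx0 dot0r.
(* Output feedback [v = - C xi] shows that [- P] is a subsolution: the cost, here [|C xi|^2], equals
   the energy [- dot v (C *m xi)] that this input extracts. *)
- pose xi := invmx (1%:M - A + B *m C) *m (2 *: x); pose v := - (C *m xi).
  exists v.
  have mE : cayley_mid A B x v = xi.
    apply: cayley_mid_eq => //; have : (1%:M - A + B *m C) *m xi = 2 *: x by rewrite mulKVmx.
    rewrite mulmxDl -[B *m C *m xi]mulmxA => h; rewrite /v mulmxN -h addrK. by [].
  have := bE (- P) x v; rewrite linearN /= sP => /(_ erefl); rewrite mE.
  rewrite !mulNmx mulmxDr [P *m (B *m _)]mulmxA BC !dot_lin -dot_mull /v !dot_lin.
  by have := dA xi; lra.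
- have := bE 0 x v; rewrite trmx0 => /(_ erefl); rewrite !mul0mx !dot0r.
  have := dot_ge0 (C *m cayley_mid A B x v); have := dot_ge0 v; lra.
have [X XE] : exists X, X = - Y by exists (- Y).
have sX : X^T = X by rewrite XE linearN /= sY.
pose ric := A^T *m X + X *m A - X *m B *m B^T *m X + C^T *m C.
have sric : ric^T = ric.
  rewrite /ric !linearD /= linearN /= !trmx_mul !trmxK sX !mulmxA.
  by rewrite [A^T *m X + _]addrC.
have LE xi v : dot (C *m xi) (C *m xi) + dot v v + 2 * dot xi (X *m (A *m xi + B *m v)) =
    dot (v + B^T *m X *m xi) (v + B^T *m X *m xi) + dot xi (ric *m xi).
  rewrite /ric !(mulmxDl, mulmxBl) mulNmx !mulmxDr !dot_lin -!mulmxA.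
  rewrite [dot xi (A^T *m _)]dot_mulr [dot xi (C^T *m _)]dot_mulr !trmxK.
  rewrite [dot (A *m xi) _](dot_sym _ _ sX).
  rewrite [dot xi (X *m (B *m (B^T *m _)))]dot_mulr sX [dot (X *m xi) (B *m (B^T *m _))]dot_mulr.
  rewrite [dot xi (X *m (B *m v))]dot_mulr sX [dot (X *m xi) (B *m v)]dot_mulr.
  rewrite [dot (B^T *m _) v]dotC; lra.
have L0 xi v : 0 <= dot (C *m xi) (C *m xi) + dot v v + 2 * dot xi (X *m (A *m xi + B *m v)).
  have := bE Y (2^-1 *: (xi - A *m xi - B *m v)) v sY; rewrite cayley_midK //.
  have := YB (2^-1 *: (xi - A *m xi - B *m v)) v.
  by rewrite XE mulNmx dotNr; lra.
have ric0 xi : 0 <= dot xi (ric *m xi).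
  by have := L0 xi (- (B^T *m X *m xi)); rewrite LE addNr dot0l; lra.
(* Attainment forces [v = - B^T X xi], so [xi] solves the closed-loop equation for the given [x],
   and [ric] vanishes there. *)
have sur (x : 'cV[R]_N) : exists xi, (1%:M - A + B *m B^T *m X) *m xi = x /\ ric *m xi = 0.
  have [v hv] := Yat (2^-1 *: x).
  set xi := cayley_mid A B (2^-1 *: x) v.
  have : dot (C *m xi) (C *m xi) + dot v v + 2 * dot xi (X *m (A *m xi + B *m v)) = 0.
    by have := bE Y (2^-1 *: x) v sY; rewrite -/xi hv XE mulNmx dotNr; lra.
  rewrite LE; have := ric0 xi; have := dot_ge0 (v + B^T *m X *m xi) => h1 h2 h3.
  have /dot_eq0 h4 : dot (v + B^T *m X *m xi) (v + B^T *m X *m xi) = 0 by lra.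
  exists xi; split; last by apply: psd_ker => //; lra.
  have : (1%:M - A) *m xi = 2 *: (2^-1 *: x) + B *m v by rewrite mulKVmx.
  rewrite scalerA divff ?scale1r ?pnatr_eq0// => h; rewrite [LHS]mulmxDl h.
  by rewrite -!mulmxA -addrA -mulmxDr [B^T *m _]mulmxA h4 mulmx0 addr0.
exists X; split=> // [x|].
  by have /andP[] := bY x; rewrite XE !mulNmx mul0mx !dot_lin => ? ?; apply/andP; split; lra.
(* Solutions for the basis vectors, taken as columns, form an invertible [Z] with [ric *m Z = 0]. *)
have [f hf] := choice sur.
pose Z := \matrix_(i, j) f (delta_mx j 0) i 0.
have cZ j : col j Z = f (delta_mx j 0) by apply/colP => i; rewrite !mxE.
have GZ : (1%:M - A + B *m B^T *m X) *m Z = 1%:M.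
  apply/matrixP => i j; have := (hf (delta_mx j 0)).1.
  by rewrite -cZ colE mulmxA -colE => /colP/(_ i); rewrite !mxE eqxx andbT.
have RZ : ric *m Z = 0.
  apply/matrixP => i j; have := (hf (delta_mx j 0)).2.
  by rewrite -cZ colE mulmxA -colE => /colP/(_ i); rewrite !mxE.
have [_ uZ] := mulmx1_unit GZ.
by rewrite -/ric -[ric](mulmxK uZ) RZ mul0mx.
Qed.

(** Value iteration from [0] below [P] has a limit that solves the KYP inequality, hence dominates
    the minimal [P]. So [P] inherits the comparison principle of [bellman_fixpoint], which
    characterizes the available storage. *)
Lemma kyp_min_le N m (A P : 'M[R]_N) (B : 'M[R]_(N, m)) (C : 'M[R]_(m, N)) :
  1%:M - A \in unitmx -> is_kyp_min A B C 0 P ->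
  forall (S : 'cV[R]_N -> Prop) (g : 'cV[R]_N -> R),
    (forall x, S x -> 0 <= g x) ->
    (forall x v, S x -> S (cayley_next A B x v) /\
       g (cayley_next A B x v) - dot v (C *m cayley_mid A B x v) <= g x) ->
    forall x, S x -> dot x (P *m x) <= g x.
Proof.
move=> uA [/psdmx_dot[sP P0] kP minP] S g g0 gS x0 Sx.
have [dA BC] := (nsd_kypP A B C sP).1 kP.
pose W : 'M[R]_(N + m) := block_mx 0 (- C^T) (- C) 0.
have sW : W^T = W by rewrite tr_block_mx !linearN /= !trmx0 trmxK.
have gE x v : stage_gain A B W x v = - dot v (C *m cayley_mid A B x v).
  rewrite /stage_gain; set xi := cayley_mid _ _ _ _.
  rewrite mul_block_col dot_col_mx !mul0mx addr0 add0r !mulNmx !dot_lin.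
  by rewrite -dot_mull [dot (C *m xi) v]dotC; lra.
have bE Y x v : Y^T = Y -> bellman A B W Y x v - dot x (Y *m x) =
    dot (cayley_mid A B x v) (Y *m (A *m cayley_mid A B x v + B *m v)) -
    dot v (C *m cayley_mid A B x v).
  by move=> sY; rewrite /bellman gE -(cayley_incr _ _ _ uA sY); lra.
have [||z|z|z v|Y [sY bY YB _ leY]] := bellman_fixpoint (A := A) (B := B) sW (Plo := 0) (Pup := P).
- by rewrite trmx0.
- by [].
- by rewrite mul0mx dot0r P0.
- exists 0; rewrite /bellman gE !mul0mx !dot_lin; lra.
- have := bE P z v sP; rewrite mulmxDr [P *m (B *m v)]mulmxA BC dotDr -dot_mull.
  by have := dA (cayley_mid A B z v); rewrite [dot (C *m _) v]dotC; lra.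
have Ysup xi v : dot xi (Y *m (A *m xi + B *m v)) <= dot v (C *m xi).
  have := bE Y (2^-1 *: (xi - A *m xi - B *m v)) v sY; rewrite cayley_midK //.
  by have := YB (2^-1 *: (xi - A *m xi - B *m v)) v; lra.
have Y0 z : 0 <= dot z (Y *m z) by have := bY z; rewrite mul0mx dot0r => /andP[].
have kY : nsdmx (kyp A B C 0 Y).
  apply/nsd_kypP => //; split=> [z|].
    by have := Ysup z 0; rewrite mulmx0 addr0 dot0l.
  apply/eqP; rewrite -subr_eq0; apply/eqP/matrixP => i j; rewrite [RHS]mxE.
  have -> : (Y *m B - C^T) i j = dot (delta_mx i 0) ((Y *m B - C^T) *m delta_mx j 0).
    by rewrite -colE /dot trmx_delta -rowE !mxE.
  set z := delta_mx i 0; set v := delta_mx j 0.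
  have h t : 0 <= - dot z (Y *m (A *m z)) + t * - dot z ((Y *m B - C^T) *m v).
    have := Ysup z (t *: v); rewrite mulmxBl !mulmxDr -!scalemxAr !dot_lin -dot_mull.
    by rewrite -[Y *m B *m v]mulmxA [dot v _]dotC; lra.
  by have := linear_ge0 h; lra.
have psdY : psdmx Y by apply/psdmx_dot.
have := minP Y psdY kY; rewrite mxle_dot // => h.
rewrite (le_trans (h x0)) // (leY S) // => [z Sz|z v Sz].
  by rewrite mul0mx dot0r g0.
by rewrite gE; apply: gS.
Qed.

End Riccati.

(** * Truncation of balanced systems *)

Section Truncation.
Variable R : realType.

(* The two storage functions [Sigma] and its inverse [Theta] both satisfy the
   dissipation inequality. Apply the first to the difference and the second to
   the sum of the two trajectories: the defects of the truncated trajectory in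
   the removed coordinates cancel in the weighted sum of the two estimates. *)
Lemma truncation_step N m (Sg Th E E' A : 'M[R]_N) (B : 'M[R]_(N, m)) (s : R)
    (x x' : 'cV[R]_N) (u u' : 'cV[R]_m) :
  Sg^T = Sg -> Th^T = Th -> E^T = E -> Sg *m E = E *m Sg -> Th *m E = E *m Th ->
  Sg *m (E - E') = s *: (E - E') -> s ^+ 2 *: (Th *m (E - E')) = s *: (E - E') ->
  dissipative Sg A -> dissipative Th A -> Sg *m B = B -> Th *m B = B ->
  (E' *m E' = E') -> (E *m E' = E') -> E'^T = E' ->
  E *m x = x -> E' *m x' = x' ->
  dot (x - x') (Sg *m (E *m (A *m x + B *m u) - E' *m (A *m x' + B *m u'))) +
  s ^+ 2 * dot (x + x') (Th *m (E *m (A *m x + B *m u) + E' *m (A *m x' + B *m u')))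
  <= dot (B^T *m x - B^T *m x') (u - u') +
     s ^+ 2 * dot (B^T *m x + B^T *m x') (u + u').
Proof.
move=> sSg sTh sE cSg cTh KSg KTh dS dT SB TB E'E' EE' sE' Ex Ex'.
have Ex'2 : E *m x' = x' by rewrite -Ex' mulmxA EE'.
set a := A *m x + B *m u; set a' := A *m x' + B *m u'.
have Kx' w : dot x' ((E - E') *m w) = 0.
  rewrite dot_mulr linearB /= sE sE' -Ex' mulmxA mulmxBl EE' E'E' subrr.
  by rewrite mul0mx dot0l.
have XS w (y : 'cV_N) : E *m y = y -> dot y (Sg *m (E *m w)) = dot y (Sg *m w).
  by move=> Ey; rewrite mulmxA cSg -mulmxA dot_mulr sE Ey.
have XT w (y : 'cV_N) : E *m y = y -> dot y (Th *m (E *m w)) = dot y (Th *m w).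
  by move=> Ey; rewrite mulmxA cTh -mulmxA dot_mulr sE Ey.
have ES : dot (x - x') (Sg *m (E *m a - E' *m a')) =
    dot (x - x') (Sg *m (a - a')) + s * dot x ((E - E') *m a').
  have -> : E *m a - E' *m a' = E *m (a - a') + (E - E') *m a'.
    by rewrite mulmxBr mulmxBl addrA subrK.
  rewrite mulmxDr dotDr XS; last by rewrite mulmxBr Ex Ex'2.
  congr (_ + _); rewrite mulmxA KSg -scalemxAl dotZr dotDl dotNl Kx'.
  by rewrite subr0.
have ET : s ^+ 2 * dot (x + x') (Th *m (E *m a + E' *m a')) =
    s ^+ 2 * dot (x + x') (Th *m (a + a')) - s * dot x ((E - E') *m a').
  have -> : E *m a + E' *m a' = E *m (a + a') - (E - E') *m a'.
    by rewrite mulmxDr mulmxBl opprB -addrA [E *m a' + _]addrC subrK.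
  rewrite mulmxBr dotDr XT; last by rewrite mulmxDr Ex Ex'2.
  rewrite mulrDr; congr (_ + _); rewrite dotNr mulrN; congr (- _).
  by rewrite -[LHS]dotZr mulmxA scalemxAl KTh -scalemxAl dotZr dotDl Kx' addr0.
rewrite ES ET.
have -> : a - a' = A *m (x - x') + B *m (u - u').
  by rewrite !mulmxBr /a /a' opprD addrACA.
have -> : a + a' = A *m (x + x') + B *m (u + u').
  by rewrite !mulmxDr /a /a' addrACA.
have hS := dS (x - x'); have hT := dT (x + x').
rewrite -mulmxBr -mulmxDr !dot_mull trmxK.
rewrite [Sg *m (_ + _)]mulmxDr [Th *m (_ + _)]mulmxDr [Sg *m (B *m _)]mulmxA.
rewrite [Th *m (B *m _)]mulmxA SB TB.
move: (B *m (u - u')) (B *m (u + u')) hS hT => b1 b2.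
rewrite [dot _ (_ + b1)]dotDr [dot _ (_ + b2)]dotDr => hS hT.
have := mulr_ge0_le0 (sqr_ge0 s) hT; lra.
Qed.

(** For [z = al + i om] this is the real part of the Hermitian form of [P] between [x] and [z x];
    the frequency [om] drops out because [P] is symmetric. *)
Lemma frequency_energy N (P : 'M[R]_N) al om (xr xi : 'cV[R]_N) :
  P^T = P ->
  dot xr (P *m (al *: xr - om *: xi)) + dot xi (P *m (al *: xi + om *: xr)) =
  al * (dot xr (P *m xr) + dot xi (P *m xi)).
Proof.
by move=> sP; rewrite !(mulmxDr, mulmxN) -!scalemxAr !dot_lin (dot_sym xi xr sP); lra.
Qed.

(* With [y = e - u] the sum of the dissipation inequalities over real and
   imaginary part reads [|u - u'|^2 <= s^2 (2 e - (u + u')) . (u + u')]. *)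
Lemma truncation_bound N m (Sg Th E E' A : 'M[R]_N) (B : 'M[R]_(N, m)) (s al om : R)
    (xr xr' xi xi' : 'cV[R]_N) (ur ur' ui ui' er ei : 'cV[R]_m) :
  Sg^T = Sg -> Th^T = Th -> E^T = E -> Sg *m E = E *m Sg -> Th *m E = E *m Th ->
  Sg *m (E - E') = s *: (E - E') -> s ^+ 2 *: (Th *m (E - E')) = s *: (E - E') ->
  dissipative Sg A -> dissipative Th A -> Sg *m B = B -> Th *m B = B ->
  (E' *m E' = E') -> (E *m E' = E') -> E'^T = E' ->
  (forall x, 0 <= dot x (Sg *m x)) -> (forall x, 0 <= dot x (Th *m x)) -> 0 <= al ->
  E *m xr = xr -> E' *m xr' = xr' -> E *m xi = xi -> E' *m xi' = xi' ->
  al *: xr - om *: xi = E *m (A *m xr + B *m ur) ->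
  al *: xi + om *: xr = E *m (A *m xi + B *m ui) ->
  al *: xr' - om *: xi' = E' *m (A *m xr' + B *m ur') ->
  al *: xi' + om *: xr' = E' *m (A *m xi' + B *m ui') ->
  ur + B^T *m xr = er -> ui + B^T *m xi = ei ->
  ur' + B^T *m xr' = er -> ui' + B^T *m xi' = ei ->
  dot (ur - ur') (ur - ur') + dot (ui - ui') (ui - ui') <=
  s ^+ 2 * (dot er er + dot ei ei).
Proof.
move=> sSg sTh sE cSg cTh KSg KTh dS dT SB TB E'E' EE' sE' Sg0 Th0 al0 Exr Exr' Exi Exi'.
move=> hr hi hr' hi' er1 ei1 er2 ei2.
have tr := truncation_step ur ur' sSg sTh sE cSg cTh KSg KTh dS dT SB TB E'E' EE' sE' Exr Exr'.
have ti := truncation_step ui ui' sSg sTh sE cSg cTh KSg KTh dS dT SB TB E'E' EE' sE' Exi Exi'.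
move: tr ti; rewrite -hr -hr' -hi -hi'.
have L (a b c d : 'cV[R]_N) : al *: a - om *: b - (al *: c - om *: d) =
    al *: (a - c) - om *: (b - d).
  by apply/colP => i; rewrite !mxE; ring.
have L1 (a b c d : 'cV[R]_N) : al *: a + om *: b - (al *: c + om *: d) =
    al *: (a - c) + om *: (b - d).
  by apply/colP => i; rewrite !mxE; ring.
have L2 (a b c d : 'cV[R]_N) : al *: a - om *: b + (al *: c - om *: d) =
    al *: (a + c) - om *: (b + d).
  by apply/colP => i; rewrite !mxE; ring.
have L3 (a b c d : 'cV[R]_N) : al *: a + om *: b + (al *: c + om *: d) =
    al *: (a + c) + om *: (b + d).
  by apply/colP => i; rewrite !mxE; ring.
rewrite L L1 L2 L3 => tr ti.
have fS := frequency_energy al om (xr - xr') (xi - xi') sSg.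
have fT := frequency_energy al om (xr + xr') (xi + xi') sTh.
have pS : 0 <= al * (dot (xr - xr') (Sg *m (xr - xr')) + dot (xi - xi') (Sg *m (xi - xi'))).
  by rewrite mulr_ge0 ?addr_ge0.
have pT : 0 <= s ^+ 2 * (al * (dot (xr + xr') (Th *m (xr + xr')) + dot (xi + xi') (Th *m (xi + xi')))).
  by rewrite mulr_ge0 ?sqr_ge0 ?mulr_ge0 ?addr_ge0.
rewrite -fT -{1}fS in pS pT; move: tr ti pS pT; rewrite mulrDr.
have Y (a b c : 'cV[R]_m) : a + b = c -> b = c - a by move=> <-; rewrite addrC addKr.
rewrite (Y _ _ _ er1) (Y _ _ _ ei1) (Y _ _ _ er2) (Y _ _ _ ei2).
have D1 (a b c : 'cV[R]_m) : dot (c - a - (c - b)) (a - b) = - dot (a - b) (a - b).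
  by rewrite opprB addrC addrA subrK -[b - a]opprB dotNl.
have D2 (a b c : 'cV[R]_m) : dot (c - a + (c - b)) (a + b) =
    dot c c - dot (c - (a + b)) (c - (a + b)).
  by rewrite !dot_lin [dot a c]dotC [dot b c]dotC [dot b a]dotC; ring.
rewrite !D1 !D2 !mulrDr !mulrN.
have := mulr_ge0 (sqr_ge0 s) (dot_ge0 (er - (ur + ur'))).
have := mulr_ge0 (sqr_ge0 s) (dot_ge0 (ei - (ui + ui'))).
lra.
Qed.

Lemma passive_bound N m (P A : 'M[R]_N) (B : 'M[R]_(N, m)) (C : 'M[R]_(m, N)) (al om : R)
    (xr xi : 'cV[R]_N) (ur ui : 'cV[R]_m) :
  P^T = P -> dissipative P A -> P *m B = C^T ->
  al *: xr - om *: xi = A *m xr + B *m ur ->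
  al *: xi + om *: xr = A *m xi + B *m ui ->
  al * (dot xr (P *m xr) + dot xi (P *m xi)) <= dot ur (C *m xr) + dot ui (C *m xi).
Proof.
move=> sP dA BC hr hi; rewrite -(frequency_energy _ om _ _ sP) hr hi.
rewrite !mulmxDr !dotDr [P *m (B *m ur)]mulmxA [P *m (B *m ui)]mulmxA BC -!dot_mull.
rewrite [dot (C *m xr) _]dotC [dot (C *m xi) _]dotC.
by have := dA xr; have := dA xi; lra.
Qed.

End Truncation.

(** * Balancing a sign-symmetric system *)

Section Balanced.
Variable R : realType.
Variables (N m : nat) (A P L U : 'M[R]_N) (B : 'M[R]_(N, m)) (s d : 'rV[R]_N).
Let S := diag_mx s.
Let Sg := diag_mx d.
Hypothesis s_sign : forall i, s 0 i = 1 \/ s 0 i = -1.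
Hypothesis d_ge0 : forall i, 0 <= d 0 i.
Hypothesis SAS : S *m A *m S = A^T.
Hypothesis SB : S *m B = B.
Hypothesis PL : P = L^T *m L.
Hypothesis dA : dissipative P A.
Hypothesis PB : P *m B = B.
Hypothesis oU : U^T *m U = 1%:M.
Hypothesis eig : L *m S *m L^T = U *m S *m Sg *m U^T.

(** As the square root and the inverse of 0 are 0, this is the square root of the pseudo-inverse of
    [Sg]. Cancelling it against [Sg] leaves the projector [bal_supp] in place of the identity. *)
Definition inv_sqrt_diag : 'M[R]_N := diag_mx (\row_i (Num.sqrt (d 0 i))^-1).
Local Notation Hm := inv_sqrt_diag.
Definition bal_V := S *m L^T *m U *m Hm.
Definition bal_W := Hm *m S *m U^T *m L.
Definition bal_A := bal_W *m A *m bal_V.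
Definition bal_B := bal_W *m B.
Definition bal_supp : 'M[R]_N := diag_mx (\row_i (d 0 i != 0)%:R).
Local Notation V := bal_V.
Local Notation W := bal_W.
Local Notation Ah := bal_A.
Local Notation Bh := bal_B.

Lemma diag_mx_tr n (v : 'rV[R]_n) : (diag_mx v)^T = diag_mx v.
Proof. by rewrite tr_diag_mx. Qed.

Lemma bal_SS : S *m S = 1%:M.
Proof.
rewrite mulmx_diag; apply/matrixP => i j; rewrite !mxE; congr (_ *+ _).
by have [h|h] := s_sign i; move: h => /= ->; rewrite ?mulrNN mul1r.
Qed.

Let sS : S^T = S. Proof. exact: diag_mx_tr. Qed.
Let sSg : Sg^T = Sg. Proof. exact: diag_mx_tr. Qed.
Let sH : Hm^T = Hm. Proof. exact: diag_mx_tr. Qed.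
Let SSg : S *m Sg = Sg *m S. Proof. exact: diag_mxC. Qed.
Let HS : Hm *m S = S *m Hm. Proof. exact: diag_mxC. Qed.
Let HSg : Hm *m Sg = Sg *m Hm. Proof. exact: diag_mxC. Qed.
Let sP : P^T = P. Proof. by rewrite PL trmx_mul trmxK. Qed.

Let HSH : Hm *m Sg *m Hm = bal_supp.
Proof.
rewrite /Sg !mulmx_diag; apply/matrixP => i j; rewrite !mxE; congr (_ *+ _).
have [->|dj] := eqVneq (d 0 i) 0; first by rewrite mulr0 mul0r.
have dp : 0 < d 0 i by rewrite lt_neqAle eq_sym dj d_ge0.
have sd : Num.sqrt (d 0 i) != 0 by rewrite gt_eqF ?sqrtr_gt0.
by rewrite -[X in _ * X * _]sqr_sqrtr// expr2 mulrA mulVf// mul1r divff.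
Qed.

Let eigr p (T : 'M[R]_(N, p)) :
  L *m (S *m (L^T *m T)) = U *m (S *m (Sg *m (U^T *m T))).
Proof. by rewrite !mulmxA eig. Qed.
Let UUr p (T : 'M[R]_(N, p)) : U^T *m (U *m T) = T.
Proof. by rewrite mulmxA oU mul1mx. Qed.
Let SSr p (T : 'M[R]_(N, p)) : S *m (S *m T) = T.
Proof. by rewrite mulmxA bal_SS mul1mx. Qed.

Lemma bal_W_V : W *m V = bal_supp.
Proof.
by rewrite /W /V -!mulmxA eigr !UUr SSr -HSH -!mulmxA.
Qed.

(** [W] and [V] are adjoint with respect to [Sg] and [P]; this carries the dissipation inequality of
    [P] over to [Sg]. *)
Lemma bal_Sg_W : Sg *m W = V^T *m P.
Proof.
rewrite /W /V !trmx_mul trmxK sS sH PL -!mulmxA eigr.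
rewrite UUr !mulmxA -HSg. congr (_ *m _ *m _). by rewrite -!mulmxA SSg.
Qed.

Lemma bal_SAS : S *m Ah *m S = Ah^T.
Proof.
rewrite /Ah /W /V !trmx_mul !trmxK sS sH.
have ASt p (T : 'M[R]_(N, p)) : A *m (S *m T) = S *m (A^T *m T).
  by rewrite -SAS !mulmxA bal_SS mul1mx.
have SHS p (T : 'M[R]_(N, p)) : S *m (Hm *m (S *m T)) = Hm *m T.
  by rewrite [Hm *m (S *m T)]mulmxA HS -mulmxA SSr.
by rewrite -!mulmxA SHS ASt HS.
Qed.

(** For [b = U^T L B] the eigendecomposition gives [S Sg b = b]. A row of sign -1 then satisfies
    [(1 + d) b = 0] and vanishes, so [S] fixes [b]. *)
Let LB : S *m (U^T *m (L *m B)) = U^T *m (L *m B).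
Proof.
have e : S *m (Sg *m (U^T *m (L *m B))) = U^T *m (L *m B).
  have := eigr (L *m B); rewrite [L^T *m _]mulmxA -PL PB SB => /(congr1 (mulmx U^T)).
  by rewrite UUr => <-.
apply/matrixP => i j; move/matrixP/(_ i j): e.
rewrite !mul_diag_mx !mxE; set x := \sum_ _ _.
have [h|h] := s_sign i; rewrite h ?mul1r// !mulN1r => e.
have := d_ge0 i => di; have : (1 + d 0 i) * x = 0 by lra.
by move/eqP; rewrite mulf_eq0 => /orP[/eqP|/eqP ->]; [lra|rewrite oppr0].
Qed.

Lemma bal_S_B : S *m Bh = Bh.
Proof. by rewrite /Bh /W -!mulmxA LB mulmxA -HS -mulmxA LB. Qed.

Lemma bal_V_B : V^T *m B = Bh.
Proof.
by rewrite /Bh /W /V !trmx_mul trmxK sS sH -!mulmxA SB LB.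
Qed.

Lemma bal_Sg_B : Sg *m Bh = Bh.
Proof. by rewrite {1}/Bh mulmxA bal_Sg_W -mulmxA PB bal_V_B. Qed.

Lemma bal_dissipative : dissipative Sg Ah.
Proof.
move=> x; have := dA (V *m x).
by rewrite dot_mull !mulmxA -bal_Sg_W /Ah -!mulmxA.
Qed.

(** With [y] the pseudo-inverse of [Sg] applied to [x], the inequality of [bal_dissipative] at [S y]
    reads [y^T Sg Ah^T y <= 0] by [bal_SAS]. After transposition [Ah Sg y] equals [Ah x], since [Ah]
    sees only the support of [Sg]. *)
Lemma bal_dissipative_inv : dissipative (Hm *m Hm) Ah.
Proof.
move=> x; pose y := Hm *m (Hm *m x).
have hS : S *m (Sg *m (Ah *m (S *m y))) = Sg *m (Ah^T *m y).
  by rewrite -bal_SAS !mulmxA SSg.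
have := bal_dissipative (S *m y); rewrite dot_mull sS hS.
have Ey : Hm *m (Sg *m y) = Hm *m x.
  rewrite /y; have : Hm *m (Sg *m (Hm *m (Hm *m x))) = bal_supp *m (Hm *m x).
    by rewrite -HSH -!mulmxA.
  move=> ->; rewrite mulmxA; congr (_ *m _); rewrite mulmx_diag.
  apply/matrixP => i j; rewrite !mxE; congr (_ *+ _).
  by have [->|_] := eqVneq (d 0 i) 0; rewrite ?sqrtr0 ?invr0 ?mulr0 ?mul1r.
suff -> : dot y (Sg *m (Ah^T *m y)) = dot x (Hm *m Hm *m (Ah *m x)) by [].
rewrite dot_mulr sSg dot_mulr trmxK dotC.
have -> : Ah *m (Sg *m y) = Ah *m x by rewrite /Ah /V -!mulmxA Ey.
by rewrite -mulmxA [RHS]dot_mulr sH [RHS]dot_mulr sH.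
Qed.

Lemma bal_Hsupp : bal_supp *m Hm = Hm.
Proof.
rewrite mulmx_diag; apply/matrixP => i j; rewrite !mxE; congr (_ *+ _).
by have [->|_] := eqVneq (d 0 i) 0; rewrite ?sqrtr0 ?invr0 ?mulr0 ?mul1r.
Qed.

Lemma bal_inv_B : Hm *m Hm *m Bh = Bh.
Proof.
rewrite -[in LHS]bal_Sg_B !mulmxA -[_ *m Hm *m Sg]mulmxA HSg mulmxA HSH.
by rewrite /Bh /W -!mulmxA mulmxA bal_Hsupp.
Qed.

(* Although [ker (V W)] is not [A]-invariant in general, [P] annihilates
   [(1 - V W) Q], and the kernel of [P] is [A]-invariant and unobservable. *)
Lemma bal_PZ : P *m (V *m W) *m (S *m P *m S) = P *m (S *m P *m S).
Proof.
rewrite PL /V /W -!mulmxA eigr; congr (_ *m _).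
rewrite UUr eigr.
have e p (T : 'M[R]_(N, p)) : Sg *m (Hm *m (Hm *m (S *m (S *m (Sg *m T))))) = Sg *m T.
  rewrite SSr [Hm *m (Sg *m T)]mulmxA HSg -[Sg *m Hm *m T]mulmxA.
  rewrite [Hm *m (Sg *m _)]mulmxA HSg -[Sg *m Hm *m _]mulmxA.
  rewrite !mulmxA; congr (_ *m _); rewrite /Sg !mulmx_diag; apply/matrixP => i j; rewrite !mxE.
  congr (_ *+ _); have [->|dj] := eqVneq (d 0 i) 0; first by rewrite !mul0r.
  have dp : 0 < d 0 i by rewrite lt_neqAle eq_sym dj d_ge0.
  have sd : Num.sqrt (d 0 i) != 0 by rewrite gt_eqF ?sqrtr_gt0.
  have := sqr_sqrtr (d_ge0 i); set r := Num.sqrt _ => <-; field.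
  exact: sd.
by rewrite UUr e.
Qed.

(** The form of [-(P A + A^T P)] is positive semidefinite and vanishes at [z], so [z] lies in its
    kernel; as [A^T P z = 0], this leaves [P A z = 0]. *)
Lemma dissipative_ker (z : 'cV[R]_N) : P *m z = 0 -> P *m (A *m z) = 0.
Proof.
move=> Pz; pose M := - (P *m A + A^T *m P).
have sM : M^T = M.
  by rewrite /M linearN /= linearD /= !trmx_mul trmxK sP addrC.
have ME x : dot x (M *m x) = - 2 * dot x (P *m (A *m x)).
  rewrite mulNmx mulmxDl !dot_lin -!mulmxA [dot x (A^T *m _)]dot_mulr trmxK.
  by rewrite [dot (A *m x) _](dot_sym _ _ sP); lra.
have M0 x : 0 <= dot x (M *m x) by rewrite ME; have := dA x; lra.
have /(psd_ker sM M0) : dot z (M *m z) = 0.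
  by rewrite ME dot_mulr sP Pz dot0l mulr0.
rewrite mulNmx mulmxDl -!mulmxA Pz mulmx0 addr0 => /eqP.
by rewrite oppr_eq0 => /eqP.
Qed.

(** [W] factors through [L], which vanishes on the kernel of [P]; by [dissipative_ker] this kernel
    absorbs the error term of [bal_PZ] also after application of [A]. *)
Lemma bal_W_invariant :
  W *m A *m (V *m W) *m (S *m P *m S) = W *m A *m (S *m P *m S).
Proof.
apply/eqP; rewrite -subr_eq0 -[X in X - _]mulmxA -mulmxBr; apply/eqP.
set Z := _ - _.
have PZ : P *m Z = 0.
  by rewrite /Z mulmxBr; have := bal_PZ; rewrite -[X in X = _ -> _]mulmxA => ->; exact: subrr.
have LAZ : L *m (A *m Z) = 0.
  apply/matrixP => i j.
  have Pc : P *m col j Z = 0 by rewrite colE mulmxA PZ mul0mx.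
  have h : L *m (A *m col j Z) = 0.
    apply: dot_eq0; have := dissipative_ker Pc; rewrite PL => h.
    by rewrite dot_mull [L^T *m _]mulmxA h dot0r.
  by move: h; rewrite colE !mulmxA -colE => /colP/(_ i); rewrite !mxE.
by rewrite /W -!mulmxA LAZ !mulmx0.
Qed.

End Balanced.

(** * Evaluation of rational functions *)

Section Rational.
Variable R : realType.
Notation F := (ratfun R).
Notation tf := (@FracField.tofrac {poly R}).
Notation C := (R[i]).
Notation pev := (@polyC_eval R).

Lemma frac_repr (f : F) : f * tf (frac (repr f)).2 = tf (frac (repr f)).1.
Proof.
have d0 := denom_ratioP (repr f).
rewrite -{1}[f]reprK; unlock FracField.tofrac; rewrite -[LHS]FracField.pi_mul.
apply/eqmodP => /=; rewrite FracField.equivfE /FracField.mulf.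
by rewrite !numden_Ratio ?oner_neq0 ?mulr1 ?mulrA// mulrC.
Qed.

Lemma frac_den_neq0 (f : F) : (frac (repr f)).2 != 0.
Proof. exact: denom_ratioP. Qed.

Lemma rnumE (f : F) : rnum f = (frac (repr f)).1 %/ gcdp (frac (repr f)).1 (frac (repr f)).2.
Proof. by rewrite /rnum; case: (frac _). Qed.

Lemma rdenE (f : F) : rden f = (frac (repr f)).2 %/ gcdp (frac (repr f)).1 (frac (repr f)).2.
Proof. by rewrite /rden; case: (frac _). Qed.

Lemma rden_neq0 (f : F) : rden f != 0.
Proof.
rewrite rdenE; set p := _.1; set q := _.2.
have q0 : q != 0 := frac_den_neq0 f.
have : q %/ gcdp p q * gcdp p q != 0 by rewrite divpK ?dvdp_gcdr.
by apply: contraNneq => ->; rewrite mul0r.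
Qed.

Lemma rnum_rden (f : F) : f * tf (rden f) = tf (rnum f).
Proof.
have := frac_repr f; rewrite rnumE rdenE; set p := _.1; set q := _.2 => e.
have q0 : q != 0 := frac_den_neq0 f.
have g0 : gcdp p q != 0 by rewrite gcdp_eq0 negb_and q0 orbT.
apply: (@mulIf _ (tf (gcdp p q))); first by rewrite tofrac_eq0.
by rewrite -mulrA -!rmorphM /= !divpK ?dvdp_gcdl ?dvdp_gcdr.
Qed.

Lemma rnum_coprime (f : F) : coprimep (rnum f) (rden f).
Proof.
rewrite rnumE rdenE coprimep_div_gcd//; apply/orP; right; exact: frac_den_neq0.
Qed.

Lemma rat_cross (f : F) p q : f * tf q = tf p -> rnum f * q = p * rden f.
Proof.
move=> e; apply/eqP; rewrite -(tofrac_eq (R := {poly R})) !rmorphM /= -rnum_rden -e.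
by apply/eqP; ring.
Qed.

Lemma rden_dvd (f : F) p q : f * tf q = tf p -> rden f %| q.
Proof.
move=> /rat_cross e; have := rnum_coprime f; rewrite coprimep_sym => h.
by rewrite -(Gauss_dvdpr _ h) e dvdp_mull.
Qed.

Lemma pev0 z : pev 0 z = 0. Proof. by rewrite /polyC_eval rmorph0 horner0. Qed.
Lemma pev1 z : pev 1 z = 1. Proof. by rewrite /polyC_eval rmorph1 hornerC. Qed.
Lemma pevD p q z : pev (p + q) z = pev p z + pev q z.
Proof. by rewrite /polyC_eval rmorphD hornerD. Qed.
Lemma pevN p z : pev (- p) z = - pev p z.
Proof. by rewrite /polyC_eval rmorphN hornerN. Qed.
Lemma pevM p q z : pev (p * q) z = pev p z * pev q z.
Proof. by rewrite /polyC_eval rmorphM hornerM. Qed.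
Lemma pevC a z : pev a%:P z = real_complex R a.
Proof. by rewrite /polyC_eval map_polyC hornerC. Qed.
Lemma pevX z : pev 'X z = z.
Proof. by rewrite /polyC_eval map_polyX hornerX. Qed.

Definition regular z (f : F) := pev (rden f) z != 0.

Lemma not_pole z f : ~ is_pole f z <-> regular z f.
Proof. by rewrite /is_pole; split=> [/eqP|/eqP]. Qed.

(** The reduced denominator divides every denominator, so any representation whose denominator does
    not vanish at [z] may be evaluated. The rules below for sums and products thereby become
    polynomial identities. *)
Lemma regular_frac z f p q : pev q z != 0 -> f * tf q = tf p ->
  regular z f /\ reval f z = pev p z / pev q z.
Proof.
move=> q0 e; have /dvdpP[r rE] := rden_dvd e.
have d0 : pev (rden f) z != 0.
  by apply: contraNneq q0 => d0; rewrite rE pevM d0 mulr0.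
split=> //; apply/eqP; rewrite eqr_div//; apply/eqP; rewrite -!pevM.
by rewrite (rat_cross e).
Qed.

Lemma reval_rden z f : regular z f -> reval f z * pev (rden f) z = pev (rnum f) z.
Proof. by move=> h; rewrite /reval divfK. Qed.

Lemma regularC z a : regular z (rconst a) /\ reval (rconst a) z = real_complex R a.
Proof.
have [||h ->] := @regular_frac z (rconst a) a%:P 1.
- by rewrite pev1 oner_neq0.
- by rewrite rmorph1 mulr1.
- by rewrite pev1 divr1 pevC.
Qed.

Lemma regularX z : regular z (tf 'X) /\ reval (tf 'X) z = z.
Proof.
have [||h ->] := @regular_frac z (tf 'X) 'X 1.
- by rewrite pev1 oner_neq0.
- by rewrite rmorph1 mulr1.
- by rewrite pev1 divr1 pevX.
Qed.

Lemma regularD z f g : regular z f -> regular z g ->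
  regular z (f + g) /\ reval (f + g) z = reval f z + reval g z.
Proof.
move=> hf hg; have := @regular_frac z (f + g)
  (rnum f * rden g + rnum g * rden f) (rden f * rden g).
rewrite pevM mulf_neq0// => /(_ isT) [|r ->].
  by rewrite rmorphD !rmorphM /= -!rnum_rden; ring.
split=> //; rewrite pevD !pevM -(reval_rden hf) -(reval_rden hg).
by field; apply/andP.
Qed.

Lemma regularM z f g : regular z f -> regular z g ->
  regular z (f * g) /\ reval (f * g) z = reval f z * reval g z.
Proof.
move=> hf hg; have := @regular_frac z (f * g) (rnum f * rnum g) (rden f * rden g).
rewrite pevM mulf_neq0// => /(_ isT) [|r ->].
  by rewrite !rmorphM /= -!rnum_rden; ring.
split=> //; rewrite !pevM -(reval_rden hf) -(reval_rden hg).
by field; apply/andP.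
Qed.

Lemma regularN z f : regular z f -> regular z (- f) /\ reval (- f) z = - reval f z.
Proof.
move=> hf; have := @regular_frac z (- f) (- rnum f) (rden f).
case=> // [|r ->]; first by rewrite rmorphN /= -rnum_rden mulNr.
by split=> //; rewrite pevN mulNr.
Qed.

Lemma regular0 z : regular z (0 : F) /\ reval (0 : F) z = 0.
Proof.
have [||h ->] := @regular_frac z 0 0 1.
- by rewrite pev1 oner_neq0.
- by rewrite mul0r rmorph0.
- by rewrite pev0 mul0r.
Qed.

Lemma regular_sum z (I : Type) (r : seq I) (f : I -> F) : (forall i, regular z (f i)) ->
  regular z (\sum_(i <- r) f i) /\ reval (\sum_(i <- r) f i) z = \sum_(i <- r) reval (f i) z.
Proof.
move=> h; elim: r => [|i r [IH IHe]]; first by rewrite !big_nil; exact: regular0.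
by rewrite !big_cons; have [? ->] := regularD (h i) IH; rewrite IHe.
Qed.

Definition regmx z p q (M : 'M[F]_(p, q)) := forall i j, regular z (M i j).
Definition evmx z p q (M : 'M[F]_(p, q)) : 'M[C]_(p, q) := map_mx (fun f => reval f z) M.

Lemma regmxM z p q r (M : 'M[F]_(p, q)) (N : 'M[F]_(q, r)) : regmx z M -> regmx z N ->
  regmx z (M *m N) /\ evmx z (M *m N) = evmx z M *m evmx z N.
Proof.
move=> hM hN.
have h i j : regular z ((M *m N) i j) /\
    reval ((M *m N) i j) z = \sum_k reval (M i k) z * reval (N k j) z.
  rewrite mxE; have [|rs ->] := @regular_sum z _ (index_enum _) (fun k => M i k * N k j).
    by move=> k; have [] := regularM (hM i k) (hN k j).
  by split=> //; apply: eq_bigr => k _; have [_ ->] := regularM (hM i k) (hN k j).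
split=> [i j|]; first by have [] := h i j.
apply/matrixP => i j; rewrite !mxE; have [_] := h i j; rewrite mxE => ->.
by apply: eq_bigr => k _; rewrite !mxE.
Qed.

Lemma regmxD z p q (M N : 'M[F]_(p, q)) : regmx z M -> regmx z N ->
  regmx z (M + N) /\ evmx z (M + N) = evmx z M + evmx z N.
Proof.
move=> hM hN; split=> [i j|]; first by rewrite mxE; have [] := regularD (hM i j) (hN i j).
by apply/matrixP => i j; rewrite !mxE; have [_ ->] := regularD (hM i j) (hN i j).
Qed.

Lemma regmxN z p q (M : 'M[F]_(p, q)) : regmx z M ->
  regmx z (- M) /\ evmx z (- M) = - evmx z M.
Proof.
move=> hM; split=> [i j|]; first by rewrite mxE; have [] := regularN (hM i j).
by apply/matrixP => i j; rewrite !mxE; have [_ ->] := regularN (hM i j).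
Qed.

Lemma regmx_const z p q (M : 'M[R]_(p, q)) :
  regmx z (map_mx (@rconst R) M) /\ evmx z (map_mx (@rconst R) M) = map_mx (real_complex R) M.
Proof.
split=> [i j|]; first by rewrite mxE; have [] := regularC z (M i j).
by apply/matrixP => i j; rewrite !mxE; have [_ ->] := regularC z (M i j).
Qed.

Lemma regmx_1 z n : regmx z (1%:M : 'M[F]_n) /\ evmx z (1%:M : 'M[F]_n) = 1%:M.
Proof.
have := @regmx_const z n n 1%:M.
have -> : map_mx (@rconst R) 1%:M = 1%:M :> 'M[F]_n.
  by apply/matrixP => i j; rewrite !mxE /rconst; case: eqP => _; rewrite ?polyC0 ?rmorph0 ?rmorph1.
by rewrite map_mx1.
Qed.

Lemma regmx_scaleX z p q (M : 'M[F]_(p, q)) : regmx z M ->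
  regmx z (tf 'X *: M) /\ evmx z (tf 'X *: M) = z *: evmx z M.
Proof.
move=> hM; have [rX eX] := regularX z.
split=> [i j|]; first by rewrite mxE; have [] := regularM rX (hM i j).
by apply/matrixP => i j; rewrite !mxE; have [_ ->] := regularM rX (hM i j); rewrite eX.
Qed.

(** Validity off the zeros of one nonzero real polynomial, hence off a finite set. Finite
    conjunctions are handled by multiplying the polynomials, so all entries involved may be taken
    regular at once. *)
Definition generic (Q : C -> Prop) :=
  exists2 p : {poly R}, p != 0 & forall z, pev p z != 0 -> Q z.

Lemma genericI Q Q' : generic Q -> generic Q' -> generic (fun z => Q z /\ Q' z).
Proof.
move=> [p p0 hp] [q q0 hq]; exists (p * q); first by rewrite mulf_neq0.
by move=> z; rewrite pevM mulf_eq0 negb_or => /andP[/hp ? /hq].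
Qed.

Lemma genericW (Q Q' : C -> Prop) : (forall z, Q z -> Q' z) -> generic Q -> generic Q'.
Proof. by move=> h [p p0 hp]; exists p => // z /hp/h. Qed.

Lemma generic_regular f : generic (fun z => regular z f).
Proof. by exists (rden f); rewrite ?rden_neq0. Qed.

Lemma generic_all (I : finType) (Q : I -> C -> Prop) :
  (forall i, generic (Q i)) -> generic (fun z => forall i, Q i z).
Proof.
move=> h; suff [p p0 hp] : generic (fun z => forall i, i \in enum I -> Q i z).
  by exists p => // z /hp hz i; apply: hz; rewrite mem_enum.
elim: (enum I) => [|i s [p p0 hp]]; first by exists 1; rewrite ?oner_neq0.
have [q q0 hq] := h i; exists (p * q); first by rewrite mulf_neq0.
move=> z; rewrite pevM mulf_eq0 negb_or => /andP[/hp hz /hq hi] j.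
by rewrite inE => /orP[/eqP ->//|/hz].
Qed.

Lemma generic_regmx p q (M : 'M[F]_(p, q)) : generic (fun z => regmx z M).
Proof. by apply: generic_all => i; apply: generic_all => j; exact: generic_regular. Qed.

End Rational.

(** * Real polynomials along rays in the complex plane *)

Section ComplexParts.
Variable R : realType.
Notation C := (R[i]).
Notation re := (@complex.Re R).
Notation im := (@complex.Im R).
Notation rc := (real_complex R).

Lemma cReD (x y : C) : re (x + y) = re x + re y. Proof. by case: x; case: y. Qed.
Lemma cImD (x y : C) : im (x + y) = im x + im y. Proof. by case: x; case: y. Qed.
Lemma cReN (x : C) : re (- x) = - re x. Proof. by case: x. Qed.
Lemma cImN (x : C) : im (- x) = - im x. Proof. by case: x. Qed.
Lemma cReM (x y : C) : re (x * y) = re x * re y - im x * im y.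
Proof. by case: x; case: y. Qed.
Lemma cImM (x y : C) : im (x * y) = re x * im y + im x * re y.
Proof. by case: x => a b; case: y => c d /=; ring. Qed.
Lemma cRe_rc a : re (rc a) = a. Proof. by []. Qed.
Lemma cIm_rc a : im (rc a) = 0. Proof. by []. Qed.

Definition ReImE := (cReD, cImD, cReN, cImN, cReM, cImM, cRe_rc, cIm_rc).

Lemma complexP (x y : C) : re x = re y -> im x = im y -> x = y.
Proof. by case: x => a b; case: y => c d /= -> ->. Qed.

Lemma cRe_sum I (r : seq I) (f : I -> C) :
  re (\sum_(i <- r) f i) = \sum_(i <- r) re (f i).
Proof. exact: (big_morph _ cReD). Qed.
Lemma cIm_sum I (r : seq I) (f : I -> C) :
  im (\sum_(i <- r) f i) = \sum_(i <- r) im (f i).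
Proof. exact: (big_morph _ cImD). Qed.

Lemma Re_horner (Q : {poly C}) t : re Q.[rc t] = (map_poly re Q).[t].
Proof.
rewrite horner_coef /map_poly horner_poly cRe_sum; apply: eq_bigr => i _.
by rewrite cReM -rmorphXn /= mulr0 subr0.
Qed.

Lemma Im_horner (Q : {poly C}) t : im Q.[rc t] = (map_poly im Q).[t].
Proof.
rewrite horner_coef /map_poly horner_poly cIm_sum; apply: eq_bigr => i _.
by rewrite cImM -rmorphXn /= mulr0 add0r.
Qed.

Definition sqnorm (z : C) : R := re z ^+ 2 + im z ^+ 2.

Lemma sqnorm_ge0 z : 0 <= sqnorm z.
Proof. by rewrite addr_ge0 ?sqr_ge0. Qed.

Lemma sqnormM x y : sqnorm (x * y) = sqnorm x * sqnorm y.
Proof. by rewrite /sqnorm !ReImE; ring. Qed.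

Lemma sqnorm_eq0 z : (sqnorm z == 0) = (z == 0).
Proof.
rewrite /sqnorm paddr_eq0 ?sqr_ge0// !sqrf_eq0.
by case: z => a b /=; rewrite eq_complex.
Qed.

Lemma sqnorm_gt0 z : (0 < sqnorm z) = (z != 0).
Proof. by rewrite lt0r sqnorm_eq0 sqnorm_ge0 andbT. Qed.

Lemma sqnorm_rc a : sqnorm (rc a) = a ^+ 2.
Proof. by rewrite /sqnorm /= expr0n addr0. Qed.

(** [|p (z0 + t)|^2] as a real polynomial in the real variable [t]; a limit [t -> 0] is then
    continuity of a polynomial. *)
Definition line_sq (z0 : C) (p : {poly R}) : {poly R} :=
  let Q := map_poly rc p \Po ('X + z0%:P) in
  map_poly re Q ^+ 2 + map_poly im Q ^+ 2.

Lemma line_sqE z0 p t : (line_sq z0 p).[t] = sqnorm (polyC_eval p (z0 + rc t)).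
Proof.
rewrite /line_sq /polyC_eval /sqnorm hornerD !horner_exp -Re_horner -Im_horner.
by rewrite horner_comp !hornerE [rc t + z0]addrC.
Qed.

Lemma poly_nonroot (p : {poly R}) (a : R) : p != 0 -> 0 < a ->
  exists2 t, 0 < t < a & p.[t] != 0.
Proof.
move=> p0 a0; apply: contrapT => h.
(* These [size p] points of the open interval outnumber the possible roots of [p]. *)
pose s := [seq a / (i.+2)%:R | i <- iota 0 (size p)].
have us : uniq s.
  rewrite map_inj_uniq ?iota_uniq// => i j /(mulfI (lt0r_neq0 a0)) /invr_inj /eqP.
  by rewrite eqr_nat => /eqP [].
have := max_poly_roots p0 _ us; rewrite size_map size_iota ltnn => hh.
suff : false by []; apply: hh; apply/allP => _ /mapP[i _ ->]; apply/negPn/negP => r.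
apply: h; exists (a / i.+2%:R) => //; rewrite divr_gt0//=.
by rewrite ltr_pdivrMr// ltr_pMr// ltr1n.
Qed.

Lemma line_sq_neq0 z0 p : p != 0 -> line_sq z0 p != 0.
Proof.
move=> p0; apply/eqP => h.
pose Q := map_poly rc p \Po ('X + z0%:P).
have Q0 t : Q.[rc t] = 0.
  apply/eqP; rewrite -sqnorm_eq0; have := line_sqE z0 p t.
  by rewrite h horner0 /polyC_eval /Q horner_comp !hornerE [rc t + z0]addrC => <-.
have Qn : Q != 0.
  apply: contraNneq p0 => Q00.
  have : Q \Po ('X - z0%:P) = map_poly rc p.
    by rewrite /Q -comp_polyA comp_polyD comp_polyX comp_polyC subrK comp_polyXr.
  by rewrite Q00 comp_poly0 => /esym/eqP; rewrite map_poly_eq0.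
pose s := [seq rc i%:R | i <- iota 0 (size Q)].
have us : uniq s.
  rewrite map_inj_uniq ?iota_uniq// => i j /complexI /eqP.
  by rewrite eqr_nat => /eqP.
have := max_poly_roots Qn _ us; rewrite size_map size_iota ltnn => hh.
suff : false by []; apply: hh; apply/allP => _ /mapP[i _ ->].
by rewrite /root Q0.
Qed.

Lemma poly_ge0_at0 (e h : {poly R}) : e != 0 ->
  (forall t, 0 < t -> e.[t] != 0 -> 0 <= h.[t]) -> 0 <= h.[0].
Proof.
move=> e0 hp; rewrite leNgt; apply/negP => h0.
have [|d d0 hd] := @poly_cont _ 0 h (- h.[0]); first by rewrite oppr_gt0.
have [t /andP[t0 td] et] := poly_nonroot e0 d0.
have := hp t t0 et; have := hd t; rewrite subr0 gtr0_norm// => /(_ td).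
rewrite ltr_norml => /andP[_]; lra.
Qed.

End ComplexParts.

(** * Half-plane bounds imply stability and properness *)

Section Bounded.
Variable R : realType.
Notation F := (ratfun R).
Notation C := (R[i]).
Notation re := (@complex.Re R).
Notation rc := (real_complex R).
Notation pev := (@polyC_eval R).

Lemma pev_rc (p : {poly R}) t : pev p (rc t) = rc p.[t].
Proof. by rewrite /polyC_eval horner_map. Qed.

Lemma sqnorm_reval z (f : F) : regular z f ->
  sqnorm (pev (rnum f) z) = sqnorm (reval f z) * sqnorm (pev (rden f) z).
Proof. by move=> h; rewrite -sqnormM reval_rden. Qed.

(* Both sides of [|num|^2 <= c |den|^2] are polynomial along rays, so the bound
   extends to the closed half-plane, where coprimality rules out a zero of the
   denominator. *)
Lemma bounded_ineq (f : F) c (z0 : C) : 0 <= re z0 ->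
  generic (fun z => 0 < re z -> sqnorm (reval f z) <= c) ->
  sqnorm (pev (rnum f) z0) <= c * sqnorm (pev (rden f) z0).
Proof.
move=> z00 [p p0 hp].
pose e := line_sq z0 (p * rden f).
pose h := c *: line_sq z0 (rden f) - line_sq z0 (rnum f).
have e0 : e != 0 by rewrite line_sq_neq0// mulf_neq0// rden_neq0.
have hE t : h.[t] = c * sqnorm (pev (rden f) (z0 + rc t)) - sqnorm (pev (rnum f) (z0 + rc t)).
  by rewrite /h hornerD hornerN hornerZ !line_sqE.
suff : 0 <= h.[0] by rewrite hE rmorph0 addr0 subr_ge0.
apply: (poly_ge0_at0 e0) => t t0.
rewrite line_sqE sqnorm_eq0 pevM mulf_eq0 negb_or => /andP[/hp hz hd].
rewrite hE subr_ge0 sqnorm_reval//.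
by rewrite ler_wpM2r ?sqnorm_ge0// hz// cReD /= ltr_wpDl.
Qed.

Lemma bounded_no_rhp_pole (f : F) c :
  generic (fun z => 0 < re z -> sqnorm (reval f z) <= c) -> no_rhp_pole f.
Proof.
move=> hf z z0 /eqP; rewrite -sqnorm_eq0 => /eqP d0.
have := bounded_ineq z0 hf; rewrite d0 mulr0 => h.
have /eqP : sqnorm (pev (rnum f) z) = 0 by apply/le_anti; rewrite h sqnorm_ge0.
rewrite sqnorm_eq0 => /eqP n0; move/eqP: d0; rewrite sqnorm_eq0 => /eqP d0.
have /Bezout_eq1_coprimepP[[u v] /= uv] := rnum_coprime f.
have := congr1 (fun p => pev p z) uv; rewrite pevD !pevM n0 d0 !mulr0 addr0 pev1.
by move/eqP; rewrite eq_sym oner_eq0.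
Qed.

(** A numerator of larger degree would make [rnum f ^+ 2 - c *: rden f ^+ 2] positive at all large
    real arguments, against the bound at a generic one. *)
Lemma bounded_proper (f : F) c x0 :
  generic (fun z => forall x, z = rc x -> x0 < x -> sqnorm (reval f z) <= c) ->
  proper f.
Proof.
move=> [p p0 hp]; rewrite /proper leqNgt; apply/negP => ltd.
pose h := rnum f ^+ 2 - c *: rden f ^+ 2.
have nn0 : rnum f != 0 by rewrite -size_poly_gt0 (leq_ltn_trans _ ltd).
have lh : lead_coef h = lead_coef (rnum f) ^+ 2.
  rewrite /h lead_coefDl ?lead_coef_exp// size_polyN.
  rewrite (leq_ltn_trans (size_scale_leq _ _))//.
  have sz (q : {poly R}) : q != 0 -> size (q ^+ 2) = ((size q).-1 * 2).+1.
    by move=> q0; rewrite -size_exp prednK// size_poly_gt0 expf_neq0.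
  rewrite !sz ?rden_neq0// ltnS ltn_mul2r /=.
  have : (0 < size (rden f))%N by rewrite size_poly_gt0 rden_neq0.
  by move: ltd; case: (size (rden f)) => // a; case: (size (rnum f)).
have lh0 : 0 < lead_coef h by rewrite lh exprn_even_gt0 //= lead_coef_eq0.
have [x1 hx1] := poly_pinfty_gt_lc lh0.
pose e := (p * rden f) \Po ('X + (Num.max x0 x1)%:P).
have e0 : e != 0.
  apply/eqP => e0.
  have : e \Po ('X - (Num.max x0 x1)%:P) = p * rden f.
    by rewrite /e -comp_polyA comp_polyD comp_polyX comp_polyC subrK comp_polyXr.
  rewrite e0 comp_poly0 => /esym/eqP.
  by rewrite mulf_eq0 (negbTE p0) (negbTE (rden_neq0 f)).
have [t /andP[t0 _] et] := poly_nonroot e0 ltr01.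
pose x := t + Num.max x0 x1.
have xx0 : x0 < x by rewrite /x (le_lt_trans (_ : _ <= Num.max x0 x1)) ?le_max ?lexx// ltrDr.
have xx1 : x1 <= x by rewrite /x (le_trans (_ : _ <= Num.max x0 x1)) ?le_max ?lexx ?orbT// lerDr ltW.
move: et; rewrite /e horner_comp !hornerE mulf_eq0 negb_or -/x => /andP[px dx].
have := hp (rc x); rewrite pev_rc fmorph_eq0 px => /(_ isT) /(_ x erefl xx0) hb.
have rx : regular (rc x) f by rewrite /regular pev_rc fmorph_eq0.
have := sqnorm_reval rx; rewrite !pev_rc !sqnorm_rc => hE.
have := lt_le_trans lh0 (hx1 x xx1).
rewrite /h hornerD hornerN hornerZ !horner_exp hE.
have := ler_wpM2r (sqr_ge0 (rden f).[x]) hb; lra.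
Qed.

End Bounded.

(** * Constants and paraconjugation as ring morphisms *)

Section RatMorphisms.
Variable R : realType.
Notation F := (ratfun R).
Notation tf := (@FracField.tofrac {poly R}).
Notation pev := (@polyC_eval R).

Lemma rconst_is_zmod_morphism : zmod_morphism (@rconst R).
Proof. by move=> a b; rewrite /rconst polyCB rmorphB. Qed.
Lemma rconst_is_monoid_morphism : monoid_morphism (@rconst R).
Proof. by split=> [|a b]; rewrite /rconst ?rmorph1// polyCM rmorphM. Qed.
HB.instance Definition _ := GRing.isZmodMorphism.Build R (ratfun R) (@rconst R)
  rconst_is_zmod_morphism.
HB.instance Definition _ := GRing.isMonoidMorphism.Build R (ratfun R) (@rconst R)
  rconst_is_monoid_morphism.

Lemma comp_polyNXK (p : {poly R}) : (p \Po - 'X) \Po - 'X = p.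
Proof.
by rewrite -comp_polyA -[- 'X]scaleN1r comp_polyZ comp_polyX scalerA mulrNN mulr1 scale1r
  comp_polyXr.
Qed.

Lemma comp_polyNX_eq0 (p : {poly R}) : (p \Po - 'X == 0) = (p == 0).
Proof.
apply/eqP/eqP => [h|->]; last by rewrite comp_poly0.
by rewrite -[p]comp_polyNXK h comp_poly0.
Qed.

Lemma pev_flip (p : {poly R}) z : pev (p \Po - 'X) z = pev p (- z).
Proof.
by rewrite /polyC_eval map_comp_poly rmorphN /= map_polyX horner_comp hornerN hornerX.
Qed.

(** Independence of the representing fraction, from which the morphism laws of [rflip] follow by
    cross-multiplication. *)
Lemma rflip_frac (f : F) p q : f * tf q = tf p ->
  rflip f * tf (q \Po - 'X) = tf (p \Po - 'X).
Proof.
move=> /rat_cross e; rewrite /rflip.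
have d0 : tf (rden f \Po - 'X) != 0 by rewrite tofrac_eq0 comp_polyNX_eq0 rden_neq0.
apply: (mulIf d0); rewrite mulrAC divfK//.
by rewrite -!rmorphM /= e.
Qed.

Lemma rflip_def (f : F) p q : q != 0 -> f * tf q = tf p ->
  rflip f = tf (p \Po - 'X) / tf (q \Po - 'X).
Proof.
move=> q0 /rflip_frac <-.
by rewrite mulfK// tofrac_eq0 comp_polyNX_eq0.
Qed.

Let comp_poly1 (q : {poly R}) : 1 \Po q = 1.
Proof. by rewrite -polyC1 comp_polyC. Qed.
Let fp (p : {poly R}) : F := tf (p \Po - 'X).
Let fpM p q : fp (p * q) = fp p * fp q.
Proof. by rewrite /fp comp_polyM tofracM. Qed.
Let fpB p q : fp (p - q) = fp p - fp q.
Proof. by rewrite /fp comp_polyB tofracB. Qed.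
Let fp_neq0 p : p != 0 -> fp p != 0.
Proof. by rewrite /fp tofrac_eq0 comp_polyNX_eq0. Qed.
Let flipE (f : F) : rflip f * fp (rden f) = fp (rnum f).
Proof. exact: rflip_frac (rnum_rden f). Qed.

Lemma rflip_is_zmod_morphism : zmod_morphism (@rflip R).
Proof.
move=> f g; have := @rflip_frac (f - g) (rnum f * rden g - rnum g * rden f) (rden f * rden g).
rewrite tofracB !tofracM -!rnum_rden => /(_ _)/wrap[]; first by ring.
rewrite -!/(fp _) fpB !fpM -!flipE => h.
apply: (@mulIf _ (fp (rden f) * fp (rden g))).
  by rewrite mulf_neq0 ?fp_neq0 ?rden_neq0.
by rewrite h; ring.
Qed.

Lemma rflip_is_monoid_morphism : monoid_morphism (@rflip R).
Proof.
split=> [|f g].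
  rewrite (@rflip_def 1 1 1) ?oner_neq0 ?rmorph1 ?mulr1//.
  by rewrite ?comp_poly1 ?rmorph1 divr1.
have := @rflip_frac (f * g) (rnum f * rnum g) (rden f * rden g).
rewrite !tofracM -!rnum_rden => /(_ _)/wrap[]; first by ring.
rewrite -!/(fp _) !fpM -!flipE => h.
apply: (@mulIf _ (fp (rden f) * fp (rden g))).
  by rewrite mulf_neq0 ?fp_neq0 ?rden_neq0.
by rewrite h; ring.
Qed.
HB.instance Definition _ := GRing.isZmodMorphism.Build (ratfun R) (ratfun R) (@rflip R)
  rflip_is_zmod_morphism.
HB.instance Definition _ := GRing.isMonoidMorphism.Build (ratfun R) (ratfun R) (@rflip R)
  rflip_is_monoid_morphism.

Lemma rflip_const a : rflip (rconst a) = rconst a :> F.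
Proof.
rewrite (@rflip_def _ a%:P 1) ?oner_neq0 ?rmorph1 ?mulr1//.
by rewrite comp_polyC ?comp_poly1 ?rmorph1 divr1.
Qed.

Lemma rflip_X : rflip (tf 'X) = - tf 'X.
Proof.
rewrite (@rflip_def _ 'X 1) ?oner_neq0 ?rmorph1 ?mulr1//.
by rewrite comp_polyX ?comp_poly1 ?rmorph1 divr1 rmorphN.
Qed.

Lemma rflip_regular z (f : F) : regular (- z) f ->
  regular z (rflip f) /\ reval (rflip f) z = reval f (- z).
Proof.
move=> h; have e := rflip_frac (rnum_rden f).
have [|r ->] := regular_frac (z := z) _ e; first by rewrite pev_flip.
by split=> //; rewrite !pev_flip.
Qed.

End RatMorphisms.

(** * Rational trajectories and their values *)

Section Resolvent.
Variable R : realType.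
Notation F := (ratfun R).
Notation tf := (@FracField.tofrac {poly R}).
Notation C := (R[i]).
Notation re := (@complex.Re R).
Notation im := (@complex.Im R).
Notation rc := (real_complex R).
Notation lift := (map_mx (@rconst R)).
Notation reM := (map_mx (@complex.Re R)).
Notation imM := (map_mx (@complex.Im R)).

Definition resolvent N m (A : 'M[R]_N) (B : 'M[R]_(N, m)) : 'M[F]_(N, m) :=
  invmx ((tf 'X)%:M - lift A) *m lift B.

Lemma resolvent_unit N (A : 'M[R]_N) : (tf 'X)%:M - lift A \in unitmx.
Proof.
have -> : (tf 'X)%:M - lift A = map_mx tf (char_poly_mx A).
  by rewrite map_mxB map_scalar_mx; congr (_ - _); apply/matrixP => i j; rewrite !mxE.
rewrite unitmxE det_map_mx unitfE tofrac_eq0.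
by rewrite -/(char_poly A) monic_neq0 ?char_poly_monic.
Qed.

Lemma resolventP N m (A : 'M[R]_N) (B : 'M[R]_(N, m)) :
  tf 'X *: resolvent A B = lift A *m resolvent A B + lift B.
Proof.
have : ((tf 'X)%:M - lift A) *m resolvent A B = lift B.
  by rewrite /resolvent mulKVmx ?resolvent_unit.
by rewrite mulmxBl mul_scalar_mx => <-; rewrite addrC subrK.
Qed.

Lemma resolvent_uniq N m (A : 'M[R]_N) (Y : 'M[F]_(N, m)) (X : 'M[F]_(N, m)) :
  tf 'X *: X = lift A *m X + Y -> X = invmx ((tf 'X)%:M - lift A) *m Y.
Proof.
move=> h; have <- : ((tf 'X)%:M - lift A) *m X = Y.
  by rewrite mulmxBl mul_scalar_mx h addrC addKr.
by rewrite mulKmx ?resolvent_unit.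
Qed.

Lemma transferE N m p (A : 'M[R]_N) (B : 'M[R]_(N, m)) (C0 : 'M[R]_(p, N)) :
  transfer A B C0 0 = lift C0 *m resolvent A B.
Proof. by rewrite /transfer map_mx0 addr0 mulmxA. Qed.

(** Under the feedback [u = K x + v] the matrix [1%:M + lift K *m Ph] maps [v] to [u], and
    [1 - K (s - A)^-1 B] inverts it. The identities serve both for the loop map, with [K = - C], and
    for the denominator of the coprime factorization, with [K = - B^T X]. *)
Lemma resolvent_feedback N m (A : 'M[R]_N) (B : 'M[R]_(N, m)) (K : 'M[R]_(m, N)) :
  let Ph := resolvent (A + B *m K) B in
  [/\ tf 'X *: Ph = lift A *m Ph + lift B *m (1%:M + lift K *m Ph),
      Ph = resolvent A B *m (1%:M + lift K *m Ph) &
      (1%:M - lift K *m resolvent A B) *m (1%:M + lift K *m Ph) = 1%:M].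
Proof.
move=> Ph.
have h1 : tf 'X *: Ph = lift A *m Ph + lift B *m (1%:M + lift K *m Ph).
  rewrite resolventP map_mxD map_mxM mulmxDl mulmxDr mulmx1 -!mulmxA -!addrA.
  by congr (_ + _); rewrite addrC.
have h2 : Ph = resolvent A B *m (1%:M + lift K *m Ph).
  by rewrite {1}(resolvent_uniq h1) /resolvent mulmxA.
split=> //.
by rewrite mulmxBl mul1mx -mulmxA -h2 addrK.
Qed.

(** Squared Hermitian norm, split so that inequalities between real quadratic forms apply to both
    parts. *)
Definition cnorm n (v : 'cV[C]_n) : R := dot (reM v) (reM v) + dot (imM v) (imM v).

Lemma cnorm_ge0 n (v : 'cV[C]_n) : 0 <= cnorm v.
Proof. by rewrite addr_ge0 ?dot_ge0. Qed.

Lemma cnormE n (v : 'cV[C]_n) : cnorm v = \sum_i sqnorm (v i 0).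
Proof.
by rewrite /cnorm !dotE -big_split; apply: eq_bigr => i _; rewrite !mxE -!expr2.
Qed.

Lemma reM_mul p q r (A : 'M[R]_(p, q)) (X : 'M[C]_(q, r)) :
  reM (map_mx rc A *m X) = A *m reM X.
Proof.
apply/matrixP => i j; rewrite !mxE cRe_sum; apply: eq_bigr => k _.
by rewrite !mxE cReM cRe_rc cIm_rc mul0r subr0.
Qed.

Lemma imM_mul p q r (A : 'M[R]_(p, q)) (X : 'M[C]_(q, r)) :
  imM (map_mx rc A *m X) = A *m imM X.
Proof.
apply/matrixP => i j; rewrite !mxE cIm_sum; apply: eq_bigr => k _.
by rewrite !mxE cImM cRe_rc cIm_rc mul0r addr0.
Qed.

Lemma reMD p q (X Y : 'M[C]_(p, q)) : reM (X + Y) = reM X + reM Y.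
Proof. by apply/matrixP => i j; rewrite !mxE cReD. Qed.
Lemma imMD p q (X Y : 'M[C]_(p, q)) : imM (X + Y) = imM X + imM Y.
Proof. by apply/matrixP => i j; rewrite !mxE cImD. Qed.
Lemma reMN p q (X : 'M[C]_(p, q)) : reM (- X) = - reM X.
Proof. by apply/matrixP => i j; rewrite !mxE cReN. Qed.
Lemma imMN p q (X : 'M[C]_(p, q)) : imM (- X) = - imM X.
Proof. by apply/matrixP => i j; rewrite !mxE cImN. Qed.
Lemma reMZ p q z (X : 'M[C]_(p, q)) : reM (z *: X) = re z *: reM X - im z *: imM X.
Proof. by apply/matrixP => i j; rewrite !mxE cReM. Qed.
Lemma imMZ p q z (X : 'M[C]_(p, q)) : imM (z *: X) = re z *: imM X + im z *: reM X.
Proof. by apply/matrixP => i j; rewrite !mxE cImM. Qed.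

(** Evaluated at [z], a rational trajectory becomes the amplitude of an exponential one. Its real
    and imaginary parts satisfy two coupled real equations, to which real dissipation inequalities
    apply. *)
Lemma trajectory_eval N m p (A : 'M[R]_N) (B : 'M[R]_(N, m)) (X : 'M[F]_(N, p))
    (Y : 'M[F]_(m, p)) z (w : 'cV[C]_p) :
  tf 'X *: X = lift A *m X + lift B *m Y -> regmx z X -> regmx z Y ->
  let x := evmx z X *m w in let u := evmx z Y *m w in
  re z *: reM x - im z *: imM x = A *m reM x + B *m reM u /\
  re z *: imM x + im z *: reM x = A *m imM x + B *m imM u.
Proof.
move=> h rX rY x u.
have [rA eA] := regmx_const z A; have [rB eB] := regmx_const z B.
have [rAX eAX] := regmxM rA rX; have [rBY eBY] := regmxM rB rY.
have : z *: x = map_mx rc A *m x + map_mx rc B *m u.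
  rewrite /x scalemxAl -(regmx_scaleX rX).2 h (regmxD rAX rBY).2 eAX eBY eA eB.
  by rewrite mulmxDl -!mulmxA.
move=> e; split.
  by rewrite -reMZ e reMD !reM_mul.
by rewrite -imMZ e imMD !imM_mul.
Qed.

Lemma cnorm_bound_entry p q (M : 'M[C]_(p, q)) c i j :
  (forall w, cnorm (M *m w) <= c * cnorm w) -> sqnorm (M i j) <= c.
Proof.
move=> /(_ (delta_mx j 0)); rewrite -colE => h.
have -> : c = c * cnorm (delta_mx j 0 : 'cV[C]_q).
  rewrite cnormE (bigD1 j)//= !mxE !eqxx big1 => [|k kj]; last first.
    by rewrite !mxE (negbTE kj) /sqnorm /= expr0n addr0.
  by rewrite /sqnorm /= expr1n expr0n !addr0 mulr1.
apply: le_trans h; rewrite cnormE (bigD1 i)//= mxE lerDl.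
by apply: sumr_ge0 => k _; exact: sqnorm_ge0.
Qed.

(** An energy estimate at generic points of the open half-plane yields stability and properness
    together; the state matrix does not enter. *)
Lemma bounded_RHinf p q (M : 'M[F]_(p, q)) c :
  generic (fun z => 0 < re z -> forall w, cnorm (evmx z M *m w) <= c * cnorm w) ->
  RHinf M.
Proof.
move=> h i j.
have h' : generic (fun z => 0 < re z -> sqnorm (reval (M i j) z) <= c).
  by apply: genericW h => z hz z0; have := cnorm_bound_entry i j (hz z0); rewrite mxE.
split; last exact: bounded_no_rhp_pole h'.
apply: (@bounded_proper _ _ c 0); apply: genericW h' => z hz x zx x0.
by apply: hz; rewrite zx.
Qed.

Lemma RHinf_regmx p q (M : 'M[F]_(p, q)) z : RHinf M -> 0 <= re z -> regmx z M.
Proof. by move=> h z0 i j; apply/not_pole; exact: (h i j).2. Qed.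

Definition sq_poly (Q : {poly C}) : {poly R} := map_poly re Q ^+ 2 + map_poly im Q ^+ 2.

Lemma sq_polyE Q t : (sq_poly Q).[t] = sqnorm Q.[rc t].
Proof. by rewrite /sq_poly /sqnorm hornerD !horner_exp -Re_horner -Im_horner. Qed.

(** After multiplication by the common denominator [den] both sides are polynomial along [z0 + t],
    so the bound passes to [t = 0]. It is needed on the imaginary axis, where the H2 norm is
    integrated. *)
Lemma bounded_evmx p q (M : 'M[F]_(p, q)) c z0 (w : 'cV[C]_q) :
  generic (fun z => 0 < re z -> forall w, cnorm (evmx z M *m w) <= c * cnorm w) ->
  0 <= re z0 -> cnorm (evmx z0 M *m w) <= c * cnorm w.
Proof.
move=> h z00; have rz0 := RHinf_regmx (bounded_RHinf h) z00.
pose den : {poly R} := \prod_(k : 'I_p * 'I_q) rden (M k.1 k.2).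
have denE i j : exists r, den = r * rden (M i j).
  rewrite /den (bigD1 (i, j))//= mulrC; by eexists; reflexivity.
pose num i j := (rnum (M i j) * (den %/ rden (M i j)))%R.
have numE i j : M i j * tf den = tf (num i j).
  have [r rE] := denE i j; rewrite /num rE mulpK ?rden_neq0//.
  by rewrite !rmorphM /= -rnum_rden; ring.
have den0 : polyC_eval den z0 != 0.
  rewrite /den; apply: (big_ind (fun d => polyC_eval d z0 != 0)).
  - by rewrite pev1 oner_neq0.
  - by move=> a b a0 b0; rewrite pevM mulf_neq0.
  - by move=> k _; exact: rz0.
pose sh (d : {poly R}) := map_poly rc d \Po ('X + z0%:P).
have shE d t : (sh d).[rc t] = polyC_eval d (z0 + rc t).
  by rewrite /sh horner_comp !hornerE [rc t + z0]addrC.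
pose hp : {poly R} := c * cnorm w *: sq_poly (sh den) -
  \sum_i sq_poly (\sum_j w j 0 *: sh (num i j)).
have hE t : polyC_eval den (z0 + rc t) != 0 ->
    hp.[t] = sqnorm (polyC_eval den (z0 + rc t)) *
             (c * cnorm w - cnorm (evmx (z0 + rc t) M *m w)).
  move=> d0; rewrite /hp hornerD hornerN hornerZ sq_polyE shE horner_sum mulrBr.
  congr (_ - _); first by rewrite mulrC.
  rewrite cnormE mulr_sumr; apply: eq_bigr => i _; rewrite sq_polyE -sqnormM; congr sqnorm.
  rewrite horner_sum mxE mulr_sumr; apply: eq_bigr => j _.
  rewrite hornerZ shE mxE (regular_frac d0 (numE i j)).2.
  by field.
have [e e0 he] := genericI h (generic_regmx M).
have E0 : line_sq z0 (e * den) != 0.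
  rewrite line_sq_neq0// mulf_neq0//.
  by apply: contraNneq den0 => ->; rewrite pev0.
have : 0 <= hp.[0].
  apply: (poly_ge0_at0 E0) => t t0; rewrite line_sqE sqnorm_eq0 pevM mulf_eq0 negb_or.
  move=> /andP[/he [hz _] d0]; rewrite hE// mulr_ge0 ?sqnorm_ge0// subr_ge0 hz//.
  by rewrite cReD ltr_wpDl.
rewrite hE rmorph0 addr0// pmulr_rge0 ?sqnorm_gt0// subr_ge0.
by [].
Qed.

Lemma mx_bound p q (M : 'M[R]_(p, q)) : exists2 c, 0 <= c &
  forall x : 'cV[R]_q, dot (M *m x) (M *m x) <= c * dot x x.
Proof.
pose P := M^T *m M.
exists (\sum_i \sum_j `|P i j|); first by apply: sumr_ge0 => i _; apply: sumr_ge0.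
move=> x; rewrite dot_mull mulmxA -/P dotE mulr_suml; apply: ler_sum => i _.
rewrite mxE mulr_sumr mulr_suml; apply: ler_sum => j _.
have xk k : x k 0 ^+ 2 <= dot x x.
  rewrite dotE (bigD1 k)//= -expr2 lerDl.
  by apply: sumr_ge0 => l _; rewrite -expr2 sqr_ge0.
have : `|x i 0 * x j 0| <= dot x x.
  have := xk i; have := xk j; rewrite ler_norml => ? ?; apply/andP; split; nra.
move=> h; rewrite mulrCA; apply: le_trans (ler_norm _) _.
by rewrite normrM ler_wpM2l.
Qed.

End Resolvent.

(** * Normalized coprime factorizations from a Riccati equation *)

Section FieldIdentities.
Variable K : fieldType.

Lemma one_sub_oppM p q (c : 'M[K]_(p, q)) (X : 'M[K]_(q, p)) :
  1%:M - (- c) *m X = 1%:M + c *m X.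
Proof. by rewrite mulNmx opprK. Qed.

Lemma one_subM p q r (c : 'M[K]_(p, q)) (X : 'M[K]_(q, p)) (Y : 'M[K]_(p, r)) :
  (1%:M - c *m X) *m Y = Y + (- c) *m (X *m Y).
Proof. by rewrite mulmxBl mul1mx -mulmxA mulNmx. Qed.

(** With [W = M^-1] and [L = (1 + G)^-1], both Bezout coefficients may be chosen equal to
    [W *m L]. *)
Lemma bezout_feedback p (W L G M : 'M[K]_p) :
  L *m (1%:M + G) = 1%:M -> W *m M = 1%:M ->
  W *m L *m M + W *m L *m (G *m M) = 1%:M.
Proof.
move=> h1 h2; rewrite -mulmxDr -{1}[M]mul1mx -mulmxDl mulmxA -[W *m L *m _]mulmxA.
by rewrite h1 mulmx1.
Qed.

(* The Lyapunov form of the Riccati equation makes the closed loop all-pass. *)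
Lemma allpass N m p (s : K) (AF X : 'M[K]_N) (B : 'M[K]_(N, m)) (k : 'M[K]_(m, N))
    (C : 'M[K]_(p, N)) (Y : 'M[K]_(m, N)) (Ph : 'M[K]_(N, m)) :
  s *: Ph = AF *m Ph + B -> - (s *: Y) = Y *m AF^T + B^T ->
  AF^T *m X + X *m AF = - (k^T *m k + C^T *m C) -> k = - (B^T *m X) -> X^T = X ->
  (1%:M + Y *m k^T) *m (1%:M + k *m Ph) + Y *m C^T *m (C *m Ph) = 1%:M.
Proof.
move=> hP hY lyap kE sX.
have YX : Y *m (k^T *m k + C^T *m C) *m Ph = - (Y *m k^T) - k *m Ph.
  rewrite -[X in _ *m X *m _]opprK -lyap mulmxN mulNmx mulmxDr mulmxDl.
  have -> : Y *m (AF^T *m X) *m Ph = - (s *: (Y *m X *m Ph)) + k *m Ph.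
    rewrite mulmxA; have -> : Y *m AF^T = - (s *: Y) - B^T by rewrite hY addrK.
    by rewrite 2!mulmxBl !mulNmx -!scalemxAl kE mulNmx.
  have -> : Y *m (X *m AF) *m Ph = s *: (Y *m X *m Ph) + Y *m k^T.
    rewrite -!mulmxA; have -> : AF *m Ph = s *: Ph - B by rewrite hP addrK.
    rewrite !mulmxBr -!scalemxAr kE linearN /= trmx_mul trmxK sX mulmxN.
    by [].
  by rewrite addrACA addNr add0r opprD addrC.
have -> : (1%:M + Y *m k^T) *m (1%:M + k *m Ph) + Y *m C^T *m (C *m Ph) =
    1%:M + k *m Ph + Y *m k^T + Y *m (k^T *m k + C^T *m C) *m Ph.
  rewrite mulmxDl mul1mx !mulmxDr !mulmx1 !mulmxDl -!mulmxA !addrA.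
  by [].
by rewrite YX addrA addrK addrK.
Qed.

End FieldIdentities.

Section Ncf.
Variable R : realType.
Notation F := (ratfun R).
Notation tf := (@FracField.tofrac {poly R}).
Notation re := (@complex.Re R).
Notation im := (@complex.Im R).
Notation rc := (real_complex R).
Notation lift := (map_mx (@rconst R)).
Notation reM := (map_mx (@complex.Re R)).
Notation imM := (map_mx (@complex.Im R)).

Lemma evmx_feedback z p q N (M : 'M[F]_(p, q)) (K : 'M[R]_(p, N)) (X : 'M[F]_(N, q)) (w : 'cV[R[i]]_q) :
  regmx z M -> regmx z X ->
  regmx z (M + lift K *m X) /\
  evmx z (M + lift K *m X) *m w = evmx z M *m w + map_mx rc K *m (evmx z X *m w).
Proof.
move=> rM rX; have [rK eK] := regmx_const z K; have [rKX eKX] := regmxM rK rX.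
have [r ->] := regmxD rM rKX; split=> //.
by rewrite eKX eK mulmxDl mulmxA.
Qed.

(** State-space form of [(1 + G)^-1], obtained by closing the loop with [u = e - C x]. *)
Definition loop N m (A : 'M[R]_N) (B : 'M[R]_(N, m)) (C : 'M[R]_(m, N)) : 'M[F]_m :=
  1%:M + lift (- C) *m resolvent (A + B *m (- C)) B.

Lemma loopP N m (A : 'M[R]_N) (B : 'M[R]_(N, m)) (C : 'M[R]_(m, N)) :
  (1%:M + transfer A B C 0) *m loop A B C = 1%:M /\
  loop A B C *m (1%:M + transfer A B C 0) = 1%:M.
Proof.
suff h : (1%:M + transfer A B C 0) *m loop A B C = 1%:M by split=> //; exact: mulmx1C.
have [_ _] := resolvent_feedback A B (- C); rewrite /loop transferE map_mxN.
by rewrite one_sub_oppM.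
Qed.

Lemma loop_trajectory N m (A : 'M[R]_N) (B : 'M[R]_(N, m)) (C : 'M[R]_(m, N)) z (w : 'cV[R[i]]_m) :
  regmx z (resolvent (A + B *m (- C)) B) -> regmx z (loop A B C) ->
  let x := evmx z (resolvent (A + B *m (- C)) B) *m w in
  let u := evmx z (loop A B C) *m w in
  [/\ re z *: reM x - im z *: imM x = A *m reM x + B *m reM u,
      re z *: imM x + im z *: reM x = A *m imM x + B *m imM u,
      reM u + C *m reM x = reM w & imM u + C *m imM x = imM w].
Proof.
move=> rX rU x u; have [h1 h2 _] := resolvent_feedback A B (- C).
have [e1 e2] := trajectory_eval w h1 rX rU.
have [r1 ev1] := regmx_1 z m.
have uE : u + map_mx rc C *m x = w.
  rewrite /u /loop (evmx_feedback _ _ r1 rX).2 ev1 mul1mx -/x.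
  by rewrite map_mxN mulNmx subrK.
split=> //; first by rewrite -[in RHS]uE reMD reM_mul.
by rewrite -[in RHS]uE imMD imM_mul.
Qed.

Lemma rflip_lift p q (Q : 'M[R]_(p, q)) : map_mx (@rflip R) (lift Q) = lift Q.
Proof. by apply/matrixP => i j; rewrite !mxE rflip_const. Qed.

Lemma rflip_mull p q r (Q : 'M[R]_(p, q)) (X : 'M[F]_(q, r)) :
  map_mx (@rflip R) (lift Q *m X)^T = map_mx (@rflip R) X^T *m (lift Q)^T.
Proof. by rewrite trmx_mul map_mxM; congr (_ *m _); rewrite -map_trmx rflip_lift. Qed.

Lemma rflip_affine p q (Q : 'M[R]_(p, q)) (X : 'M[F]_(q, p)) :
  map_mx (@rflip R) (1%:M + lift Q *m X)^T = 1%:M + map_mx (@rflip R) X^T *m (lift Q)^T.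
Proof. by rewrite linearD /= trmx1 map_mxD map_mx1 rflip_mull. Qed.

Lemma rflip_linear p q (A : 'M[R]_p) (B : 'M[R]_(p, q)) (X : 'M[F]_(p, q)) :
  tf 'X *: X = lift A *m X + lift B ->
  - (tf 'X *: map_mx (@rflip R) X^T) = map_mx (@rflip R) X^T *m (lift A)^T + (lift B)^T.
Proof.
move=> h; have -> : (lift B)^T = map_mx (@rflip R) (lift B)^T by rewrite -map_trmx rflip_lift.
rewrite -rflip_mull -map_mxD -linearD /= -h; apply/matrixP => i j.
by rewrite !mxE [RHS]rmorphM /= rflip_X mulNr.
Qed.

Section Passive.
Variables (N m : nat) (A P : 'M[R]_N) (B : 'M[R]_(N, m)) (C : 'M[R]_(m, N)).
Hypothesis psdP : psdmx P.
Hypothesis dA : dissipative P A.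
Hypothesis BC : P *m B = C^T.

(** Passivity makes the supply [u . y] nonnegative, so [|u|^2 + |y|^2 <= |u + y|^2 = |w|^2]. Hence
    the loop map is a contraction. *)
Lemma loop_energy z (w : 'cV[R[i]]_m) :
  regmx z (resolvent (A + B *m (- C)) B) -> regmx z (loop A B C) -> 0 < re z ->
  let x := evmx z (resolvent (A + B *m (- C)) B) *m w in
  let u := evmx z (loop A B C) *m w in
  re z * (dot (reM x) (P *m reM x) + dot (imM x) (P *m imM x)) <=
    dot (reM u) (C *m reM x) + dot (imM u) (C *m imM x) /\
  cnorm u + (dot (C *m reM x) (C *m reM x) + dot (C *m imM x) (C *m imM x)) <= cnorm w.
Proof.
move=> rX rU z0 x u; have [e1 e2 e3 e4] := loop_trajectory w rX rU.
have /psdmx_dot[sP P0] := psdP.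
have h := passive_bound sP dA BC e1 e2.
have h0 : 0 <= re z * (dot (reM x) (P *m reM x) + dot (imM x) (P *m imM x)).
  by rewrite mulr_ge0 ?addr_ge0// ltW.
split=> //; rewrite /cnorm -[in leRHS]e3 -[in leRHS]e4 -/u -/x !dotDl !dotDr.
rewrite [dot (C *m reM x) (reM u)]dotC [dot (C *m imM x) (imM u)]dotC.
move: h h0; rewrite -/u -/x; lra.
Qed.

Lemma loop_bound :
  generic (fun z => 0 < re z -> forall w, cnorm (evmx z (loop A B C) *m w) <= 1 * cnorm w).
Proof.
have := genericI (generic_regmx (resolvent (A + B *m (- C)) B)) (generic_regmx (loop A B C)).
apply: genericW => z [rX rU] z0 w; have [_] := loop_energy w rX rU z0; rewrite mul1r.
have := dot_ge0 (C *m reM (evmx z (resolvent (A + B *m - C) B) *m w)).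
have := dot_ge0 (C *m imM (evmx z (resolvent (A + B *m - C) B) *m w)); lra.
Qed.

Variable X : 'M[R]_N.
Hypothesis sX : X^T = X.
Hypothesis X0 : forall x, 0 <= dot x (X *m x) <= dot x (P *m x).
Hypothesis ricX : A^T *m X + X *m A - X *m B *m B^T *m X + C^T *m C = 0.

Variable K : 'M[R]_(m, N).
Hypothesis KE : K = - (B^T *m X).

(** The Riccati equation as a completion of the square in [u] around the optimal feedback [K x]. *)
Lemma riccati_dot x u :
  2 * dot x (X *m (A *m x + B *m u)) =
  dot (u - K *m x) (u - K *m x) - dot u u - dot (C *m x) (C *m x).
Proof.
have := congr1 (fun M => dot x (M *m x)) ricX.
rewrite !(mulmxDl, mulmxBl) mulNmx !mulmxDr mul0mx !dot_lin -!mulmxA.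
rewrite [dot x (A^T *m _)]dot_mulr [dot x (C^T *m _)]dot_mulr !trmxK.
rewrite [dot (A *m x) _](dot_sym _ _ sX).
rewrite [dot x (X *m (B *m (B^T *m _)))]dot_mulr sX [dot (X *m x) (B *m (B^T *m _))]dot_mulr.
rewrite [dot x (X *m (B *m u))]dot_mulr sX [dot (X *m x) (B *m u)]dot_mulr.
rewrite KE mulNmx opprK -mulmxA !dot_lin [dot (B^T *m _) u]dotC; lra.
Qed.

Lemma riccati_energy al om xr xi ur ui :
  al *: xr - om *: xi = A *m xr + B *m ur ->
  al *: xi + om *: xr = A *m xi + B *m ui ->
  2 * (al * (dot xr (X *m xr) + dot xi (X *m xi))) =
  dot (ur - K *m xr) (ur - K *m xr) + dot (ui - K *m xi) (ui - K *m xi)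
  - (dot ur ur + dot ui ui) - (dot (C *m xr) (C *m xr) + dot (C *m xi) (C *m xi)).
Proof.
move=> hr hi; rewrite -(frequency_energy _ om _ _ sX) hr hi mulrDr !riccati_dot; ring.
Qed.

Let Ph := resolvent (A + B *m K) B.
Let M := 1%:M + lift K *m Ph.
Let N0 := lift C *m Ph.
Let G := transfer A B C 0.

Let M_inv : (1%:M - lift K *m resolvent A B) *m M = 1%:M.
Proof. by have [] := resolvent_feedback A B K. Qed.

Let uM : M \in unitmx. Proof. by have [] := mulmx1_unit M_inv. Qed.

Let invM : invmx M = 1%:M - lift K *m resolvent A B.
Proof. by rewrite -[RHS](mulmxK uM) M_inv mul1mx. Qed.

Let GM : N0 = G *m M.
Proof. by have [_ h _] := resolvent_feedback A B K; rewrite /N0 /G transferE /M -mulmxA -h. Qed.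

(** On the closed loop [w = u - K x], so [riccati_energy] says that [|M w|^2 + |N0 w|^2] and twice
    the storage term, which is nonnegative, add up to [|w|^2]. *)
Let MN_energy z (w : 'cV[R[i]]_m) : regmx z Ph -> regmx z M -> 0 < re z ->
  cnorm (evmx z M *m w) + cnorm (evmx z N0 *m w) <= cnorm w.
Proof.
move=> rX rU z0; have [h1 _ _] := resolvent_feedback A B K.
have [] := trajectory_eval w h1 rX rU; rewrite -/Ph -/M => hr hi.
set x := evmx z Ph *m w in hr hi *; set u := evmx z M *m w in hr hi *.
have := riccati_energy hr hi.
have [r1 ev1] := regmx_1 z m.
have uE : u - map_mx rc K *m x = w.
  by rewrite /u /M (evmx_feedback _ _ r1 rX).2 ev1 mul1mx addrK.
have -> : reM u - K *m reM x = reM w by rewrite -uE reMD reMN reM_mul.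
have -> : imM u - K *m imM x = imM w by rewrite -uE imMD imMN imM_mul.
have -> : evmx z N0 *m w = map_mx rc C *m x.
  have [rC eC] := regmx_const z C; have [_ ->] := regmxM rC rX.
  by rewrite eC -mulmxA.
rewrite /cnorm reM_mul imM_mul.
have := X0 (reM x); have := X0 (imM x) => /andP[h3 _] /andP[h4 _].
have : 0 <= re z * (dot (reM x) (X *m reM x) + dot (imM x) (X *m imM x)).
  by rewrite mulr_ge0 ?addr_ge0// ltW.
lra.
Qed.

Let RHinf_M : RHinf M.
Proof.
apply: (@bounded_RHinf _ _ _ _ 1).
apply: genericW (genericI (generic_regmx Ph) (generic_regmx M)) => z [rX rU] z0 w.
rewrite mul1r (le_trans _ (MN_energy w rX rU z0))// lerDl cnorm_ge0//.
Qed.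

Let RHinf_N : RHinf N0.
Proof.
apply: (@bounded_RHinf _ _ _ _ 1).
apply: genericW (genericI (generic_regmx Ph) (generic_regmx M)) => z [rX rU] z0 w.
rewrite mul1r (le_trans _ (MN_energy w rX rU z0))// lerDr cnorm_ge0//.
Qed.

(** The common Bezout coefficient of [bezout_feedback]. Along the loop it maps [e] to [u - K x],
    which makes it accessible to energy estimates. *)
Let R0 := invmx M *m loop A B C.

Let R0E : R0 = loop A B C + lift (- K) *m resolvent (A + B *m (- C)) B.
Proof.
have [_ h _] := resolvent_feedback A B (- C).
rewrite -/(loop A B C) in h.
by rewrite /R0 invM one_subM -h -[in LHS]map_mxN.
Qed.

Let R0_MN : R0 *m M + R0 *m N0 = 1%:M.
Proof.
have h1 := (loopP A B C).2; have h2 := mulVmx uM.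
by rewrite GM; exact: bezout_feedback h1 h2.
Qed.

(** As [X <= P], the Riccati storage term is at most the supply, so
    [|u - K x|^2 <= |u|^2 + |y|^2 + 2 u . y], which is at most [2 (|u|^2 + |y|^2) <= 2 |w|^2]. *)
Let RHinf_R0 : RHinf R0.
Proof.
apply: (@bounded_RHinf _ _ _ _ 2).
have := genericI (generic_regmx (resolvent (A + B *m (- C)) B)) (generic_regmx (loop A B C)).
apply: genericW => z [rX rU] z0 w.
have [en1 en2] := loop_energy w rX rU z0.
have [e1 e2 e3 e4] := loop_trajectory w rX rU.
have re1 := riccati_energy e1 e2; have [_ ev] := evmx_feedback (- K) w rU rX.
rewrite R0E ev; move: re1.
move: en1 en2; set x := evmx z _ *m w; set u := evmx z (loop A B C) *m w => en1 en2.
rewrite map_mxN mulNmx /cnorm reMD imMD reMN imMN.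
rewrite reM_mul imM_mul -/(cnorm w).
have hx y : 0 <= dot y (P *m y) - dot y (X *m y) by have /andP[_] := X0 y; lra.
have : 0 <= re z * ((dot (reM x) (P *m reM x) - dot (reM x) (X *m reM x)) +
   (dot (imM x) (P *m imM x) - dot (imM x) (X *m imM x))).
  by apply: mulr_ge0; [exact: ltW|apply: addr_ge0; exact: hx].
have hd (a b : 'cV[R]_m) : 2 * dot a b <= dot a a + dot b b.
  by have := dot_ge0 (a - b); rewrite !dot_lin [dot b a]dotC; lra.
have := hd (reM u) (C *m reM x); have := hd (imM u) (C *m imM x).
move: en2; rewrite {1}/cnorm; lra.
Qed.

Let proper_invM i j : proper (invmx M i j).
Proof.
rewrite invM.
have [a a0 ha] := mx_bound A; have [b b0 hb] := mx_bound B; have [k k0 hk] := mx_bound K.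
(* For real [t > 1 + 2 a] the equation [t x = A x + B w] gives [|x|^2 <= 2 b |w|^2], because
   [t^2 >= 1 + 2 a]. Then [|w - K x|^2 <= 2 |w|^2 + 2 k |x|^2] yields the constant. *)
apply: (@bounded_proper _ _ (2 + 4 * k * b) (1 + a + a)).
have g := generic_regmx (resolvent A B); apply: genericW g => z rX t zt at0.
have rI := regmx_1 z m.
have rM : regmx z (1%:M + lift (- K) *m resolvent A B).
  by have [] := evmx_feedback (z := z) (- K) 0 rI.1 rX.
have -> : reval ((1%:M - lift K *m resolvent A B) i j) z =
    evmx z (1%:M + lift (- K) *m resolvent A B) i j.
  by rewrite map_mxN mulNmx !mxE.
apply: cnorm_bound_entry => w.
have [_ ->] := evmx_feedback (- K) w rI.1 rX; rewrite rI.2 mul1mx map_mxN mulNmx.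
have h1 : tf 'X *: resolvent A B = lift A *m resolvent A B + lift B *m 1%:M.
  by rewrite mulmx1 resolventP.
have [] := trajectory_eval w h1 rX rI.1; rewrite rI.2 mul1mx.
set x := evmx z _ *m w; rewrite zt /= !scale0r subr0 addr0 => hr hi.
rewrite /cnorm reMD imMD reMN imMN reM_mul imM_mul.
have hd n (p q : 'cV[R]_n) : dot (p + q) (p + q) <= 2 * (dot p p + dot q q).
  by have := dot_ge0 (p - q); rewrite !dot_lin [dot q p]dotC; lra.
have hs (y : 'cV[R]_N) (v : 'cV[R]_m) : t *: y = A *m y + B *m v ->
    dot y y <= 2 * b * dot v v.
  move=> e; have := hd _ (A *m y) (B *m v); rewrite -e !dot_lin.
  have := ha y; have := hb v; have := dot_ge0 y; have := dot_ge0 v => y1 y2 y3 y4 y5.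
  have t1 : 1 + 2 * a <= t * t by nra.
  have := ler_wpM2r y2 t1; lra.
have f1 := hs _ _ hr; have f2 := hs _ _ hi.
have g1 := hd _ (reM w) (- (K *m reM x)); have g2 := hd _ (imM w) (- (K *m imM x)).
move: g1 g2; rewrite !dot_lin.
have k1 := hk (reM x); have k2 := hk (imM x).
have k3 := ler_wpM2l k0 f1; have k4 := ler_wpM2l k0 f2.
move: k3 k4; rewrite !mulrA; lra.
Qed.

Let normalized : map_mx (@rflip R) M^T *m M + map_mx (@rflip R) N0^T *m N0 = 1%:M.
Proof.
pose Y := map_mx (@rflip R) Ph^T.
have hY : - (tf 'X *: Y) = Y *m (lift (A + B *m K))^T + (lift B)^T.
  exact: rflip_linear (resolventP _ _).
have MT : map_mx (@rflip R) M^T = 1%:M + Y *m (lift K)^T by exact: rflip_affine.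
have NT : map_mx (@rflip R) N0^T = Y *m (lift C)^T by exact: rflip_mull.
have lyap : (A + B *m K)^T *m X + X *m (A + B *m K) = - (K^T *m K + C^T *m C).
  have KT : K^T = - (X *m B) by rewrite KE [LHS]linearN /= trmx_mul trmxK sX.
  rewrite [(A + B *m K)^T]linearD /= trmx_mul KT mulmxDl mulmxDr !mulNmx KE !mulmxN opprK.
  have := ricX; rewrite !mulmxA.
  move: (A^T *m X) (X *m A) (X *m B *m B^T *m X) (C^T *m C) => q1 q2 q3 q4 e.
  by apply/matrixP => i j; move/matrixP/(_ i j): e; rewrite !mxE; lra.
rewrite MT NT /M /N0 map_trmx [(lift C)^T]map_trmx.
have := @allpass F N m m (tf 'X) (lift (A + B *m K)) (lift X) (lift B) (lift K) (lift C) Y Ph.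
rewrite !map_trmx -!map_mxM -!map_mxD -!map_mxN; apply.
- exact: resolventP.
- by rewrite hY !map_trmx.
- by rewrite lyap.
- by rewrite KE.
- by rewrite sX.
Qed.

Lemma ncf_of_riccati : exists M N0, is_ncf G M N0.
Proof.
exists M, N0; split=> //.
- by split=> //; rewrite GM mulmxK.
- by exists R0, R0; split.
Qed.

End Passive.

Theorem ncf_exists N m (A P : 'M[R]_N) (B : 'M[R]_(N, m)) (C : 'M[R]_(m, N)) :
  pdmx P -> dissipative P A -> P *m B = C^T ->
  exists M N0, is_ncf (transfer A B C 0) M N0.
Proof.
move=> pP dA BC; have [X [sX X0 ric]] := riccati pP dA BC.
exact: (ncf_of_riccati (pdmx_psd pP) dA BC sX X0 ric erefl).
Qed.

End Ncf.

(** * Integrals of rational functions and the H2 inner product *)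

Section LineIntegral.
Variable R : realType.
Notation mu := (@lebesgue_measure R).

Lemma cvg_Rintegral_line (f : R -> R) : mu.-integrable setT (EFin \o f) ->
  (fun n => \int[mu]_(x in `[- n%:R, n%:R]) f x) @ \oo --> \int[mu]_(x in setT) f x.
Proof.
move=> itf.
have [mf _] := integrableP _ _ _ itf.
have mI n : measurable (`[- n%:R, n%:R] : set R) by [].
have mf' : measurable_fun setT f by exact/measurable_EFinP.
pose g n : R -> \bar R := EFin \o (f \_ (`[- n%:R, n%:R]%classic : set R)).
have [|||||itf' _ h] := @dominated_convergence _ _ R mu setT measurableT
    g (EFin \o f) (fun x => `|(f x)%:E|%E).
- move=> n; apply/measurable_EFinP; apply/(measurable_restrictT _ _).1 => //.
  exact: measurable_funS mf'.
- exact: mf.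
- apply: aeW => x _.
  apply: cvg_near_cst; near=> n; rewrite /g /= patchE mem_set//= in_itv/= -ler_norml.
  by near: n; exact: nbhs_infty_ger.
- exact: integrable_abse.
- apply: aeW => x n _; rewrite /g /= patchE; case: ifP => _; first by [].
  by rewrite normr0 lee_fin.
have E n : (\int[mu]_(x in setT) g n x)%E = (\int[mu]_(x in `[- n%:R, n%:R]) f x)%:E.
  rewrite /g -restrict_EFin -integral_mkcond /Rintegral fineK//.
  by apply: integrable_fin_num => //; exact: integrableS itf.
move: h; under eq_fun do rewrite E.
have fin : (\int[mu]_x (EFin \o f) x)%E \is a fin_num by exact: integrable_fin_num.
by rewrite -(fineK fin) => /fine_cvg.
Unshelve. all: by end_near. Qed.

Lemma Rintegral_line_antiderivative (f F : R -> R) :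
  continuous f -> mu.-integrable setT (EFin \o f) ->
  (forall x : R, is_derive x 1 F (f x)) ->
  (fun n : nat => F n%:R - F (- n%:R)) @ \oo --> (0 : R) ->
  \int[mu]_(x in setT) f x = 0.
Proof.
move=> cf itf dF F0.
have h := cvg_Rintegral_line itf.
suff E : (fun n => \int[mu]_(x in `[- n%:R, n%:R]) f x) @ \oo --> (0 : R).
  by rewrite -(cvg_lim _ h)// (cvg_lim _ E).
apply: cvg_trans F0; apply: near_eq_cvg; near=> n.
have n0 : (0 < n)%N by near: n; exact: nbhs_infty_gt.
rewrite /Rintegral (@continuous_FTC2 _ f F)//.
- by rewrite ltrNl; rewrite (lt_trans (y := 0)) ?oppr_lt0 ?oppr0 ?ltr0n// oppr_cp0 ltr0n.
- by apply: continuous_subspaceT.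
- have cF : continuous F.
    by move=> x; apply: differentiable_continuous; apply/derivable1_diffP; have [] := dF x.
  split.
  + by move=> x _; have [] := dF x.
  + exact: cvg_at_right_filter (cF _).
  + exact: cvg_at_left_filter (cF _).
- by move=> x _; rewrite derive1E; have [_ ->] := dF x.
Unshelve. all: by end_near. Qed.

Lemma integrable_oneDsqrV : mu.-integrable setT (EFin \o (fun x : R => (oneDsqr x)^-1)).
Proof.
set h := fun x : R => _.
have c : continuous h := @continuous_oneDsqrV R.
have m : measurable_fun setT h by exact: continuous_measurable_fun.
apply/integrableP; split; first exact/measurable_EFinP.
have h0 x : 0 <= h x by rewrite /h invr_ge0 addr_ge0 ?sqr_ge0.
have -> : (\int[mu]_(x in setT) `|(EFin \o h) x| = \int[mu]_(x in setT) (h x)%:E)%E.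
  by apply: eq_integral => x _ /=; rewrite ger0_norm.
rewrite ge0_symfun_integralT//.
- have -> : [set x : R | 0 <= x] = `[0, +oo[%classic by rewrite set_itvcy.
  by rewrite integral0y_oneDsqr -EFinM ltry.
- by move=> x /=; rewrite /h /oneDsqr sqrrN.
Qed.

(** Division leaves a constant plus a remainder [r] of smaller degree than [b]. Near infinity
    [r ^+ 2 <= b ^+ 2] by leading coefficients, at minus infinity after substituting [- 'X]; on the
    remaining compact interval [|b|] is bounded away from 0. *)
Lemma poly_ratio_bounded (a b : {poly R}) : (forall x, b.[x] != 0) ->
  (size a <= size b)%N -> exists2 c, 0 <= c & forall x, `|a.[x]| <= c * `|b.[x]|.
Proof.
move=> b0 sab.
have bn0 : b != 0 by apply: contraTneq (b0 0) => ->; rewrite horner0 eqxx.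
pose q := a %/ b; pose r := a %% b.
have aE : a = q * b + r by exact: divp_eq.
have sr : (size r < size b)%N by rewrite ltn_modp.
have sq : (size q <= 1)%N.
  by rewrite size_divp// leq_subLR addn1 prednK ?size_poly_gt0.
have qE : q = (q`_0)%:P by exact: size1_polyC.
have sqe (p : {poly R}) : p != 0 -> size (p ^+ 2) = ((size p).-1 * 2).+1.
  by move=> p0; rewrite -size_exp prednK// size_poly_gt0 expf_neq0.
have big (e : {poly R}) : (size e = size b)%N -> (size r < size e)%N ->
    forall rr : {poly R}, size rr = size r -> exists n, forall x, n <= x -> rr.[x] ^+ 2 <= e.[x] ^+ 2.
  move=> se _ rr srr; have e0 : e != 0 by rewrite -size_poly_eq0 se size_poly_eq0.
  have [->|rr0] := eqVneq rr 0; first by exists 0 => x _; rewrite horner0 expr0n sqr_ge0.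
  have ss : (size (- rr ^+ 2)%R < size (e ^+ 2))%N.
    rewrite size_polyN !sqe// ltnS ltn_mul2r /= se srr.
    move: sr; have : (0 < size rr)%N by rewrite size_poly_gt0.
    by rewrite srr; case: (size r) => // k _; case: (size b).
  have l0 : 0 < lead_coef (e ^+ 2 - rr ^+ 2).
    by rewrite lead_coefDl// lead_coef_exp exprn_even_gt0 //= lead_coef_eq0.
  have [n hn] := poly_pinfty_gt_lc l0; exists n => x /hn.
  rewrite hornerD hornerN !horner_exp => h.
  by rewrite -subr_ge0 (le_trans _ h)// ltW.
have [n1 h1] := big b erefl sr r erefl.
have sN (p : {poly R}) : size (p \Po - 'X) = size p.
  by rewrite size_comp_poly2// size_polyN size_polyX.
have [|n2 h2] := big (b \Po - 'X) (sN b) _ (r \Po - 'X) (sN r); first by rewrite sN.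
pose n := Num.max 1 (Num.max n1 n2).
have n10 : 0 < n by rewrite lt_max ltr01.
have [ub hub] := poly_itv_bound r (- n) n.
have nn : - n <= n by rewrite ge0_cp// ltW.
have [|c cI hc] := @EVT_min R (horner (b ^+ 2)) (- n) n nn.
  by apply: continuous_subspaceT => x; exact: continuous_horner.
have bc0 : 0 < b.[c] ^+ 2 by rewrite exprn_even_gt0 //= b0.
pose k := 1 + `|ub| / `|b.[c]|.
have bca : 0 < `|b.[c]| by rewrite normr_gt0.
have k1 : 1 <= k by rewrite lerDl divr_ge0.
have rk x : `|r.[x]| <= k * `|b.[x]|.
  have [/andP[nx xn]|hx] := boolP (- n <= x <= n).
    have bx : `|b.[c]| <= `|b.[x]|.
      by rewrite -ler_sqr ?nnegrE// !real_normK ?num_real// -!horner_exp hc// in_itv/= nx.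
    have rx : `|r.[x]| <= `|ub| by rewrite (le_trans (hub _ _)) ?nx ?ler_norm.
    apply: le_trans rx _; apply: (@le_trans _ _ (`|ub| / `|b.[c]| * `|b.[x]|)).
      by rewrite -mulrA ler_peMr// mulrC ler_pdivlMr// mul1r.
    by rewrite ler_wpM2r// /k lerDr.
  have : r.[x] ^+ 2 <= b.[x] ^+ 2.
    move: hx; rewrite negb_and -!ltNge => /orP[hx|hx].
      have := h2 (- x); rewrite !horner_comp !hornerN !hornerX !opprK; apply.
      by rewrite lerNr ltW// (lt_le_trans hx)// lerN2 !le_max lexx !orbT.
    by apply: h1; rewrite ltW// (le_lt_trans _ hx)// !le_max lexx !orbT.
  rewrite -[_ ^+ 2 <= _]ler_sqrt ?sqr_ge0// !sqrtr_sqr => h.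
  by apply: le_trans h _; rewrite ler_peMl.
exists (`|q`_0| + k); first by rewrite addr_ge0// (le_trans ler01).
move=> x; rewrite aE hornerD hornerM qE hornerC mulrDl.
by rewrite coefC /=; apply: le_trans (ler_normD _ _) _; rewrite normrM lerD.
Qed.

Lemma poly_ratio_continuous (a b : {poly R}) : (forall x, b.[x] != 0) ->
  continuous (fun x => a.[x] / b.[x]).
Proof.
move=> b0 x; apply: cvgM; first exact: continuous_horner.
by apply: cvgV; [exact: b0|exact: continuous_horner].
Qed.

(** The degree gap of two lets the ratio be dominated by a multiple of [1 / (1 + x^2)]. *)
Lemma poly_ratio_integrable (a b : {poly R}) : (forall x, b.[x] != 0) ->
  ((size a).+1 < size b)%N ->
  mu.-integrable setT (EFin \o (fun x => a.[x] / b.[x])).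
Proof.
move=> b0 sab.
have [|c c0 hc] := @poly_ratio_bounded (a * (1 + 'X^2)) b b0.
  have s2 : size (1 + 'X^2 : {poly R}) = 3%N.
    by rewrite addrC size_polyDl ?size_polyXn// size_poly1.
  by rewrite (leq_trans (size_polyMleq _ _))// s2 addn3.
have cf := @poly_ratio_continuous a b b0.
have ig : mu.-integrable setT (EFin \o (fun x : R => c * (oneDsqr x)^-1)).
  by have := integrableZl measurableT c integrable_oneDsqrV.
apply: le_integrable ig => //.
  by apply/measurable_EFinP; exact: continuous_measurable_fun.
move=> x _ /=; rewrite lee_fin /oneDsqr.
have p0 : 0 < 1 + x ^+ 2 by rewrite ltr_wpDr ?sqr_ge0.
rewrite [leRHS]ger0_norm ?mulr_ge0 ?invr_ge0 ?(ltW p0)//.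
rewrite normrM normfV ler_pdivrMr ?normr_gt0// mulrAC ler_pdivlMr//.
have := hc x; rewrite hornerM normrM hornerD hornerC hornerXn.
by rewrite [`|1 + _|]ger0_norm ?(ltW p0).
Qed.

End LineIntegral.

(** * Antiderivatives along the real line for poles off the line *)

Section ComplexLine.
Variable R : realType.
Notation mu := (@lebesgue_measure R).
Notation C := (R[i]).
Notation re := (@complex.Re R).
Notation im := (@complex.Im R).
Notation rc := (real_complex R).

Lemma derD (f g : R -> R) (x a b : R) : is_derive x 1 f a -> is_derive x 1 g b ->
  is_derive x 1 (fun y => f y + g y) (a + b).
Proof. by move=> hf hg; exact: is_deriveD. Qed.

Lemma derB (f g : R -> R) (x a b : R) : is_derive x 1 f a -> is_derive x 1 g b ->
  is_derive x 1 (fun y => f y - g y) (a - b).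
Proof. by move=> hf hg; exact: is_deriveB. Qed.

Lemma derM (f g : R -> R) (x a b : R) : is_derive x 1 f a -> is_derive x 1 g b ->
  is_derive x 1 (fun y => f y * g y) (a * g x + f x * b).
Proof.
move=> hf hg; have := is_deriveM hf hg; rewrite addrC => h.
apply: is_derive_eq h _; by rewrite /GRing.scale /= mulrC.
Qed.

Lemma derZ (f : R -> R) (x k a : R) : is_derive x 1 f a ->
  is_derive x 1 (fun y => k * f y) (k * a).
Proof.
move=> hf; have := derM (is_derive_cst k x 1) hf; rewrite mul0r add0r; exact.
Qed.

Lemma derV (f : R -> R) (x a : R) : f x != 0 -> is_derive x 1 f a ->
  is_derive x 1 (fun y => (f y)^-1) (- a / f x ^+ 2).
Proof.
move=> f0 hf; apply: is_derive_eq (is_deriveV f0 hf) _.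
by rewrite /GRing.scale /= !mulNr mulrC.
Qed.

Lemma der_sub (a x : R) : is_derive x 1 (fun y => y - a) 1.
Proof. by have := derB (is_derive_id x 1) (is_derive_cst a x 1); rewrite subr0; exact. Qed.

Definition cder (f : R -> C) (x : R) (d : C) :=
  is_derive x 1 (fun y => re (f y)) (re d) /\ is_derive x 1 (fun y => im (f y)) (im d).

Lemma cderM f g x a b : cder f x a -> cder g x b ->
  cder (fun y => f y * g y) x (a * g x + f x * b).
Proof.
move=> [rf jf] [rg jg]; split.
- have := derB (derM rf rg) (derM jf jg).
  under eq_fun do rewrite -cReM.
  by move=> h; apply: is_derive_eq h _; rewrite !ReImE; ring.
- have := derD (derM rf jg) (derM jf rg).
  under eq_fun do rewrite -cImM.
  by move=> h; apply: is_derive_eq h _; rewrite !ReImE; ring.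
Qed.

Lemma cderZ c f x a : cder f x a -> cder (fun y => c * f y) x (c * a).
Proof.
move=> h; have hc : cder (fun _ => c) x 0.
  by split; [exact: (is_derive_cst (re c))|exact: (is_derive_cst (im c))].
by have := cderM hc h; rewrite mul0r add0r.
Qed.

Definition den2 (a : C) (x : R) := (x - re a) ^+ 2 + im a ^+ 2.

Lemma den2_gt0 a x : 0 < im a -> 0 < den2 a x.
Proof. by move=> a0; rewrite /den2 ltr_wpDl ?sqr_ge0// exprn_gt0. Qed.

Lemma subC_neq0 (a : C) x : 0 < im a -> rc x - a != 0.
Proof.
move=> a0; apply: contraTneq a0 => h; have := congr1 im h.
by rewrite cImD cImN /= add0r => /eqP; rewrite oppr_eq0 => /eqP ->; rewrite ltxx.
Qed.

Lemma invC_re a x : 0 < im a -> re (rc x - a)^-1 = (x - re a) / den2 a x.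
Proof. by case: a => a b /= b0; rewrite /den2 /= sub0r sqrrN. Qed.

Lemma invC_im a x : 0 < im a -> im (rc x - a)^-1 = im a / den2 a x.
Proof. by case: a => a b /= b0; rewrite /den2 /= sub0r sqrrN mulNr opprK. Qed.

Lemma der_den2 a (x : R) : is_derive x 1 (den2 a) (2 * (x - re a)).
Proof.
have h := derM (der_sub (re a) x) (der_sub (re a) x).
have := derD h (is_derive_cst (im a ^+ 2) x 1).
rewrite mul1r mulr1 addr0 => h2; apply: is_derive_eq h2 _; ring.
Qed.

Lemma cder_inv a x : 0 < im a ->
  cder (fun y => (rc y - a)^-1) x (- ((rc x - a)^-1 * (rc x - a)^-1)).
Proof.
move=> a0; have d0 := lt0r_neq0 (den2_gt0 x a0); split.
- under eq_fun do rewrite invC_re//.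
  have := derM (der_sub (re a) x) (derV d0 (der_den2 a x)) => h.
  apply: is_derive_eq h _.
  rewrite cReN cReM invC_re// invC_im//.
  by move: d0; rewrite /den2 => d0; field.
- under eq_fun do rewrite invC_im//.
  have := derZ (im a) (derV d0 (der_den2 a x)) => h.
  apply: is_derive_eq h _.
  rewrite cImN cImM invC_re// invC_im//.
  by move: d0; rewrite /den2 => d0; field.
Qed.

Lemma cder_inv_pow a x j : 0 < im a ->
  cder (fun y => (rc y - a)^-1 ^+ j.+1) x (- (j.+1%:R * (rc x - a)^-1 ^+ j.+2)).
Proof.
move=> a0; elim: j => [|j IH].
  have := cder_inv x a0; rewrite mul1r -expr2.
  by under [X in cder X]eq_fun do rewrite -[_^-1]expr1.
have := cderM (cder_inv x a0) IH.
under [X in cder X]eq_fun do rewrite -exprS.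
congr cder; set e := (rc x - a)^-1.
have -> : j.+2%:R = 1 + j.+1%:R :> C by rewrite -natr1 addrC.
rewrite [e ^+ j.+3]exprSr [e ^+ j.+2]exprSr; move: (e ^+ j.+1) (j.+1%:R) => p N.
by ring.
Qed.

(** [der_log] and [der_arg] provide the real and imaginary part of a primitive of [1 / (x - a)]; the
    arctangent takes the place of a branch of the complex logarithm. *)
Lemma der_log a (x : R) : 0 < im a ->
  is_derive x 1 (fun y => ln (den2 a y) / 2) (re (rc x - a)^-1).
Proof.
move=> a0; have d0 := den2_gt0 x a0.
have h := is_derive1_comp (is_derive1_ln d0) (der_den2 a x).
have := derM h (is_derive_cst (2^-1 : R) x 1).
rewrite mulr0 addr0 invC_re// => h2; apply: is_derive_eq h2 _.
by rewrite /cst /=; field; exact: lt0r_neq0.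
Qed.

Lemma der_arg a (x : R) : 0 < im a ->
  is_derive x 1 (fun y => atan ((y - re a) / im a)) (im (rc x - a)^-1).
Proof.
move=> a0; have d0 := den2_gt0 x a0.
pose g (y : R) := (y - re a) / im a.
have h0 : is_derive x 1 g (1 * (im a)^-1 + (x - re a) * 0).
  exact: (derM (der_sub (re a) x) (is_derive_cst (im a)^-1 x 1)).
have h := @is_derive1_comp _ (@atan R) g x _ _ (is_derive1_atan (g x)) h0.
rewrite invC_im//; apply: is_derive_eq h _.
rewrite mulr0 addr0 mul1r /g; move: d0 a0; rewrite /den2.
move: (re a) (im a) => u v d0 v0; field.
by rewrite (lt0r_neq0 d0) (lt0r_neq0 v0).
Qed.

Definition conjp (Q : {poly C}) : {poly C} := map_poly (@conjc R) Q.

Lemma conjpE Q x : (conjp Q).[rc x] = conjc Q.[rc x].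
Proof.
have -> : rc x = conjc (rc x) by rewrite conjc_real.
by rewrite /conjp horner_map conjc_real.
Qed.

Lemma Re_div (a b : C) : re (a / b) = re (a * conjc b) / re (b * conjc b).
Proof.
case: a b => a1 a2 [b1 b2] /=; rewrite !mulrN !opprK -!expr2.
by rewrite !mulrA -mulrDl.
Qed.

Lemma sqnormE (b : C) : sqnorm b = re (b * conjc b).
Proof. by case: b => b1 b2 /=; rewrite /sqnorm /= mulrN opprK -!expr2. Qed.

Lemma crat_re (P Q : {poly C}) x : re (P.[rc x] / Q.[rc x]) =
  (map_poly re (P * conjp Q)).[x] / (map_poly re (Q * conjp Q)).[x].
Proof. by rewrite Re_div -!Re_horner !hornerM !conjpE. Qed.

Section Crat.
Variables (P Q : {poly C}).
Hypothesis Q0 : forall x, Q.[rc x] != 0.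
Let num := map_poly re (P * conjp Q).
Let den := map_poly re (Q * conjp Q).

Let Qn0 : Q != 0. Proof. by apply: contraTneq (Q0 0) => ->; rewrite horner0 eqxx. Qed.

Let size_conj : size (conjp Q) = size Q.
Proof. by rewrite /conjp size_map_poly. Qed.

Let den_neq0 x : den.[x] != 0.
Proof. by rewrite /den -Re_horner hornerM conjpE -sqnormE sqnorm_eq0. Qed.

Let size_den : size den = (size Q + size Q).-1.
Proof.
have c0 : conjp Q != 0 by rewrite -size_poly_eq0 size_conj size_poly_eq0.
rewrite /den size_map_poly_id0; first by rewrite size_mul// size_conj.
rewrite lead_coefM /conjp lead_coef_map -sqnormE sqnorm_eq0 lead_coef_eq0//.
Qed.

Let size_num : (size num <= (size P + size Q).-1)%N.
Proof.
rewrite /num (leq_trans (size_poly _ _))// (leq_trans (size_polyMleq _ _))//.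
by rewrite size_conj.
Qed.

Lemma crat_continuous : continuous (fun x => re (P.[rc x] / Q.[rc x])).
Proof.
under eq_fun do rewrite crat_re.
exact: poly_ratio_continuous den_neq0.
Qed.

Lemma crat_integrable : ((size P).+1 < size Q)%N ->
  mu.-integrable setT (EFin \o (fun x => re (P.[rc x] / Q.[rc x]))).
Proof.
move=> s; under eq_fun do rewrite crat_re.
apply: (poly_ratio_integrable den_neq0).
rewrite size_den -/num; move: size_num s.
by move: (size num) (size P) (size Q) => x y z; lia.
Qed.

Lemma crat_bounded_line : (size P < size Q)%N ->
  exists2 c, 0 <= c & forall x, `|x| * `|re (P.[rc x] / Q.[rc x])| <= c.
Proof.
move=> s; have [|c c0 hc] := @poly_ratio_bounded R ('X * num) den den_neq0.
  rewrite size_den (leq_trans (size_polyMleq _ _))// size_polyX.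
  move: size_num s; move: (size num) (size P) (size Q) => x y z; lia.
exists c => // x; rewrite crat_re -/num -/den normrM normfV mulrA.
by rewrite ler_pdivrMr ?normr_gt0// -normrM; have := hc x; rewrite hornerM hornerX.
Qed.

End Crat.

Lemma cvg_invn (f : R -> R) c : (forall x, `|x| * `|f x| <= c) ->
  (fun n : nat => f n%:R) @ \oo --> (0 : R) /\ (fun n : nat => f (- n%:R)) @ \oo --> (0 : R).
Proof.
move=> h.
have key (g : nat -> R) : (forall n, n%:R * `|g n| <= c) -> g @ \oo --> (0 : R).
  move=> hg; apply/cvgr0Pnorm_le => e e0; near=> n.
  have n0 : 0 < n%:R :> R by rewrite ltr0n; near: n; exact: nbhs_infty_gt.
  rewrite -(ler_pM2l n0) (le_trans (hg n))// -ler_pdivrMr//.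
  by near: n; exact: nbhs_infty_ger.
split; apply: key => n.
- by have := h n%:R; rewrite [`|n%:R|]ger0_norm.
- by have := h (- n%:R); rewrite normrN [`|n%:R|]ger0_norm.
Unshelve. all: by end_near. Qed.

End ComplexLine.

(** * Line integrals of rational functions with poles in the upper half-plane *)

Section Vanish.
Variable R : realType.
Notation mu := (@lebesgue_measure R).
Notation C := (R[i]).
Notation re := (@complex.Re R).
Notation im := (@complex.Im R).
Notation rc := (real_complex R).

Definition prodX (s : seq C) : {poly C} := \prod_(a <- s) ('X - a%:P).

Lemma size_prodX s : size (prodX s) = (size s).+1.
Proof. exact: size_prod_XsubC. Qed.

Lemma prodX_cons a s : prodX (a :: s) = ('X - a%:P) * prodX s.
Proof. by rewrite /prodX big_cons. Qed.

Lemma prodX_neq0 s x : (forall a, a \in s -> 0 < im a) -> (prodX s).[rc x] != 0.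
Proof.
move=> h; rewrite /prodX horner_prod prodf_seq_neq0; apply/allP => a /h a0.
by rewrite hornerXsubC subC_neq0.
Qed.

Lemma prodX_integrable s (P : {poly C}) : (forall a, a \in s -> 0 < im a) ->
  ((size P).+1 <= size s)%N ->
  mu.-integrable setT (EFin \o (fun x => re (P.[rc x] / (prodX s).[rc x]))).
Proof.
move=> h sz; apply: crat_integrable => [x|]; first exact: prodX_neq0.
by rewrite size_prodX ltnS.
Qed.

Lemma vanish_pow a k c : 0 < im a ->
  \int[mu]_(x in setT) re (c%:P.[rc x] / (prodX (nseq k.+2 a)).[rc x]) = 0.
Proof.
move=> a0; pose c' := - c / k.+1%:R.
have nz : k.+1%:R != 0 :> C by rewrite pnatr_eq0.
have hs n b : b \in nseq n a -> 0 < im b by rewrite mem_nseq => /andP[_ /eqP ->].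
have E (d : C) n x : d%:P.[rc x] / (prodX (nseq n a)).[rc x] = d * (rc x - a)^-1 ^+ n.
  rewrite hornerC /prodX big_nseq; congr (_ * _).
  elim: n => [|n IH]; first by rewrite /= hornerC expr0 invr1.
  by rewrite /= hornerM hornerXsubC invfM exprS IH.
apply: (@Rintegral_line_antiderivative _ _ (fun x => re (c'%:P.[rc x] / (prodX (nseq k.+1 a)).[rc x]))).
- by apply: crat_continuous => x; apply: prodX_neq0; exact: hs.
- apply: prodX_integrable; first exact: hs.
  by rewrite size_nseq ltnS (leq_trans (size_polyC_leq1 _)).
- move=> x; have [h _] := cderZ c' (cder_inv_pow x k a0).
  under eq_fun do rewrite E.
  apply: is_derive_eq h _; rewrite E; congr re.
  by rewrite /c'; move: (_ ^+ k.+2) => e; field.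
- have [||cst _ hc] := @crat_bounded_line _ c'%:P (prodX (nseq k.+1 a)).
  + by move=> x; apply: prodX_neq0; exact: hs.
  + by rewrite size_prodX size_nseq; exact: (leq_ltn_trans (size_polyC_leq1 _)).
  have [h1 h2] := cvg_invn hc.
  by rewrite -[X in _ --> X](subr0 0); exact: cvgB h1 h2.
Qed.

(** By partial fractions a difference of two logarithms is a primitive. Its modulus part tends to 0
    because [den2 a / den2 b] tends to 1, and its two arctangents have the same limit at each end
    because both poles lie on the same side of the line. *)
Lemma vanish_pair a b c : 0 < im a -> 0 < im b -> a != b ->
  \int[mu]_(x in setT) re (c%:P.[rc x] / (prodX [:: a; b]).[rc x]) = 0.
Proof.
move=> a0 b0 ab.
have hs z : z \in [:: a; b] -> 0 < im z by rewrite !inE => /orP[] /eqP ->.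
pose c' := c / (a - b).
have E x : c%:P.[rc x] / (prodX [:: a; b]).[rc x] =
    c' * ((rc x - a)^-1 - (rc x - b)^-1).
  rewrite hornerC !prodX_cons /prodX big_nil mulr1 hornerM !hornerXsubC /c'.
  have := subC_neq0 x a0; have := subC_neq0 x b0; move: (rc x) => y hb ha.
  by field; rewrite ha hb subr_eq0 ab.
pose la (y : R) := ln (den2 a y) / 2 - ln (den2 b y) / 2.
pose ta (y : R) := atan ((y - re a) / im a) - atan ((y - re b) / im b).
apply: (@Rintegral_line_antiderivative _ _ (fun x => re c' * la x - im c' * ta x)).
- by apply: crat_continuous => x; apply: prodX_neq0; exact: hs.
- by apply: prodX_integrable; [exact: hs|rewrite ltnS size_polyC_leq1].
- move=> x; have dl : is_derive x 1 la (re (rc x - a)^-1 - re (rc x - b)^-1).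
    exact: derB (der_log x a0) (der_log x b0).
  have dt : is_derive x 1 ta (im (rc x - a)^-1 - im (rc x - b)^-1).
    exact: derB (der_arg x a0) (der_arg x b0).
  have h := derB (derZ (re c') dl) (derZ (im c') dt).
  by apply: is_derive_eq h _; rewrite E [RHS]cReM cReD cImD cReN cImN.
have lcv : (fun n : nat => la n%:R) @ \oo --> (0 : R) /\
           (fun n : nat => la (- n%:R)) @ \oo --> (0 : R).
  have pd z x : den2 z x = (('X - (re z)%:P) ^+ 2 + (im z ^+ 2)%:P).[x].
    by rewrite /den2 hornerD horner_exp hornerXsubC hornerC.
  pose D z : {poly R} := ('X - (re z)%:P) ^+ 2 + (im z ^+ 2)%:P.
  have sD z : size (D z) = 3%N.
    by rewrite /D size_polyDl ?size_exp_XsubC// (leq_ltn_trans (size_polyC_leq1 _)).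
  have sB : (size (D a - D b)%R <= 2)%N.
    have lD z : (D z)`_2 = 1.
      have : lead_coef (D z) = 1.
        rewrite /D lead_coefDl ?lead_coef_exp ?lead_coefXsubC ?expr1n//.
        by rewrite size_exp_XsubC (leq_ltn_trans (size_polyC_leq1 _)).
      by rewrite lead_coefE sD.
    apply/leq_sizeP => j; rewrite leq_eqVlt coefB => /orP[/eqP <-|j2].
      by rewrite !lD subrr.
    by rewrite !nth_default ?sD// subrr.
  have [||cc _ hc] := @poly_ratio_bounded _ ('X * (D a - D b)) (D b).
  - by move=> x; rewrite /D -pd lt0r_neq0// den2_gt0.
  - rewrite sD (leq_trans (size_polyMleq _ _))// size_polyX add2n /=.
    by rewrite ltnS.
  have la_ln x : la x = ln (1 + (D a - D b).[x] / (D b).[x]) / 2.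
    have -> : 1 + (D a - D b).[x] / (D b).[x] = den2 a x / den2 b x.
      rewrite hornerD hornerN /D -!pd; have := lt0r_neq0 (den2_gt0 x b0).
      by move: (den2 a x) (den2 b x) => u v v0; field.
    by rewrite ln_div ?posrE ?den2_gt0// /la mulrBl.
  have [|r1 r2] := cvg_invn (f := fun x => (D a - D b).[x] / (D b).[x]) (c := cc).
    move=> x; rewrite normrM normfV mulrA ler_pdivrMr ?normr_gt0; last first.
      by rewrite /D -pd lt0r_neq0// den2_gt0.
    by rewrite -normrM; have := hc x; rewrite hornerM hornerX.
  have cl (f : nat -> R) : f @ \oo --> (0 : R) ->
      (fun n => ln (1 + f n) / 2) @ \oo --> (0 : R).
    move=> hf; have h1 : (fun n => 1 + f n) @ \oo --> (1 : R).
      by rewrite -[X in _ --> X]addr0; apply: cvgD hf; exact: cvg_cst.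
    have h2 : (fun n => ln (1 + f n)) @ \oo --> (0 : R).
      rewrite -[X in _ --> X](@ln1 R).
      by apply: (cvg_comp _ _ h1); apply: continuous_ln; exact: ltr01.
    by rewrite -[X in _ --> X](mul0r 2^-1); apply: cvgM h2 _; exact: cvg_cst.
  by split; [under eq_fun do rewrite la_ln; exact: (cl _ r1)
            |under eq_fun do rewrite la_ln; exact: (cl _ r2)].
have atn z : 0 < im z -> (fun n : nat => atan ((n%:R - re z) / im z)) @ \oo --> (pi / 2 : R) /\
    (fun n : nat => atan ((- n%:R - re z) / im z)) @ \oo --> (- (pi / 2) : R).
  move=> z0; have h : forall t : R, (fun n : nat => (n%:R + t) / im z) @ \oo --> +oo%R.
    move=> t; apply/cvgryPge => A; near=> n.
    rewrite ler_pdivlMr// -lerBlDr; near: n; exact: nbhs_infty_ger.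
  split; first exact: (cvg_comp _ _ (h (- re z)) (@cvgy_atan R)).
  have h2 : (fun n : nat => - atan ((n%:R + re z) / im z)) @ \oo --> (- (pi / 2) : R).
    apply: cvgN; exact: (cvg_comp _ _ (h (re z)) (@cvgy_atan R)).
  apply: cvg_trans h2; apply: near_eq_cvg; near=> n.
  by rewrite -atanN -mulNr opprD.
have [l1 l2] := lcv; have [a1 a2] := atn a a0; have [b1 b2] := atn b b0.
have t1 : (fun n : nat => ta n%:R) @ \oo --> (0 : R).
  by rewrite -[X in _ --> X](subrr (pi / 2)); exact: cvgB.
have t2 : (fun n : nat => ta (- n%:R)) @ \oo --> (0 : R).
  by rewrite -[X in _ --> X](subrr (- (pi / 2))); exact: cvgB.
have cm (k : R) (f : nat -> R) : f @ \oo --> (0 : R) -> (fun n => k * f n) @ \oo --> (0 : R).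
  by move=> hf; rewrite -[X in _ --> X](mulr0 k); apply: cvgM hf; exact: cvg_cst.
rewrite -[X in _ --> X](subrr 0) -[X in _ --> X - _](subrr 0) -[X in _ --> _ - X](subrr 0).
by apply: cvgB; apply: cvgB; apply: cm.
Unshelve. all: by end_near. Qed.

(** Two distinct roots [a] and [b] are separated by partial fractions, which shortens the list by
    one. Two roots form a base case, since a single simple pole is not integrable. *)
Lemma vanish_prod s c : (forall a, a \in s -> 0 < im a) -> (1 < size s)%N ->
  \int[mu]_(x in setT) re (c%:P.[rc x] / (prodX s).[rc x]) = 0.
Proof.
have [n] := ubnP (size s); elim: n s c => // n IH s c; rewrite ltnS => sn hs s2.
have [/constantP h|nc] := boolP (constant s).
  have [a sE] : exists a, s = nseq (size s) a by apply: h; exact: (0 : C).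
  have a0 : 0 < im a by apply: hs; rewrite sE mem_nseq eqxx andbT; exact: ltnW.
  by move: s2 sE; case: (size s) => // -[|k] // _ ->; exact: vanish_pow.
case: s sn hs s2 nc => // a s sn hs s2; rewrite /= => /allPn[b bs ba].
have ps : perm_eq (a :: s) (a :: b :: rem b s) by rewrite perm_cons perm_to_rem.
have -> : prodX (a :: s) = prodX (a :: b :: rem b s) by rewrite /prodX (perm_big _ ps).
have a0 : 0 < im a by apply: hs; rewrite mem_head.
have b0 : 0 < im b by apply: hs; rewrite inE bs orbT.
have ab : a != b by rewrite eq_sym.
have hr z : z \in rem b s -> 0 < im z.
  by move=> /mem_rem zs; apply: hs; rewrite inE zs orbT.
have sr : size (rem b s) = (size s).-1 by rewrite size_rem.
have [r0|rn] := eqVneq (rem b s) [::]; first by rewrite r0; exact: vanish_pair.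
have sr0 : (0 < size (rem b s))%N by rewrite lt0n size_eq0.
have hA z : z \in a :: rem b s -> 0 < im z by rewrite inE => /orP[/eqP ->//|/hr].
have hB z : z \in b :: rem b s -> 0 < im z by rewrite inE => /orP[/eqP ->//|/hr].
pose c' := c / (a - b).
have E x : re (c%:P.[rc x] / (prodX (a :: b :: rem b s)).[rc x]) =
    re (c'%:P.[rc x] / (prodX (a :: rem b s)).[rc x]) -
    re (c'%:P.[rc x] / (prodX (b :: rem b s)).[rc x]).
  rewrite -cReN -cReD; congr re.
  rewrite !prodX_cons !hornerM !hornerXsubC !hornerC /c'.
  have := subC_neq0 x a0; have := subC_neq0 x b0; have := prodX_neq0 x hr.
  move: (rc x) (_.[_]) => y w hw hb ha.
  by field; rewrite ha hb hw subr_eq0 ab.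
under eq_Rintegral do rewrite E.
have c1 : ((size c'%:P).+1 <= (size (rem b s)).+1)%N.
  by rewrite ltnS (leq_trans (size_polyC_leq1 _)).
have sle : ((size (rem b s)).+1 < n)%N.
  by move: sn sr sr0 => /=; move: (size s) (size (rem b s)) => x y; lia.
rewrite RintegralB//; [|exact: prodX_integrable|exact: prodX_integrable].
by rewrite !IH ?subr0//=; move: sle; lia.
Qed.

(** Division of [P] by ['X - a%:P] cancels one root and leaves a constant numerator, the case of
    [vanish_prod]. *)
Lemma vanish_rat s (P : {poly C}) : (forall a, a \in s -> 0 < im a) ->
  ((size P).+1 <= size s)%N ->
  \int[mu]_(x in setT) re (P.[rc x] / (prodX s).[rc x]) = 0.
Proof.
elim: s P => // a s IH P hs sz.
have a0 : 0 < im a by apply: hs; rewrite mem_head.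
have hs' z : z \in s -> 0 < im z by move=> zs; apply: hs; rewrite inE zs orbT.
pose P1 := P %/ ('X - a%:P); pose c := P.[a].
have PE : P = P1 * ('X - a%:P) + c%:P by rewrite /P1 /c -modp_XsubC -divp_eq.
have [P0|Pn0] := eqVneq P 0.
  by rewrite P0; under eq_Rintegral do rewrite horner0 mul0r; rewrite Rintegral_cst// mul0r.
have sP1 : size P1 = (size P).-1.
  by rewrite /P1 size_divp ?polyXsubC_eq0// size_XsubC subn1.
have sP0 : (0 < size P)%N by rewrite size_poly_gt0.
have E x : re (P.[rc x] / (prodX (a :: s)).[rc x]) =
    re (P1.[rc x] / (prodX s).[rc x]) + re (c%:P.[rc x] / (prodX (a :: s)).[rc x]).
  rewrite -cReD; congr re; rewrite {1}PE hornerD hornerM prodX_cons !hornerM !hornerXsubC !hornerC.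
  have := subC_neq0 x a0; have := prodX_neq0 x hs'.
  by move: (rc x - a) ((prodX s).[rc x]) => y w hw ha; field; rewrite ha hw.
under eq_Rintegral do rewrite E.
have s1 : ((size P1).+1 <= size s)%N by rewrite sP1 prednK.
have s2 : ((size c%:P).+1 <= (size s).+1)%N.
  rewrite ltnS (leq_trans (size_polyC_leq1 _))// (leq_trans _ s1)//.
rewrite RintegralD//; [|exact: prodX_integrable|exact: prodX_integrable].
rewrite IH// add0r; apply: vanish_prod => //=.
by rewrite ltnS (leq_trans _ s1).
Qed.

(** The contour integral statement for a function without poles in the closed lower half-plane and
    with quadratic decay; [Q] splits over the complex numbers, which reduces it to [vanish_rat]. *)
Theorem vanish (P Q : {poly C}) : Q != 0 -> (forall z, root Q z -> 0 < im z) ->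
  ((size P).+1 < size Q)%N ->
  \int[mu]_(x in setT) re (P.[rc x] / Q.[rc x]) = 0.
Proof.
move=> Q0 hQ sz; have [s sE] := closed_field_poly_normal Q.
have l0 : lead_coef Q != 0 by rewrite lead_coef_eq0.
have QE : Q = lead_coef Q *: prodX s by rewrite {1}sE.
have hs a : a \in s -> 0 < im a.
  by move=> sa; apply: hQ; rewrite QE rootZ// /prodX root_prod_XsubC.
have E x : re (P.[rc x] / Q.[rc x]) = re (((lead_coef Q)^-1 *: P).[rc x] / (prodX s).[rc x]).
  by rewrite {1}QE !hornerZ invfM mulrA [P.[_] * _]mulrC.
under eq_Rintegral do rewrite E.
apply: vanish_rat => //; rewrite size_scale ?invr_eq0//.
by move: sz; rewrite {1}QE size_scale// size_prodX ltnS.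
Qed.

End Vanish.

(** * Stable and antistable parts of rational functions *)

Section Split.
Variable R : realType.
Notation F := (ratfun R).
Notation tf := (@FracField.tofrac {poly R}).
Notation C := (R[i]).
Notation re := (@complex.Re R).
Notation im := (@complex.Im R).
Notation rc := (real_complex R).
Notation pev := (@polyC_eval R).

Lemma pev_conj (p : {poly R}) z : pev p (conjc z) = conjc (pev p z).
Proof.
rewrite /polyC_eval; set Q := map_poly rc p.
have QQ : map_poly (@conjc R) Q = Q.
  by apply/polyP => i; rewrite /Q !coef_map; apply: complexP; rewrite /= ?oppr0.
by rewrite -{1}QQ horner_map.
Qed.

(** Induction over real irreducible factors. Such a factor is linear or has a conjugate pair of
    roots; in both cases its roots share one real part, so it goes to one side as a whole. *)
Lemma stable_factorization (q : {poly R}) : q != 0 ->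
  (forall w, pev q (Complex 0 w) != 0) ->
  exists a b, [/\ q = a * b, forall z, pev a z = 0 -> re z < 0 &
    forall z, pev b z = 0 -> 0 < re z].
Proof.
have [n] := ubnP (size q); elim: n q => // n IH q; rewrite ltnS => sn q0 hq.
have [s1|s1] := leqP (size q) 1.
  exists q, 1; rewrite mulr1 (size1_polyC s1); split=> // z.
    rewrite pevC => /eqP; rewrite fmorph_eq0 => /eqP c0.
    by move: q0; rewrite (size1_polyC s1) c0 polyC0 eqxx.
  by rewrite pev1 => /eqP; rewrite oner_eq0.
have [z0 rz0] : exists z0, root (map_poly rc q) z0.
  by apply/closed_rootP; rewrite size_map_poly; apply: contraTneq s1 => ->.
have qz0 : pev q z0 = 0 by apply/eqP.
have [d [d1 dq dr]] : exists d : {poly R}, [/\ (1 < size d)%N, d %| q &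
    forall z, pev d z = 0 -> re z = re z0].
  have [i0|i0] := eqVneq (im z0) 0.
    have z0E : z0 = rc (re z0) by apply: complexP => //; rewrite i0.
    exists ('X - (re z0)%:P); split.
    - by rewrite size_XsubC.
    - rewrite dvdp_XsubCl /root; move: qz0; rewrite z0E pev_rc => /eqP.
      by rewrite fmorph_eq0.
    - move=> z; rewrite pevD pevX pevN pevC => /eqP; rewrite subr_eq0 => /eqP ->.
      by [].
  pose d : {poly R} := 'X^2 - (2 * re z0)%:P * 'X + (sqnorm z0)%:P.
  have dE : map_poly rc d = ('X - z0%:P) * ('X - (conjc z0)%:P).
    have e1 : rc (2 * re z0) = z0 + conjc z0.
      by case: (z0) => x y; apply: complexP; rewrite /= ?subrr//; ring.
    have e2 : rc (sqnorm z0) = z0 * conjc z0.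
      by case: (z0) => x y; apply: complexP; rewrite /= /sqnorm /=; ring.
    rewrite /d rmorphD rmorphB /= map_polyXn rmorphM /= map_polyX !map_polyC /= e1 e2.
    by rewrite polyCD polyCM; ring.
  exists d; split.
  - rewrite -(size_map_poly rc) dE size_mul ?polyXsubC_eq0// !size_XsubC//.
  - rewrite -(dvdp_map rc) dE Gauss_dvdp.
      rewrite !dvdp_XsubCl rz0 /=.
      by apply/eqP; rewrite -/(pev q _) pev_conj qz0 conjc0.
    rewrite coprimep_XsubC root_XsubC.
    apply: contra i0 => /eqP /(congr1 im); case: (z0) => x y /= e; apply/eqP; lra.
  - move=> z; rewrite /polyC_eval dE hornerM !hornerXsubC => /eqP.
    rewrite mulf_eq0 !subr_eq0 => /orP[/eqP -> //|/eqP ->]; by case: (z0).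
pose e := q %/ d; have qE : q = e * d by rewrite divpK.
have d0 : d != 0 by rewrite -size_poly_gt0 (ltn_trans _ d1).
have e0 : e != 0 by apply: contraNneq q0 => e0; rewrite qE e0 mul0r.
have [||a [b [eE ha hb]]] := IH e _ e0.
- rewrite (leq_trans _ sn)// qE size_mul//.
  move: d1 e0; rewrite -size_poly_gt0; move: (size e) (size d) => x y; lia.
- by move=> w; have := hq w; rewrite qE pevM mulf_eq0 negb_or => /andP[].
have zr : re z0 != 0.
  apply: contraTneq (hq (im z0)) => r0; rewrite negbK; apply/eqP.
  by have -> : Complex 0 (im z0) = z0; [exact: complexP|].
have [zn|zp] := ltP (re z0) 0.
  exists (a * d), b; split=> //; first by rewrite qE eE mulrAC.
  by move=> z; rewrite pevM => /eqP; rewrite mulf_eq0 => /orP[/eqP/ha//|/eqP/dr ->].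
exists a, (b * d); split=> //; first by rewrite qE eE mulrA.
move=> z; rewrite pevM => /eqP; rewrite mulf_eq0 => /orP[/eqP/hb//|/eqP/dr ->].
by rewrite lt_neqAle eq_sym zr.
Qed.

Lemma strictly_proper_frac (f : F) p q : q != 0 -> f * tf q = tf p ->
  (size p < size q)%N -> strictly_proper f.
Proof.
move=> q0 /rat_cross e s; rewrite /strictly_proper.
have [n0|n0] := eqVneq (rnum f) 0; first by rewrite n0 size_poly0 size_poly_gt0 rden_neq0.
have p0 : p != 0.
  by apply: contraNneq n0 => p0; move/eqP: e; rewrite p0 mul0r mulf_eq0 (negbTE q0) orbF.
have := congr1 (fun r : {poly R} => size r) e; rewrite /= !size_mul ?rden_neq0//.
move: s n0 p0; rewrite -!size_poly_gt0.
have := rden_neq0 f; rewrite -size_poly_gt0.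
by move: (size p) (size q) (size (rnum f)) (size (rden f)) => a b c d; lia.
Qed.

Lemma strictly_properD (f g : F) : strictly_proper f -> strictly_proper g ->
  strictly_proper (f + g).
Proof.
move=> hf hg; apply: (@strictly_proper_frac _ (rnum f * rden g + rnum g * rden f) (rden f * rden g)).
- by rewrite mulf_neq0 ?rden_neq0.
- by rewrite tofracD !tofracM -!rnum_rden; ring.
have := rden_neq0 f; have := rden_neq0 g; rewrite -!size_poly_gt0 => g0 f0.
rewrite (leq_ltn_trans (size_polyD _ _))// [size (rden f * _)]size_mul ?rden_neq0//.
rewrite gtn_max; apply/andP; split; rewrite (leq_ltn_trans (size_polyMleq _ _))//.
- move: hf g0 f0; rewrite /strictly_proper.
  by move: (size (rnum f)) (size (rden f)) (size (rden g)) => a b c; lia.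
- move: hg g0 f0; rewrite /strictly_proper.
  by move: (size (rnum g)) (size (rden f)) (size (rden g)) => a b c; lia.
Qed.

Lemma strictly_properN (f : F) : strictly_proper f -> strictly_proper (- f).
Proof.
move=> hf; apply: (@strictly_proper_frac _ (- rnum f) (rden f)).
- exact: rden_neq0.
- by rewrite tofracN -rnum_rden; ring.
- by rewrite size_polyN.
Qed.

Lemma strictly_proper0 : strictly_proper (0 : F).
Proof.
apply: (@strictly_proper_frac _ 0 1); rewrite ?oner_neq0 ?mul0r ?tofrac0//.
by rewrite size_poly0 size_poly1.
Qed.

Lemma strictly_properM (f g : F) : proper f -> strictly_proper g ->
  strictly_proper (f * g).
Proof.
move=> hf hg; apply: (@strictly_proper_frac _ (rnum f * rnum g) (rden f * rden g)).
- by rewrite mulf_neq0 ?rden_neq0.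
- by rewrite !tofracM -!rnum_rden; ring.
have := rden_neq0 f; have := rden_neq0 g; rewrite -!size_poly_gt0 => g0 f0.
rewrite (leq_ltn_trans (size_polyMleq _ _))// size_mul ?rden_neq0//.
move: hf hg g0 f0; rewrite /strictly_proper /proper.
move: (size (rnum f)) (size (rnum g)) (size (rden f)) (size (rden g)) => a b c d; lia.
Qed.

Lemma proper_rflip (f : F) : proper f -> proper (rflip f).
Proof.
rewrite /proper => h.
have e := rflip_frac (rnum_rden f); have /rat_cross e' := e.
have sN (p : {poly R}) : size (p \Po - 'X) = size p.
  by rewrite size_comp_poly2// size_polyN size_polyX.
have [n0|n0] := eqVneq (rnum (rflip f)) 0; first by rewrite n0 size_poly0.
have d0 := rden_neq0 f; have d0' := rden_neq0 (rflip f).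
have c0 : rden f \Po - 'X != 0 by rewrite comp_polyNX_eq0.
have p0 : rnum f \Po - 'X != 0.
  by apply: contraNneq n0 => p0; move/eqP: e'; rewrite p0 mul0r mulf_eq0 (negbTE c0) orbF.
have := congr1 (fun r : {poly R} => size r) e'; rewrite /= !size_mul// !sN.
move: h n0 p0 d0 d0'; rewrite -!size_poly_gt0 sN.
by move: (size _) (size _) (size _) (size _) => a b c d; lia.
Qed.

(** Partial fractions from a Bezout identity between the two factors of the denominator. Reducing
    the first numerator modulo [a] makes the stable part strictly proper, and the other part is then
    strictly proper as a difference. *)
Lemma stable_split (f : F) : strictly_proper f ->
  (forall w, regular (Complex 0 w) f) ->
  exists f1 f2, [/\ f = f1 + f2, strictly_proper f1 /\ no_rhp_pole f1,
    strictly_proper f2 & forall z, re z <= 0 -> regular z f2].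
Proof.
move=> sf rf; have [a [b [dE ha hb]]] := stable_factorization (rden_neq0 f) rf.
have a0 : a != 0 by apply: contraTneq (rden_neq0 f) => a0; rewrite dE a0 mul0r eqxx.
have b0 : b != 0 by apply: contraTneq (rden_neq0 f) => b0; rewrite dE b0 mulr0 eqxx.
have cop : coprimep a b.
  rewrite -(coprimep_map rc); apply/Pdiv.ClosedField.root_coprimep => z /eqP /ha h1.
  by apply/negP => /eqP /hb h2; have := lt_trans h1 h2; rewrite ltxx.
have /Bezout_eq1_coprimepP[[u v] /= uv] := cop.
pose r := (rnum f * v) %% a; pose s := (rnum f * v) %/ a.
pose f1 := tf r / tf a.
have ta0 : tf a != 0 by rewrite tofrac_eq0.
have f1E : f1 * tf a = tf r by rewrite /f1 divfK.
pose f2 := f - f1.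
have f2E : f2 * tf b = tf (rnum f * u + s * b).
  apply: (mulIf ta0); rewrite /f2.
  have -> : (f - f1) * tf b * tf a = f * tf (rden f) - f1 * tf a * tf b.
    by rewrite dE tofracM; ring.
  rewrite rnum_rden f1E.
  have rE : tf r = tf (rnum f) * tf v - tf s * tf a.
    rewrite -!tofracM -tofracB; congr tf.
    by rewrite [X in X - _](divp_eq _ a) addrC addKr.
  have uvE : tf u * tf a + tf v * tf b = 1 by rewrite -!tofracM -tofracD uv tofrac1.
  rewrite rE tofracD !tofracM -{1}[tf (rnum f)]mulr1 -uvE; ring.
have sf1 : strictly_proper f1.
  by apply: (strictly_proper_frac a0 f1E); rewrite ltn_modp.
exists f1, f2; split.
- by rewrite /f2 addrC subrK.
- split=> // z z0; apply/not_pole.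
  apply: (regular_frac (z := z) _ f1E).1.
  by apply: contraTneq z0 => /ha; rewrite ltNge.
- exact/strictly_properD/strictly_properN.
- move=> z z0; apply: (regular_frac (z := z) _ f2E).1.
  by apply: contraTneq z0 => /hb; rewrite ltNge.
Qed.

End Split.

(** * The H2 inner product on the imaginary axis *)

Section InnerProduct.
Variable R : realType.
Notation mu := (@lebesgue_measure R).
Notation F := (ratfun R).
Notation tf := (@FracField.tofrac {poly R}).
Notation C := (R[i]).
Notation re := (@complex.Re R).
Notation im := (@complex.Im R).
Notation rc := (real_complex R).
Notation pev := (@polyC_eval R).
Notation iw := (fun w : R => Complex 0 w).

(** In the variable [w] with [z = i w] the imaginary axis is the real line and the left half-plane
    is the upper one, as [vanish] requires. *)
Definition axis (p : {poly R}) : {poly C} := map_poly rc p \Po ((Complex 0 1)%:P * 'X).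

Lemma axisE p z : (axis p).[z] = pev p (Complex 0 1 * z).
Proof. by rewrite /axis horner_comp !hornerE. Qed.

Lemma iwE (w : R) : Complex 0 1 * rc w = Complex 0 w.
Proof. by apply: complexP; rewrite /=; ring. Qed.

Lemma size_axis p : size (axis p) = size p.
Proof.
have i0 : Complex 0 1 != 0 :> C.
  by apply/eqP => /(congr1 im) /= /eqP; rewrite oner_eq0.
have sX : size ((Complex 0 1 : C)%:P * 'X) = 2%N.
  by rewrite size_mulX ?polyC_eq0// size_polyC i0.
by rewrite /axis size_comp_poly2// size_map_poly.
Qed.

(** Square integrable on the axis, with poles allowed on both sides of it: the adjoint of a stable
    multiplier leads out of [RH2]. *)
Definition h2axis (f : F) := strictly_proper f /\ forall w, regular (iw w) f.

Lemma h2axisD f g : h2axis f -> h2axis g -> h2axis (f + g).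
Proof.
move=> [sf rf] [sg rg]; split; first exact: strictly_properD.
by move=> w; have [] := regularD (rf w) (rg w).
Qed.

Lemma h2axis0 : h2axis 0.
Proof. by split=> [|w]; [exact: strictly_proper0|have [] := regular0 (iw w)]. Qed.

Lemma h2axis_sum (I : Type) (r : seq I) (f : I -> F) :
  (forall i, h2axis (f i)) -> h2axis (\sum_(i <- r) f i).
Proof. by move=> h; elim/big_ind: _ => //; [exact: h2axis0|exact: h2axisD]. Qed.

Definition scal (f g : F) (w : R) : R := re (reval f (iw w) * conjc (reval g (iw w))).

Lemma scal0 g w : scal 0 g w = 0.
Proof. by rewrite /scal (regular0 (iw w)).2 mul0r. Qed.

Lemma scal_crat f g : f != 0 -> h2axis f -> h2axis g -> exists P Q : {poly C},
  [/\ forall w, Q.[rc w] != 0, ((size P).+1 < size Q)%N,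
     forall w, scal f g w = re (P.[rc w] / Q.[rc w]) &
     Q = axis (rden f) * conjp (axis (rden g))].
Proof.
move=> f0 [sf rf] [sg rg].
exists (axis (rnum f) * conjp (axis (rnum g))), (axis (rden f) * conjp (axis (rden g))).
split=> //.
- move=> w; rewrite hornerM conjpE !axisE iwE mulf_neq0// ?conjc_eq0; [exact: rf|exact: rg].
- have an0 (p : {poly R}) : p != 0 -> axis p != 0.
    by move=> p0; rewrite -size_poly_eq0 size_axis size_poly_eq0.
  have sc (p : {poly C}) : size (conjp p) = size p by rewrite /conjp size_map_poly.
  have c0 : conjp (axis (rden g)) != 0.
    by rewrite -size_poly_eq0 sc size_axis size_poly_eq0 rden_neq0.
  have h1 := size_polyMleq (axis (rnum f)) (conjp (axis (rnum g))).
  rewrite [X in (_ < X)%N]size_mul ?an0 ?rden_neq0// sc !size_axis.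
  have n0 : (0 < size (rnum f))%N.
    rewrite size_poly_gt0; apply: contraNneq f0 => n0; apply/eqP.
    have := rnum_rden f; rewrite n0 tofrac0 => /eqP; rewrite mulf_eq0 tofrac_eq0.
    by rewrite (negbTE (rden_neq0 f)) orbF => /eqP.
  move: h1 n0; rewrite sc !size_axis; move: sf sg; rewrite /strictly_proper.
  move: (size (axis (rnum f) * conjp (axis (rnum g)))%R) 
    (size (rnum f)) (size (rnum g)) (size (rden f)) (size (rden g)) => a b c d e; lia.
- move=> w; rewrite /scal /reval !hornerM !conjpE !axisE !iwE; congr re.
  by rewrite rmorphM /= fmorphV invfM mulrACA.
Qed.

Lemma scal_integrable f g : h2axis f -> h2axis g ->
  mu.-integrable setT (EFin \o scal f g).
Proof.
move=> hf hg; have [->|f0] := eqVneq f 0.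
  have -> : scal 0 g = cst 0 by apply/funext => w; exact: scal0.
  exact: integrable0.
have [P [Q [Q0 s E _]]] := scal_crat f0 hf hg.
have -> : scal f g = (fun w => re (P.[rc w] / Q.[rc w])) by apply/funext.
exact: crat_integrable.
Qed.

Lemma scalC f g w : scal f g w = scal g f w.
Proof. by rewrite /scal; case: (reval f _) => a b; case: (reval g _) => c d /=; ring. Qed.

Lemma scalDl f g h w : regular (iw w) f -> regular (iw w) g ->
  scal (f + g) h w = scal f h w + scal g h w.
Proof. by move=> rf rg; rewrite /scal (regularD rf rg).2 mulrDl cReD. Qed.

Lemma scalNl f h w : regular (iw w) f -> scal (- f) h w = - scal f h w.
Proof. by move=> rf; rewrite /scal (regularN rf).2 mulNr cReN. Qed.

(** On the axis the conjugate of [g] is its paraconjugate, whose poles are those of [g] reflected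
    into the left half-plane. All poles of the product then lie on one side. *)
Lemma scal_stable f g : h2axis f -> h2axis g ->
  no_rhp_pole f -> (forall z, re z <= 0 -> regular z g) ->
  \int[mu]_(w in setT) scal f g w = 0.
Proof.
move=> hf hg pf pg; have [->|f0] := eqVneq f 0.
  by under eq_Rintegral do rewrite scal0; rewrite Rintegral_cst// mul0r.
have [P [Q [Q0 s E QE]]] := scal_crat f0 hf hg.
under eq_Rintegral do rewrite E.
apply: vanish => //; first by apply: contraTneq (Q0 0) => ->; rewrite horner0 eqxx.
move=> z; rewrite QE rootM => /orP[].
- rewrite /root axisE => /eqP h; rewrite ltNge; apply/negP => z0.
  apply: (pf (Complex 0 1 * z)) h.
  by case: (z) z0 => x y /=; rewrite mul0r mul1r sub0r oppr_ge0.
- rewrite /conjp complex_root_conj /root axisE => /eqP h; rewrite ltNge; apply/negP => z0.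
  have hz : re (Complex 0 1 * conjc z) <= 0.
    by case: (z) z0 => x y /=; rewrite mul0r mul1r sub0r opprK.
  by have := pg _ hz; rewrite /regular h eqxx.
Qed.

Definition h2vec k (u : 'cV[F]_k) := forall i, h2axis (u i 0).

Lemma RH2_h2vec k (u : 'cV[F]_k) : RH2 u -> h2vec u.
Proof.
move=> h i; have [s p] := h i; split=> // w; apply/not_pole; exact: p.
Qed.

Lemma dot_integrable k (u v : 'cV[F]_k) : h2vec u -> h2vec v ->
  mu.-integrable setT (EFin \o (fun w => \sum_(i < k) scal (u i 0) (v i 0) w)).
Proof.
move=> hu hv.
have -> : EFin \o (fun w => \sum_(i < k) scal (u i 0) (v i 0) w) =
    (fun w => (\sum_(i < k) (scal (u i 0) (v i 0) w)%:E)%E).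
  by apply/funext => w /=; rewrite sumEFin.
by apply: integrable_sum => // i _; exact: scal_integrable.
Qed.

Lemma rh2_dotE k (u v : 'cV[F]_k) :
  rh2_dot u v = \int[mu]_(w in setT) \sum_(i < k) scal (u i 0) (v i 0) w.
Proof. by []. Qed.

Lemma rh2_dotC k (u v : 'cV[F]_k) : rh2_dot u v = rh2_dot v u.
Proof.
rewrite !rh2_dotE; apply: eq_Rintegral => w _; apply: eq_bigr => i _; exact: scalC.
Qed.

Lemma rh2_dotDl k (u v x : 'cV[F]_k) : h2vec u -> h2vec v -> h2vec x ->
  rh2_dot (u + v) x = rh2_dot u x + rh2_dot v x.
Proof.
move=> hu hv hx; rewrite !rh2_dotE -RintegralD//; [|exact: dot_integrable|exact: dot_integrable].
apply: eq_Rintegral => w _; rewrite -big_split; apply: eq_bigr => i _.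
by rewrite mxE scalDl//; [exact: (hu i).2|exact: (hv i).2].
Qed.

Lemma rh2_dotNl k (u x : 'cV[F]_k) : h2vec u -> h2vec x ->
  rh2_dot (- u) x = - rh2_dot u x.
Proof.
move=> hu hx; rewrite !rh2_dotE.
have -> : - (\int[mu]_(w in setT) (\sum_(i < k) scal (u i 0) (x i 0) w)) =
    \int[mu]_(w in setT) (-1 * \sum_(i < k) scal (u i 0) (x i 0) w).
  by rewrite RintegralZl ?mulN1r//; exact: dot_integrable.
apply: eq_Rintegral => w _; rewrite mulN1r -sumrN; apply: eq_bigr => i _.
by rewrite mxE scalNl//; exact: (hu i).2.
Qed.

Lemma rh2_dot_ge0 k (u : 'cV[F]_k) : 0 <= rh2_dot u u.
Proof.
apply: Rintegral_ge0 => w _; apply: sumr_ge0 => i _.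
by rewrite -sqnormE sqnorm_ge0.
Qed.

Lemma rh2_dot_sqnorm k (u : 'cV[F]_k) w :
  \sum_(i < k) scal (u i 0) (u i 0) w = cnorm (evmx (iw w) u).
Proof. by rewrite cnormE; apply: eq_bigr => i _; rewrite mxE sqnormE. Qed.

Lemma rh2_dot_le k l (u : 'cV[F]_k) (v : 'cV[F]_l) c : h2vec u -> h2vec v ->
  (forall w, cnorm (evmx (iw w) u) <= c * cnorm (evmx (iw w) v)) ->
  rh2_dot u u <= c * rh2_dot v v.
Proof.
move=> hu hv h; rewrite !rh2_dotE -RintegralZl//; last exact: dot_integrable.
apply: le_Rintegral => //.
- exact: dot_integrable.
- have := integrableZl measurableT c (dot_integrable hv hv); exact.
- by move=> w _; rewrite !rh2_dot_sqnorm.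
Qed.

End InnerProduct.

(** * Orthogonal projectors and the gap metric *)

Section Projection.
Variable R : realType.
Notation mu := (@lebesgue_measure R).
Notation F := (ratfun R).
Notation tf := (@FracField.tofrac {poly R}).
Notation C := (R[i]).
Notation re := (@complex.Re R).
Notation im := (@complex.Im R).
Notation rc := (real_complex R).
Notation iw := (fun w : R => Complex 0 w).

Lemma RH2P k (u : 'cV[F]_k) : RH2 u <->
  forall i, strictly_proper (u i 0) /\ forall z, 0 <= re z -> regular z (u i 0).
Proof.
split=> h i; have [s p] := h i; split=> // z z0; first by apply/not_pole; exact: p.
by apply/not_pole; exact: p.
Qed.

Lemma RH2D k (u v : 'cV[F]_k) : RH2 u -> RH2 v -> RH2 (u + v).
Proof.
move=> /RH2P hu /RH2P hv; apply/RH2P => i; have [su ru] := hu i; have [sv rv] := hv i.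
rewrite mxE; split=> [|z z0]; first exact: strictly_properD.
by have [] := regularD (ru z z0) (rv z z0).
Qed.

Lemma RH2N k (u : 'cV[F]_k) : RH2 u -> RH2 (- u).
Proof.
move=> /RH2P hu; apply/RH2P => i; have [su ru] := hu i.
rewrite mxE; split=> [|z z0]; first exact: strictly_properN.
by have [] := regularN (ru z z0).
Qed.

Lemma RH2Z k a (u : 'cV[F]_k) : RH2 u -> RH2 (rconst a *: u).
Proof.
move=> /RH2P hu; apply/RH2P => i; have [su ru] := hu i.
rewrite mxE; split=> [|z z0]; last by have [] := regularM (regularC z a).1 (ru z z0).
have [->|a0] := eqVneq a 0; first by rewrite /rconst polyC0 tofrac0 mul0r; exact: strictly_proper0.
apply: (@strictly_proper_frac _ _ (a%:P * rnum (u i 0)) (rden (u i 0))).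
- exact: rden_neq0.
- by rewrite -mulrA rnum_rden tofracM.
- by rewrite mul_polyC size_scale.
Qed.

Lemma RHinfP p q (M : 'M[F]_(p, q)) : RHinf M <->
  forall i j, proper (M i j) /\ forall z, 0 <= re z -> regular z (M i j).
Proof.
split=> h i j; have [s p'] := h i j; split=> // z z0; first by apply/not_pole; exact: p'.
by apply/not_pole; exact: p'.
Qed.

Lemma RH2_mul p q (M : 'M[F]_(p, q)) (u : 'cV[F]_q) : RHinf M -> RH2 u -> RH2 (M *m u).
Proof.
move=> /RHinfP hM /RH2P hu; apply/RH2P => i; rewrite mxE; split=> [|z z0].
  elim/big_ind: _ => [||j _]; [exact: strictly_proper0|exact: strictly_properD|].
  exact: strictly_properM (hM i j).1 (hu j).1.
have [] // := @regular_sum _ z _ (index_enum _) (fun j => M i j * u j 0) _.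
by move=> j; have [] := regularM ((hM i j).2 z z0) ((hu j).2 z z0).
Qed.

Lemma RH2_col p q (u : 'cV[F]_p) (v : 'cV[F]_q) : RH2 u -> RH2 v -> RH2 (col_mx u v).
Proof.
move=> hu hv i; have [j ->|j ->] := fintype.split_ordP i.
  by rewrite col_mxEu; exact: hu.
by rewrite col_mxEd; exact: hv.
Qed.

Lemma RHinf_col p q r (M : 'M[F]_(p, r)) (N : 'M[F]_(q, r)) :
  RHinf M -> RHinf N -> RHinf (col_mx M N).
Proof.
move=> hu hv i j; have [k ->|k ->] := fintype.split_ordP i.
  by rewrite col_mxEu; exact: hu.
by rewrite col_mxEd; exact: hv.
Qed.

Lemma rh2_dotZl k a (u x : 'cV[F]_k) : h2vec u -> h2vec x ->
  rh2_dot (rconst a *: u) x = a * rh2_dot u x.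
Proof.
move=> hu hx; rewrite !rh2_dotE -RintegralZl//; last exact: dot_integrable.
apply: eq_Rintegral => w _; rewrite mulr_sumr; apply: eq_bigr => i _.
rewrite mxE /scal (regularM (regularC (iw w) a).1 ((hu i).2 w)).2 (regularC (iw w) a).2.
by rewrite -mulrA cReM /= mul0r subr0.
Qed.

Lemma reval_conj (f : F) z : reval f (conjc z) = conjc (reval f z).
Proof. by rewrite /reval !pev_conj rmorphM /= fmorphV. Qed.

Lemma conj_iw (w : R) : conjc (iw w) = - (iw w).
Proof. by apply: complexP; rewrite /= ?oppr0. Qed.

Lemma flip_axis (f : F) w : regular (- iw w) f ->
  regular (iw w) (rflip f) /\ reval (rflip f) (iw w) = conjc (reval f (iw w)).
Proof. by move=> h; have [r ->] := rflip_regular h; rewrite -conj_iw reval_conj. Qed.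

Lemma h2vec_flip k m (T : 'M[F]_(k, m)) (u : 'cV[F]_k) : RHinf T -> RH2 u ->
  h2vec (map_mx (@rflip R) T^T *m u).
Proof.
move=> /RHinfP hT hu i; rewrite mxE; apply: h2axis_sum => j; rewrite !mxE.
have [su ru] := RH2_h2vec hu j; have [pT rT] := hT j i.
split; first by apply: strictly_properM su; exact: proper_rflip.
move=> w; have r1 : regular (- iw w) (T j i) by apply: rT; rewrite /= oppr0.
by have [] := regularM (flip_axis r1).1 (ru w).
Qed.

(** On the imaginary axis [f (- s)] is the complex conjugate of [f s], so the paraconjugate of the
    transpose is the adjoint. *)
Lemma rh2_dot_adjoint k m (T : 'M[F]_(k, m)) (u : 'cV[F]_k) (x : 'cV[F]_m) :
  RHinf T -> RH2 u -> RH2 x ->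
  rh2_dot u (T *m x) = rh2_dot (map_mx (@rflip R) T^T *m u) x.
Proof.
move=> hT hu hx; rewrite !rh2_dotE; apply: eq_Rintegral => w _.
have ru := (RH2P u).1 hu; have rx := (RH2P x).1 hx; have rT := (RHinfP T).1 hT.
have z0 : 0 <= re (iw w) by [].
have zn : 0 <= re (- iw w) by rewrite /= oppr0.
have E1 j : reval ((T *m x) j 0) (iw w) = \sum_i reval (T j i) (iw w) * reval (x i 0) (iw w).
  rewrite mxE; have [|_ ->] := @regular_sum _ (iw w) _ (index_enum _) (fun i => T j i * x i 0).
    by move=> i; have [] := regularM ((rT j i).2 _ z0) ((rx i).2 _ z0).
  by apply: eq_bigr => i _; rewrite (regularM ((rT j i).2 _ z0) ((rx i).2 _ z0)).2.
have E2 i : reval ((map_mx (@rflip R) T^T *m u) i 0) (iw w) =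
    \sum_j conjc (reval (T j i) (iw w)) * reval (u j 0) (iw w).
  rewrite mxE; have hr j : regular (iw w) (map_mx (@rflip R) T^T i j * u j 0) /\
      reval (map_mx (@rflip R) T^T i j * u j 0) (iw w) =
      conjc (reval (T j i) (iw w)) * reval (u j 0) (iw w).
    rewrite !mxE; have [f1 f2] := flip_axis ((rT j i).2 _ zn).
    by have [g1 ->] := regularM f1 ((ru j).2 _ z0); rewrite f2.
  have [|_ ->] := @regular_sum _ (iw w) _ (index_enum _)
    (fun j => map_mx (@rflip R) T^T i j * u j 0).
    by move=> j; have [] := hr j.
  by apply: eq_bigr => j _; have [] := hr j.
rewrite /scal -!cRe_sum; congr re.
under eq_bigr => j _ do rewrite E1 rmorph_sum mulr_sumr.
under [RHS]eq_bigr => i _ do rewrite E2 mulr_suml.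
rewrite exchange_big; apply: eq_bigr => i _; apply: eq_bigr => j _.
by rewrite rmorphM /= mulrCA mulrA.
Qed.

(** Since [T] is isometric, the projection of [u] is [T] applied to the stable part of the adjoint
    image of [u]. The rational splitting replaces completeness, and the antistable remainder is
    orthogonal to [RH2] by [scal_stable]. *)
Lemma orth_proj_exists k m (T : 'M[F]_(k, m)) : RHinf T ->
  map_mx (@rflip R) T^T *m T = 1%:M ->
  exists Pi, is_orth_proj [set T *m w | w in @RH2 R m] Pi.
Proof.
move=> hT TT.
suff h (u : 'cV[F]_k) : exists p, RH2 u -> (exists2 x, RH2 x & T *m x = p) /\
    forall v, (exists2 x, RH2 x & T *m x = v) -> rh2_dot (u - p) v = 0.
  by have [Pi hPi] := choice h; exists Pi => u /hPi.
(* Nothing is asked of the projector outside [RH2], so 0 is a harmless default there. *)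
have [hu|nu] := pselect (RH2 u); last by exists 0.
pose h := map_mx (@rflip R) T^T *m u.
have hh : h2vec h := h2vec_flip hT hu.
have sp i : exists f, [/\ strictly_proper f /\ no_rhp_pole f,
    strictly_proper (h i 0 - f) & forall z, re z <= 0 -> regular z (h i 0 - f)].
  have [f1 [f2 [fE s1 s2 r2]]] := stable_split (hh i).1 (hh i).2.
  by exists f1; rewrite fE addrC addKr.
have [f hf] := choice sp.
pose hp : 'cV[F]_m := \col_i f i.
have rhp : RH2 hp by move=> i; rewrite mxE; have [] := hf i.
exists (T *m hp) => _; split; first by exists hp.
move=> _ [x hx <-].
have a1 : h2vec u := RH2_h2vec hu.
have a2 : h2vec (T *m hp) := RH2_h2vec (RH2_mul hT rhp).
have a3 : h2vec (T *m x) := RH2_h2vec (RH2_mul hT hx).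
have a4 : h2vec (- (T *m hp)) := RH2_h2vec (RH2N (RH2_mul hT rhp)).
have a5 : h2vec (- hp) := RH2_h2vec (RH2N rhp).
rewrite rh2_dotDl// rh2_dotNl// !rh2_dot_adjoint//; last exact: RH2_mul.
rewrite mulmxA TT mul1mx -/h -rh2_dotNl//; last exact: RH2_h2vec.
  rewrite -rh2_dotDl//; last exact: RH2_h2vec.
  rewrite rh2_dotC rh2_dotE.
  have hE i : (h - hp) i 0 = h i 0 - f i.
    by rewrite [LHS]mxE [(- hp) i 0]mxE [hp i 0]mxE.
  have hd : h2vec (h - hp).
    by move=> i; have [_ s2 r2] := hf i; rewrite hE; split=> // w; apply: r2.
  rewrite /Rintegral; under eq_integral do rewrite -sumEFin.
  rewrite integral_sum//; last by move=> i; exact: scal_integrable (RH2_h2vec hx i) (hd i).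
  rewrite big1// => i _.
  have := scal_stable (RH2_h2vec hx i) (hd i) (hx i).2.
  have [_ _ r2] := hf i; rewrite hE => /(_ r2).
  rewrite /Rintegral => i0; rewrite -[LHS]fineK ?i0//.
  apply: integrable_fin_num => //.
  have := scal_integrable (RH2_h2vec hx i) (hd i).
  by rewrite hE.
exact: RH2_h2vec.
Qed.

Lemma young_arith (c1 c2 c3 e : R) : 0 < e -> c1 <= e ^+ 2 * c2 ->
  2 * c2 <= e^-1 ^+ 2 * c1 + e ^+ 2 * c3 -> c2 <= e ^+ 2 * c3.
Proof.
move=> e0 h1 h2; have : e^-1 ^+ 2 * c1 <= c2.
  by rewrite exprVn mulrC ler_pdivrMr ?exprn_gt0// mulrC.
move: h2; lra.
Qed.

Lemma rh2_dotBl k (x y v : 'cV[F]_k) : RH2 x -> RH2 y -> RH2 v ->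
  rh2_dot (x - y) v = rh2_dot x v - rh2_dot y v.
Proof.
move=> hx hy hv.
rewrite (rh2_dotDl (RH2_h2vec hx) (RH2_h2vec (RH2N hy)) (RH2_h2vec hv)).
by rewrite (rh2_dotNl (RH2_h2vec hy) (RH2_h2vec hv)).
Qed.

Lemma rh2_dot_sub k (x y : 'cV[F]_k) : RH2 x -> RH2 y ->
  rh2_dot (x - y) (x - y) = rh2_dot x x - 2 * rh2_dot x y + rh2_dot y y.
Proof.
move=> hx hy; have hxy := RH2D hx (RH2N hy).
rewrite (rh2_dotBl hx hy hxy) (rh2_dotC x (x - y)) (rh2_dotC y (x - y)).
rewrite (rh2_dotBl hx hy hx) (rh2_dotBl hx hy hy) (rh2_dotC y x).
move: (rh2_dot x x) (rh2_dot x y) (rh2_dot y y) => c1 c2 c3; ring.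
Qed.

Lemma rh2_dot_young k (x y : 'cV[F]_k) (eps : R) : RH2 x -> RH2 y -> 0 < eps ->
  2 * rh2_dot x y <= eps^-1 ^+ 2 * rh2_dot x x + eps ^+ 2 * rh2_dot y y.
Proof.
move=> hx hy e0; have hx' := RH2_h2vec hx; have hy' := RH2_h2vec hy.
have zx := RH2Z eps^-1 hx; have zy := RH2Z eps hy.
have en : eps != 0 by rewrite gt_eqF.
have := rh2_dot_ge0 (rconst eps^-1 *: x - rconst eps *: y).
rewrite (rh2_dot_sub zx zy) (rh2_dotZl _ hx' (RH2_h2vec zx)) (rh2_dotZl _ hx' (RH2_h2vec zy)).
rewrite (rh2_dotZl _ hy' (RH2_h2vec zy)) (rh2_dotC x (rconst eps^-1 *: x)).
rewrite (rh2_dotC x (rconst eps *: y)) (rh2_dotC y (rconst eps *: y)).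
rewrite (rh2_dotZl _ hx' hx') (rh2_dotZl _ hy' hx') (rh2_dotZl _ hy' hy') (rh2_dotC y x).
move: (rh2_dot x x) (rh2_dot x y) (rh2_dot y y) => c1 c2 c3.
by rewrite mulKf// !mulrA -!expr2; lra.
Qed.

(** Let [b = Pi2 u] and [r = u - b]. Then [Pi1 u - Pi2 u] is the difference of the orthogonal
    vectors [d = Pi1 u - Pi1 b] and [b - Pi1 b]. The second is bounded by the distance from [b] to
    [S1]; for the first, [|d|^2 = <d, r> = <d - g', r>] with [g'] in [S2] close to [d]. The two
    bounds add up because [|u|^2 = |b|^2 + |r|^2]. *)
Lemma orth_proj_gap k (S1 S2 : set 'cV[F]_k) Pi1 Pi2 (eps : R) : 0 < eps ->
  (forall g, S1 g -> RH2 g) -> (forall g, S2 g -> RH2 g) ->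
  (forall g h, S1 g -> S1 h -> S1 (g - h)) ->
  (forall g, S1 g -> exists2 g', S2 g' & rh2_dot (g - g') (g - g') <= eps ^+ 2 * rh2_dot g g) ->
  (forall g, S2 g -> exists2 g', S1 g' & rh2_dot (g - g') (g - g') <= eps ^+ 2 * rh2_dot g g) ->
  is_orth_proj S1 Pi1 -> is_orth_proj S2 Pi2 ->
  forall u, RH2 u ->
  rh2_dot (Pi1 u - Pi2 u) (Pi1 u - Pi2 u) <= eps ^+ 2 * rh2_dot u u.
Proof.
move=> e0 R1 R2 lin1 near12 near21 P1 P2 u hu.
have H (x : 'cV[F]_k) : RH2 x -> h2vec x := @RH2_h2vec _ _ x.
have dB := @rh2_dotBl k; have dBB := @rh2_dot_sub k.
set a := Pi1 u; set b := Pi2 u.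
have [S1a oa] := P1 u hu; have [S2b ob] := P2 u hu; rewrite -/a -/b in S1a oa S2b ob.
have ha := R1 _ S1a; have hb := R2 _ S2b.
set c := Pi1 b; have [S1c oc] := P1 b hb; rewrite -/c in S1c oc; have hc := R1 _ S1c.
have S1d := lin1 _ _ S1a S1c; set d := a - c in S1d; have hd := R1 _ S1d.
pose r := u - b; have hr : RH2 r := RH2D hu (RH2N hb).
have uE : rh2_dot u u = rh2_dot b b + rh2_dot r r.
  have := dBB u b hu hb; rewrite -/r; have := ob b S2b; rewrite dB//.
  by move: (rh2_dot u b) (rh2_dot b b) (rh2_dot u u) (rh2_dot r r) => c1 c2 c3 c4; lra.
have bc : rh2_dot (b - c) (b - c) <= eps ^+ 2 * rh2_dot b b.
  have [g' S1g hg] := near21 b S2b; apply: le_trans hg; have hg' := R1 _ S1g.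
  have hbc := RH2D hb (RH2N hc).
  have o1 := oc _ (lin1 _ _ S1g S1c).
  have -> : b - g' = (b - c) - (g' - c) by rewrite opprB addrA subrK.
  rewrite [leRHS]dBB//; last exact: RH2D hg' (RH2N hc).
  by rewrite o1 mulr0 subr0 lerDl rh2_dot_ge0.
have dd : rh2_dot d d <= eps ^+ 2 * rh2_dot r r.
  have [g' S2g hg] := near12 d S1d; have hg' := R2 _ S2g.
  have d1 : rh2_dot d d = rh2_dot (d - g') r.
    have e1 : rh2_dot g' r = 0 by rewrite rh2_dotC; exact: ob.
    have e2 : rh2_dot u d = rh2_dot a d.
      by apply/eqP; rewrite -subr_eq0 -(dB _ _ _ hu ha hd); apply/eqP; exact: oa.
    have e3 : rh2_dot b d = rh2_dot c d.
      by apply/eqP; rewrite -subr_eq0 -(dB _ _ _ hb hc hd); apply/eqP; exact: oc.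
    rewrite (dB _ _ _ hd hg' hr) e1 subr0 [RHS]rh2_dotC (dB _ _ _ hu hb hd) e2 e3.
    exact: (dB _ _ _ ha hc hd).
  have hx : RH2 (d - g') := RH2D hd (RH2N hg').
  have := rh2_dot_young hx hr e0; rewrite -d1; exact: young_arith e0 hg.
have hbc := RH2D hb (RH2N hc).
have -> : a - b = d - (b - c) by rewrite /d opprB addrA subrK.
have o0 : rh2_dot d (b - c) = 0 by rewrite rh2_dotC; exact: oc.
by rewrite (dBB _ _ hd hbc) uE mulrDr o0 mulr0 subr0 [leRHS]addrC lerD.
Qed.

Lemma cnorm_col p q (u : 'cV[C]_p) (v : 'cV[C]_q) : cnorm (col_mx u v) = cnorm u + cnorm v.
Proof. by rewrite /cnorm !map_col_mx !dot_col_mx addrACA. Qed.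

Section Graph.
Variables (m : nat) (G K M N : 'M[F]_m).
Hypothesis GK : (1%:M + G) *m K = 1%:M.
Hypothesis hK : RHinf K.
Hypothesis ncf : is_ncf G M N.

Lemma graph_coordinates (w : 'cV[F]_m) :
  M *m w = K *m (M *m w + N *m w) /\ M *m w + N *m w = (1%:M + G) *m (M *m w).
Proof.
have [_ [uM _ GE] _ _] := ncf.
have NE : N = G *m M by rewrite GE mulmxKV.
have e : M *m w + N *m w = (1%:M + G) *m (M *m w).
  by rewrite NE mulmxDl mul1mx mulmxA.
split=> //; have KG : K *m (1%:M + G) = 1%:M by exact: mulmx1C.
by rewrite e mulmxA KG mul1mx.
Qed.

(** The Bezout coefficients supply the preimage [X (K e) + Y (e - K e)], so the graph is
    parametrized by all [e] in [RH2]. *)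
Lemma graph_surjective (e : 'cV[F]_m) : RH2 e -> exists2 w, RH2 w &
  M *m w = K *m e /\ N *m w = e - K *m e.
Proof.
move=> he; have [[hM hN] [uM _ GE] [X [Y [hX hY XY]]] _] := ncf.
have NE : N = G *m M by rewrite GE mulmxKV.
have GKe : G *m (K *m e) = e - K *m e.
  by rewrite -[X in _ = X - _]mul1mx -GK mulmxDl mul1mx mulmxDl addrC mulmxA addKr.
have KGe := RH2_mul hK he.
pose w := X *m (K *m e) + Y *m (e - K *m e).
have wE : M *m w = K *m e.
  rewrite /w -GKe; have -> : X *m (K *m e) + Y *m (G *m (K *m e)) =
      (X *m M + Y *m N) *m (invmx M *m (K *m e)).
    by rewrite NE mulmxDl -!mulmxA mulKVmx.
  by rewrite XY mul1mx mulKVmx.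
exists w; first by apply: RH2D; apply: RH2_mul => //; exact: RH2D he (RH2N KGe).
by rewrite wE; split=> //; rewrite NE -mulmxA wE.
Qed.

End Graph.

(** Points with the same [e = u + y] are matched; they differ by [D] and [- D] in the two
    components, where [D = (K1 - K2) e]. The squared distance [2 |D|^2] and the estimate
    [|e|^2 <= 2 (|u|^2 + |y|^2)] each contribute a factor two, whence the factor 2 in front of
    [kap]. *)
Lemma graph_near m (G1 G2 K1 K2 M1 N1 M2 N2 : 'M[F]_m) (kap : R) :
  (1%:M + G1) *m K1 = 1%:M -> (1%:M + G2) *m K2 = 1%:M -> RHinf K2 ->
  is_ncf G1 M1 N1 -> is_ncf G2 M2 N2 ->
  (forall w x, cnorm (evmx (iw w) (K1 - K2) *m x) <= kap ^+ 2 * cnorm x) ->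
  RHinf (K1 - K2) ->
  forall g, [set col_mx M1 N1 *m w | w in @RH2 R m]%classic g ->
  exists2 g', [set col_mx M2 N2 *m w | w in @RH2 R m]%classic g' &
    rh2_dot (g - g') (g - g') <= (2 * kap) ^+ 2 * rh2_dot g g.
Proof.
move=> GK1 GK2 hK2 n1 n2 near hD _ [w hw <-].
have [[hM1 hN1] _ _ _] := n1; have [[hM2 hN2] _ _ _] := n2.
set p1 := M1 *m w; set q1 := N1 *m w; pose e := p1 + q1.
have hp1 : RH2 p1 := RH2_mul hM1 hw; have hq1 : RH2 q1 := RH2_mul hN1 hw.
have he : RH2 e := RH2D hp1 hq1.
have [p1E _] := graph_coordinates GK1 n1 w; rewrite -/p1 -/q1 -/e in p1E.
have [w' hw' [p2E q2E]] := graph_surjective GK2 hK2 n2 he.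
exists (col_mx M2 N2 *m w'); first by exists w'.
rewrite !mul_col_mx -/p1 -/q1 p2E q2E.
have -> : col_mx p1 q1 - col_mx (K2 *m e) (e - K2 *m e) =
    col_mx ((K1 - K2) *m e) (- ((K1 - K2) *m e)).
  rewrite opp_col_mx add_col_mx; congr col_mx; first by rewrite mulmxBl -p1E.
  rewrite mulmxBl -p1E; have -> : q1 = e - p1 by rewrite /e addrC addKr.
  by rewrite [- (e - _)]opprB addrC addrA subrK opprB.
have hDe : RH2 ((K1 - K2) *m e) := RH2_mul hD he.
apply: rh2_dot_le.
- by apply: RH2_h2vec; apply: RH2_col => //; exact: RH2N.
- by apply: RH2_h2vec; apply: RH2_col.
move=> t; rewrite /evmx !map_col_mx !cnorm_col -!/(evmx _ _).
have z0 : 0 <= re (iw t) by [].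
have regv k (v : 'cV[F]_k) : RH2 v -> regmx (iw t) v.
  by move=> hv i j; rewrite ord1; exact: ((RH2P v).1 hv i).2.
have [_ ->] := regmxN (regv _ _ hDe).
have -> : cnorm (- evmx (iw t) ((K1 - K2) *m e)) = cnorm (evmx (iw t) ((K1 - K2) *m e)).
  by rewrite /cnorm reMN imMN !dot_lin !opprK.
have [_ ->] := regmxM (RHinf_regmx hD z0) (regv _ _ he).
have := near t (evmx (iw t) e).
have -> : evmx (iw t) e = evmx (iw t) p1 + evmx (iw t) q1.
  exact: (regmxD (regv _ _ hp1) (regv _ _ hq1)).2.
move: (evmx _ p1) (evmx _ q1) (cnorm (_ *m _)) => a b D hh.
have : cnorm (a + b) <= 2 * (cnorm a + cnorm b).
  rewrite /cnorm reMD imMD.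
  have h1 := dot_ge0 (map_mx re a - map_mx re b).
  have h2 := dot_ge0 (map_mx im a - map_mx im b).
  move: h1 h2; rewrite !dot_lin [dot (map_mx re b) (map_mx re a)]dotC.
  rewrite [dot (map_mx im b) (map_mx im a)]dotC; lra.
move=> h3; have h4 := ler_wpM2l (sqr_ge0 kap) h3; move: hh h4.
rewrite exprMn; move: (kap ^+ 2) (cnorm (a + b)) (cnorm a) (cnorm b) => k x y z; nra.
Qed.

Theorem gap_metric_le m (G1 G2 K1 K2 : 'M[F]_m) (kap : R) :
  0 <= kap ->
  (1%:M + G1) *m K1 = 1%:M -> (1%:M + G2) *m K2 = 1%:M -> RHinf K1 -> RHinf K2 ->
  (exists M N, is_ncf G1 M N) -> (exists M N, is_ncf G2 M N) ->
  generic (fun z => 0 < re z -> forall x, cnorm (evmx z (K1 - K2) *m x) <= kap ^+ 2 * cnorm x) ->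
  (gap_metric G1 G2 <= (2 * kap)%:E)%E.
Proof.
move=> k0 GK1 GK2 hK1 hK2 ex1 ex2 near.
have hD : RHinf (K1 - K2) := bounded_RHinf near.
have near1 w x : cnorm (evmx (iw w) (K1 - K2) *m x) <= kap ^+ 2 * cnorm x.
  by apply: bounded_evmx near _.
have hD2 : RHinf (K2 - K1).
  have -> : K2 - K1 = - (K1 - K2) by rewrite opprB.
  apply/RHinfP => i j; have [pr rg] := (RHinfP _).1 hD i j; rewrite mxE; split=> [|z z0].
    move: pr; rewrite /proper => pr.
    have e : rnum (- (K1 - K2) i j) * rden ((K1 - K2) i j) =
        - rnum ((K1 - K2) i j) * rden (- (K1 - K2) i j).
      by apply: rat_cross; rewrite tofracN -rnum_rden mulNr.
    have := congr1 (fun p : {poly R} => size p) e.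
    have [->|n0] := eqVneq (rnum (- (K1 - K2) i j)) 0; first by rewrite size_poly0.
    have [z0|n0'] := eqVneq (rnum ((K1 - K2) i j)) 0.
      move/eqP: e; rewrite z0 oppr0 mul0r mulf_eq0 (negbTE n0).
      by rewrite (negbTE (rden_neq0 _)).
    rewrite /= !size_mul ?oppr_eq0 ?rden_neq0// size_polyN.
    move: pr n0 n0' (rden_neq0 (- (K1 - K2) i j)) (rden_neq0 ((K1 - K2) i j)).
    rewrite -!size_poly_gt0.
    by move: (size _) (size _) (size _) (size _) => a b c d; lia.
  by have [] := regularN (rg z z0).
have near2 w x : cnorm (evmx (iw w) (K2 - K1) *m x) <= kap ^+ 2 * cnorm x.
  have -> : K2 - K1 = - (K1 - K2) by rewrite opprB.
  have [_ ->] := regmxN (RHinf_regmx (z := iw w) hD (lexx _)).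
  rewrite mulNmx; have := near1 w x; rewrite /cnorm reMN imMN !dot_lin !opprK.
  by [].
have key d : (exists Pi1 Pi2, [/\ is_ncf_proj G1 Pi1, is_ncf_proj G2 Pi2 &
    d = rh2_opnorm (fun u => Pi1 u - Pi2 u)]) -> (d <= (2 * kap)%:E)%E.
  move=> [Pi1 [Pi2 [[M1 [N1 [n1 o1]]] [M2 [N2 [n2 o2]]] ->]]].
  have [[hM1 hN1] _ _ _] := n1; have [[hM2 hN2] _ _ _] := n2.
  have bnd (eps : R) u : 0 < eps -> 2 * kap <= eps -> RH2 u ->
      rh2_dot (Pi1 u - Pi2 u) (Pi1 u - Pi2 u) <= eps ^+ 2 * rh2_dot u u.
    move=> e0 ke hu.
    have sq : (2 * kap) ^+ 2 <= eps ^+ 2 by rewrite ler_sqr ?nnegrE ?mulr_ge0// ltW.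
    apply: (orth_proj_gap e0 _ _ _ _ _ o1 o2 hu).
    - by move=> _ [w hw <-]; apply: RH2_mul hw; exact: RHinf_col.
    - by move=> _ [w hw <-]; apply: RH2_mul hw; exact: RHinf_col.
    - move=> _ _ [w hw <-] [w' hw' <-]; exists (w - w'); first exact: RH2D hw (RH2N hw').
      by rewrite mulmxBr.
    - move=> g /(graph_near GK1 GK2 hK2 n1 n2 near1 hD)[g' Sg' hg]; exists g' => //.
      by rewrite (le_trans hg)// ler_wpM2r ?rh2_dot_ge0.
    - move=> g /(graph_near GK2 GK1 hK1 n2 n1 near2 hD2)[g' Sg' hg]; exists g' => //.
      by rewrite (le_trans hg)// ler_wpM2r ?rh2_dot_ge0.
  apply: ge_ereal_sup => _ [u [hu u1] <-]; rewrite lee_fin.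
  (* A positive [t] is added because [orth_proj_gap] divides by [eps], while [kap] may be 0. *)
  apply/ler_addgt0Pr => t t0; pose eps := 2 * kap + t.
  have e0 : 0 < eps by rewrite ltr_wpDl ?mulr_ge0.
  have h := bnd eps u e0 _ hu; rewrite /rh2_norm in u1 *.
  rewrite -/eps.
  rewrite -[eps]ger0_norm ?(ltW e0)// -sqrtr_sqr ler_sqrt ?sqr_ge0//.
  rewrite (le_trans (h _))//; first by rewrite lerDl ltW.
  rewrite -[leRHS]mulr1 ler_wpM2l ?sqr_ge0//.
  have := u1; rewrite -[X in _ <= X]sqrtr1 ler_sqrt//.
have [M1 [N1 n1]] := ex1; have [M2 [N2 n2]] := ex2.
have pr (G M N : 'M[F]_m) : is_ncf G M N -> exists Pi, is_ncf_proj G Pi.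
  move=> n; have [[hM hN] _ _ norm] := n.
  have [||Pi hPi] := @orth_proj_exists _ _ (col_mx M N).
  - exact: RHinf_col.
  - by rewrite tr_col_mx map_row_mx mul_row_col.
  by exists Pi, M, N.
have [Pi1 h1] := pr _ _ _ n1; have [Pi2 h2] := pr _ _ _ n2.
rewrite /gap_metric; apply: key.
(* Factorizations and projectors exist, so [xget] returns an attained value and not the default
   [+oo]. *)
apply: (@xgetPex _ +oo%E [set d | exists Pi1 Pi2, [/\ is_ncf_proj G1 Pi1, is_ncf_proj G2 Pi2 &
    d = rh2_opnorm (fun u => Pi1 u - Pi2 u)]]%classic).
by exists (rh2_opnorm (fun u => Pi1 u - Pi2 u)), Pi1, Pi2.
Qed.

End Projection.

(** * The chain of truncations *)

Section GainBound.
Variable R : realType.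
Notation F := (ratfun R).
Notation re := (@complex.Re R).
Notation im := (@complex.Im R).
Notation reM := (map_mx (@complex.Re R)).
Notation imM := (map_mx (@complex.Im R)).

Definition gain_le p q (K : 'M[F]_(p, q)) (k : R) : Prop :=
  generic (fun z => 0 < re z -> forall x, cnorm (evmx z K *m x) <= k ^+ 2 * cnorm x).

Lemma cnorm_le0 n (v : 'cV[R[i]]_n) : cnorm v <= 0 -> v = 0.
Proof.
move=> h; apply/colP => i; rewrite mxE; apply/eqP.
have /psumr_eq0P h0 : \sum_i sqnorm (v i 0) = 0.
  by apply/eqP; rewrite eq_le sumr_ge0 -?cnormE ?h// => j _; exact: sqnorm_ge0.
by rewrite -sqnorm_eq0; apply/eqP/h0 => // j _; exact: sqnorm_ge0.
Qed.

(** Triangle inequality for squared norms. The cross term is bounded by the square of [b x - a y],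
    which requires positive weights; zero weights are treated beforehand. *)
Lemma cnormD_le n (x y : 'cV[R[i]]_n) (a b c : R) : 0 <= a -> 0 <= b ->
  cnorm x <= a ^+ 2 * c -> cnorm y <= b ^+ 2 * c -> cnorm (x + y) <= (a + b) ^+ 2 * c.
Proof.
rewrite le_eqVlt => /orP[/eqP <-|a0]; rewrite le_eqVlt => /orP[/eqP <-|b0].
- rewrite addr0 expr0n /= mul0r => /cnorm_le0 -> /cnorm_le0 ->; rewrite addr0.
  by rewrite cnormE big1// => i _; rewrite mxE /sqnorm /= expr0n addr0.
- by rewrite expr0n /= mul0r => /cnorm_le0 ->; rewrite !add0r.
- by move=> h; rewrite expr0n /= mul0r => /cnorm_le0 ->; rewrite !addr0.
move=> hx hy; have ab : 0 < a * b by rewrite mulr_gt0.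
have h1 := dot_ge0 (b *: reM x - a *: reM y).
have h2 := dot_ge0 (b *: imM x - a *: imM y).
have : a * b * cnorm (x + y) <= (a + b) * (b * cnorm x + a * cnorm y).
  rewrite /cnorm reMD imMD; move: h1 h2; rewrite !dot_lin.
  rewrite [dot (reM y) (reM x)]dotC [dot (imM y) (imM x)]dotC.
  move: (dot _ _) (dot _ _) (dot _ _) (dot _ _) (dot _ _) (dot _ _) => p q r s t u.
  nra.
have : b * cnorm x + a * cnorm y <= a * b * ((a + b) * c).
  have := ler_wpM2l (ltW b0) hx; have := ler_wpM2l (ltW a0) hy; lra.
move: (cnorm _) (_ + a * cnorm y) => t u hu ht.
rewrite -(ler_pM2l ab) (le_trans ht)//.
by have := ler_wpM2l (ltW (addr_gt0 a0 b0)) hu; lra.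
Qed.

Lemma gain_leD p q (K K' : 'M[F]_(p, q)) a b : 0 <= a -> 0 <= b ->
  gain_le K a -> gain_le K' b -> gain_le (K + K') (a + b).
Proof.
move=> a0 b0 hK hK'.
have := genericI (genericI (generic_regmx K) (generic_regmx K')) (genericI hK hK').
apply: genericW => z [[rK rK'] [h h']] z0 x.
by rewrite (regmxD rK rK').2 mulmxDl; apply: cnormD_le; [| |exact: h|exact: h'].
Qed.

Lemma gain_le0 p q (a : R) : gain_le (0 : 'M[F]_(p, q)) a.
Proof.
exists 1; first exact: oner_neq0.
move=> z _ _ x; have -> : evmx z (0 : 'M[F]_(p, q)) = 0.
  by apply/matrixP => i j; rewrite !mxE (regular0 z).2.
rewrite mul0mx {1}cnormE big1 => [|i _]; last by rewrite mxE /sqnorm /= expr0n addr0.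
by apply: mulr_ge0; [exact: sqr_ge0|exact: cnorm_ge0].
Qed.

Lemma gain_le_telescope p q (K : nat -> 'M[F]_(p, q)) (a : nat -> R) (k l : nat) :
  (k <= l)%N -> (forall i, (k <= i < l)%N -> 0 <= a i) ->
  (forall i, (k <= i < l)%N -> gain_le (K i.+1 - K i) (a i)) ->
  gain_le (K l - K k) (\sum_(k <= i < l) a i).
Proof.
move=> /subnK <-; elim: (l - k)%N => [|d IH] a0 h.
  by rewrite add0n subrr big_geq//; exact: gain_le0.
rewrite addSn big_nat_recr ?leq_addl//=.
have -> : K (d + k).+1 - K k = (K (d + k)%N - K k) + (K (d + k).+1 - K (d + k)%N).
  by rewrite [RHS]addrC addrA subrK.
apply: gain_leD.
- rewrite big_nat; apply: sumr_ge0 => i /andP[ki il].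
  by apply: a0; rewrite ki ltnS ltnW.
- by apply: a0; rewrite leq_addl leqnn.
- by apply: IH => i /andP[ki il]; [apply: a0|apply: h]; rewrite ki ltnS ltnW.
- by apply: h; rewrite leq_addl leqnn.
Qed.

End GainBound.

(** * Truncation by coordinate projectors *)

Section Mask.
Variable R : realType.
Notation F := (ratfun R).
Notation tf := (@FracField.tofrac {poly R}).
Notation lift := (map_mx (@rconst R)).
Notation re := (@complex.Re R).
Notation im := (@complex.Im R).
Notation reM := (map_mx (@complex.Re R)).
Notation imM := (map_mx (@complex.Im R)).

(** Truncation by a projector [E] keeps the dimension. All truncations then share one state space,
    in which their trajectories can be added and subtracted. *)
Definition masked_loop N m (A : 'M[R]_N) (B : 'M[R]_(N, m)) (E : 'M[R]_N) : 'M[F]_m :=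
  loop (E *m A *m E) (E *m B) (B^T *m E).

(** [z x] lies in the range of [E] and [z] is nonzero, so [x] lies there too; the division by
    [z = a + i b] is written out in real and imaginary parts. *)
Lemma masked_invariant N m (A : 'M[R]_N) (B : 'M[R]_(N, m)) (E : 'M[R]_N) (a b : R)
    (p q : 'cV[R]_N) (u v : 'cV[R]_m) : 0 < a -> E *m E = E ->
  a *: p - b *: q = E *m A *m E *m p + E *m B *m u ->
  a *: q + b *: p = E *m A *m E *m q + E *m B *m v ->
  E *m p = p /\ E *m q = q.
Proof.
move=> a0 EE h1 h2.
have inE (y w : 'cV[R]_N) (c : 'cV[R]_m) : y = E *m A *m E *m w + E *m B *m c -> E *m y = y.
  by move=> ->; rewrite mulmxDr -!mulmxA ![E *m (E *m _)]mulmxA EE.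
have e1 := inE _ _ _ h1; have e2 := inE _ _ _ h2.
have n0 : a ^+ 2 + b ^+ 2 != 0 by rewrite gt_eqF ?ltr_wpDr ?sqr_ge0 ?exprn_gt0.
have pE : p = (a ^+ 2 + b ^+ 2)^-1 *: (a *: (a *: p - b *: q) + b *: (a *: q + b *: p)).
  by apply/colP => i; rewrite !mxE; field.
have qE : q = (a ^+ 2 + b ^+ 2)^-1 *: (a *: (a *: q + b *: p) - b *: (a *: p - b *: q)).
  by apply/colP => i; rewrite !mxE; field.
split; [rewrite pE|rewrite qE]; rewrite -scalemxAr.
- by rewrite mulmxDr -!scalemxAr e1 e2.
- by rewrite mulmxBr -!scalemxAr e1 e2.
Qed.

Lemma masked_trajectory N m (A : 'M[R]_N) (B : 'M[R]_(N, m)) (C : 'M[R]_(m, N)) z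
    (w : 'cV[R[i]]_m) :
  regmx z (resolvent (A + B *m (- C)) B) -> regmx z (loop A B C) ->
  exists (x : 'cV[R[i]]_N) (u : 'cV[R[i]]_m), [/\ evmx z (loop A B C) *m w = u,
      re z *: reM x - im z *: imM x = A *m reM x + B *m reM u,
      re z *: imM x + im z *: reM x = A *m imM x + B *m imM u,
      reM u + C *m reM x = reM w & imM u + C *m imM x = imM w].
Proof.
move=> r1 r2; have [h1 h2 h3 h4] := loop_trajectory w r1 r2.
by exists (evmx z (resolvent (A + B *m (- C)) B) *m w), (evmx z (loop A B C) *m w).
Qed.

Lemma evmx_sub p q (K K' : 'M[F]_(p, q)) z (w : 'cV[R[i]]_q) u u' :
  regmx z K -> regmx z K' -> evmx z K *m w = u -> evmx z K' *m w = u' ->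
  evmx z (K - K') *m w = u - u'.
Proof.
move=> r r' <- <-; have [rN eN] := regmxN r'.
by have [_ ->] := regmxD r rN; rewrite eN mulmxBl.
Qed.

Lemma masked_gain N m (Sg Th E E' A : 'M[R]_N) (B : 'M[R]_(N, m)) (s : R) :
  psdmx Sg -> psdmx Th -> E^T = E -> Sg *m E = E *m Sg -> Th *m E = E *m Th ->
  Sg *m (E - E') = s *: (E - E') -> s ^+ 2 *: (Th *m (E - E')) = s *: (E - E') ->
  dissipative Sg A -> dissipative Th A -> Sg *m B = B -> Th *m B = B ->
  E *m E = E -> E' *m E' = E' -> E *m E' = E' -> E'^T = E' ->
  gain_le (masked_loop A B E - masked_loop A B E') s.
Proof.
move=> /psdmx_dot[sSg Sg0] /psdmx_dot[sTh Th0] sE cSg cTh KSg KTh dS dT SB TB EE E'E' EE' sE'.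
rewrite /gain_le /masked_loop.
set AE := E *m A *m E; set AE' := E' *m A *m E'.
set BE := E *m B; set BE' := E' *m B; set CE := B^T *m E; set CE' := B^T *m E'.
have := genericI (genericI (generic_regmx (resolvent (AE + BE *m (- CE)) BE))
    (generic_regmx (loop AE BE CE)))
  (genericI (generic_regmx (resolvent (AE' + BE' *m (- CE')) BE'))
    (generic_regmx (loop AE' BE' CE'))).
apply: genericW => z [[r1 r2] [r1' r2']] z0 w.
have [x [u [uE h1 h2 h3 h4]]] := masked_trajectory w r1 r2.
have [x' [u' [uE' h1' h2' h3' h4']]] := masked_trajectory w r1' r2'.
rewrite (evmx_sub r2 r2' uE uE'); clear r1 r2 r1' r2' uE uE'.
have [Er Ei] := masked_invariant z0 EE h1 h2.
have [Er' Ei'] := masked_invariant z0 E'E' h1' h2'.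
rewrite /cnorm reMD imMD reMN imMN.
apply: (truncation_bound (om := im z) sSg sTh sE cSg cTh KSg KTh dS dT SB TB E'E' EE' sE' Sg0 Th0 (ltW z0)
  Er Er' Ei Ei').
- by rewrite h1 /AE /BE -!mulmxA Er mulmxDr.
- by rewrite h2 /AE /BE -!mulmxA Ei mulmxDr.
- by rewrite h1' /AE' /BE' -!mulmxA Er' mulmxDr.
- by rewrite h2' /AE' /BE' -!mulmxA Ei' mulmxDr.
- by rewrite -h3 /CE -mulmxA Er.
- by rewrite -h4 /CE -mulmxA Ei.
- by rewrite -h3' /CE' -mulmxA Er'.
- by rewrite -h4' /CE' -mulmxA Ei'.
Qed.

Lemma masked_RHinf N m (Sg E A : 'M[R]_N) (B : 'M[R]_(N, m)) :
  psdmx Sg -> E^T = E -> Sg *m E = E *m Sg -> E *m E = E ->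
  dissipative Sg A -> Sg *m B = B -> RHinf (masked_loop A B E).
Proof.
move=> pS sE cS EE dS SB; apply: bounded_RHinf; apply: loop_bound pS _ _.
- move=> x; rewrite -!mulmxA mulmxA cS -mulmxA dot_mulr sE; exact: dS.
- by rewrite mulmxA cS -mulmxA SB trmx_mul trmxK sE.
Qed.

(** [T] embeds the kept coordinates isometrically and intertwines the two resolvents. *)
Lemma selected_transfer N r m (A E : 'M[R]_N) (B : 'M[R]_(N, m)) (T : 'M[R]_(N, r)) :
  T^T *m T = 1%:M -> T *m T^T = E ->
  transfer (T^T *m A *m T) (T^T *m B) (B^T *m T) 0 =
  transfer (E *m A *m E) (E *m B) (B^T *m E) 0.
Proof.
move=> TT TE; rewrite !transferE.
have ET : E *m T = T by rewrite -TE -mulmxA TT mulmx1.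
suff -> : resolvent (E *m A *m E) (E *m B) =
    lift T *m resolvent (T^T *m A *m T) (T^T *m B).
  by rewrite mulmxA -map_mxM -[B^T *m E *m T]mulmxA ET.
apply/esym/resolvent_uniq; rewrite scalemxAr resolventP mulmxDr !mulmxA -!map_mxM !mulmxA TE.
by rewrite -[E *m A *m E *m T]mulmxA ET.
Qed.

End Mask.

(** * Transfer function of the balanced system *)

Section FullTransfer.
Variable R : realType.
Notation F := (ratfun R).
Notation lift := (map_mx (@rconst R)).
Variables (N m : nat) (A P L U : 'M[R]_N) (B : 'M[R]_(N, m)) (s d : 'rV[R]_N).
Let S := diag_mx s.
Hypothesis s_sign : forall i, s 0 i = 1 \/ s 0 i = -1.
Hypothesis d_ge0 : forall i, 0 <= d 0 i.
Hypothesis SAS : S *m A *m S = A^T.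
Hypothesis SB : S *m B = B.
Hypothesis PL : P = L^T *m L.
Hypothesis dA : dissipative P A.
Hypothesis PB : P *m B = B.
Hypothesis oU : U^T *m U = 1%:M.
Hypothesis eig : L *m S *m L^T = U *m S *m diag_mx d *m U^T.
Local Notation Q := (S *m P *m S).
Local Notation V := (bal_V L U s d).
Local Notation W := (bal_W L U s d).
Local Notation Ah := (bal_A A L U s d).
Local Notation Bh := (bal_B L U B s d).
Local Notation E := (bal_supp d).

Let SS : S *m S = 1%:M. Proof. exact: bal_SS. Qed.

(** Dual of [dissipative_ker]: by the sign symmetry the kernel of [Q] is invariant under [A^T], so
    the range of [Q] is invariant under [A]. *)
Lemma range_invariant : exists D, A *m Q = Q *m D.
Proof.
suff /submxP[D h] : (Q *m A^T <= Q)%MS.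
  exists D^T; apply: trmx_inj; rewrite !trmx_mul !trmxK.
  have sP : P^T = P by rewrite PL trmx_mul trmxK.
  have sS : S^T = S by exact: diag_mx_tr.
  by rewrite sP sS [S *m (P *m S)]mulmxA.
rewrite submxE; apply/eqP; set Z := cokermx _.
have PSZ : P *m (S *m Z) = 0.
  have : S *m (Q *m Z) = 0 by rewrite mulmx_coker mulmx0.
  by rewrite -!mulmxA mulmxA SS mul1mx.
have PASZ : P *m (A *m (S *m Z)) = 0.
  apply/matrixP => i j; have := dissipative_ker PL dA (z := col j (S *m Z)).
  rewrite colE mulmxA PSZ mul0mx => /(_ erefl); rewrite !mulmxA -colE => /colP/(_ i).
  by rewrite !mxE.
by rewrite -SAS -!mulmxA [S *m (S *m _)]mulmxA SS mul1mx PASZ mulmx0.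
Qed.

Lemma range_B : B = Q *m B.
Proof. by rewrite -!mulmxA SB PB SB. Qed.

Lemma range_WA p (X : 'M[R]_(N, p)) : W *m (A *m (Q *m X)) = Ah *m (W *m (Q *m X)).
Proof.
have := bal_W_invariant s_sign d_ge0 PL dA oU eig.
move=> /(congr1 (fun M => M *m X)); rewrite /bal_A -!mulmxA => <-.
by [].
Qed.

Lemma range_WB p (X : 'M[R]_(N, p)) : Bh^T *m (W *m (Q *m X)) = B^T *m (Q *m X).
Proof.
have VB := bal_V_B s_sign d_ge0 SB PL PB oU eig.
have sP : P^T = P by rewrite PL trmx_mul trmxK.
have BP : B^T = B^T *m P by rewrite -[in LHS]PB trmx_mul sP.
have := congr1 (fun M => B^T *m (M *m X)) (bal_PZ s_sign d_ge0 PL oU eig).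
rewrite -VB; move: (bal_V _ _ _ _) (bal_W _ _ _ _) => v w.
by rewrite trmx_mul trmxK -!mulmxA [B^T *m (P *m _)]mulmxA -BP [B^T *m (P *m _)]mulmxA -BP.
Qed.

Lemma supp_W : E *m W = W.
Proof. by rewrite /bal_W !mulmxA bal_Hsupp. Qed.

Lemma supp_V : V *m E = V.
Proof. by rewrite /bal_V -!mulmxA [_ *m E]diag_mxC bal_Hsupp. Qed.

Lemma lift_mul3 p q r t o (a : 'M[R]_(p, q)) (b : 'M[R]_(q, r)) (c : 'M[R]_(r, t)) (x : 'M[F]_(t, o)) :
  lift a *m (lift b *m (lift c *m x)) = lift (a *m (b *m c)) *m x.
Proof. by rewrite !map_mxM !mulmxA. Qed.

Lemma resolvent_intertwine r k (A' : 'M[R]_r) (B' : 'M[R]_(N, k)) (X : 'M[R]_(r, N)) :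
  lift X *m (lift A *m resolvent A B') = lift A' *m (lift X *m resolvent A B') ->
  resolvent A' (X *m B') = lift X *m resolvent A B'.
Proof.
by move=> h; apply/esym/resolvent_uniq; rewrite scalemxAr resolventP mulmxDr h map_mxM.
Qed.

(** [W] is known to intertwine [A] and [Ah] on the range of [Q]. This range is invariant under [A]
    and contains the columns of [B], so the resolvent takes its values in it, which is [rE]. *)
Lemma full_transfer : transfer (E *m Ah *m E) (E *m Bh) (Bh^T *m E) 0 = transfer A B B^T 0.
Proof.
have absorb (w v a e : 'M[R]_N) : e *m w = w -> v *m e = v -> e *m (w *m a *m v) *m e = w *m a *m v.
  by move=> h1 h2; rewrite !mulmxA h1 -!mulmxA h2.
have -> : E *m Ah *m E = Ah by exact: absorb supp_W supp_V.
have EB : E *m Bh = Bh by rewrite /bal_B mulmxA supp_W.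
have absorb_tr (b : 'M[R]_(N, m)) (e : 'M[R]_N) : e^T = e -> e *m b = b -> b^T *m e = b^T.
  by move=> h1 h2; rewrite -[in RHS]h2 trmx_mul h1.
have -> : Bh^T *m E = Bh^T by apply: absorb_tr EB; exact: diag_mx_tr.
rewrite EB !transferE.
have [D hD] := range_invariant.
have rE : resolvent A B = lift Q *m resolvent D B.
  apply/esym/resolvent_uniq; rewrite scalemxAr resolventP mulmxDr !mulmxA -!map_mxM.
  by rewrite hD -range_B.
suff -> : resolvent Ah Bh = lift W *m resolvent A B.
  rewrite rE lift_mul3; have := range_WB 1%:M; rewrite !mulmx1 => ->.
  by rewrite map_mxM mulmxA.
apply: resolvent_intertwine; rewrite rE !lift_mul3.
by have := range_WA 1%:M; rewrite !mulmx1 => ->.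
Qed.

End FullTransfer.

(** * Multiplicities and index ranges *)

Section RepeatSeq.
Variable R : realType.
Implicit Types (sv : seq R) (mult : seq nat).

Lemma rank_truncS q mult : rank_trunc q.+1 mult = (rank_trunc q mult + nth 0 mult q)%N.
Proof.
elim: q mult => [|q IH] [|k mult]; rewrite /rank_trunc //= ?take0 ?addn0 ?add0n//.
by have := IH mult; rewrite /rank_trunc => ->; rewrite addnA.
Qed.

Lemma rank_trunc_size mult : rank_trunc (size mult) mult = sumn mult.
Proof. by rewrite /rank_trunc take_size. Qed.

Lemma rank_trunc_le q mult : (rank_trunc q mult <= sumn mult)%N.
Proof. by rewrite -{2}(cat_take_drop q mult) sumn_cat leq_addr. Qed.

Lemma repeat_seq_cons x k sv mult :
  repeat_seq (x :: sv) (k :: mult) = nseq k x ++ repeat_seq sv mult.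
Proof. by []. Qed.

Lemma size_repeat_seq sv mult : size mult = size sv -> size (repeat_seq sv mult) = sumn mult.
Proof.
elim: sv mult => [|x sv IH] [|k mult] //= [/IH e].
by rewrite repeat_seq_cons size_cat size_nseq e.
Qed.

Lemma take_repeat_seq q sv mult : size mult = size sv ->
  repeat_seq (take q sv) (take q mult) = take (rank_trunc q mult) (repeat_seq sv mult).
Proof.
elim: sv mult q => [|x sv IH] [|k mult] [|q] //=; first by rewrite /rank_trunc /= take0.
move=> [/IH e]; rewrite !repeat_seq_cons e /rank_trunc /= take_cat size_nseq.
by rewrite ltnNge leq_addr addKn.
Qed.

Lemma nth_repeat_seq q i sv mult : size mult = size sv ->
  (rank_trunc q mult <= i < rank_trunc q.+1 mult)%N -> (repeat_seq sv mult)`_i = sv`_q.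
Proof.
elim: sv mult q i => [|x sv IH] [|k mult] q i //=.
move=> [hs]; rewrite repeat_seq_cons nth_cat size_nseq nth_nseq.
case: q => [|q]; first by rewrite /rank_trunc /= take0 addn0 => /= ->.
rewrite /rank_trunc /= => /andP[h1 h2]; have ki : (k <= i)%N by rewrite (leq_trans (leq_addr _ _) h1).
rewrite ltnNge ki /=; apply: IH => //.
by rewrite /rank_trunc leq_subRL// h1 ltn_subLR.
Qed.

Lemma repeat_seq_level i mult : (i < sumn mult)%N ->
  exists2 q, (q < size mult)%N & (rank_trunc q mult <= i < rank_trunc q.+1 mult)%N.
Proof.
elim: mult i => [|k mult IH] i //= h; have [ik|ki] := ltnP i k.
  by exists 0%N => //; rewrite /rank_trunc /= take0 addn0.
have [|q qs hq] := IH (i - k)%N; first by rewrite ltn_subLR.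
exists q.+1 => //; move: hq; rewrite /rank_trunc /= leq_subRL// ltn_subLR//.
Qed.

Variables (n : nat) (sv : seq R) (mult : seq nat).
Hypothesis svP : is_sv_list n sv mult.

Lemma sv_list_bounds q : 0 <= sv`_q <= 1.
Proof.
have [_ /allP h _ _ _] := svP; have [hq|hq] := ltnP q (size sv).
  exact: h (mem_nth _ hq).
by rewrite nth_default// lexx ler01.
Qed.

(** Holds past the end as well, where [nth] returns 0. The condition that the entry at [q] be 0 thus
    covers the case that no value is left to remove. *)
Lemma sv_list_anti p q : (p <= q)%N -> sv`_q <= sv`_p.
Proof.
have [hs _ _ _ _] := svP; rewrite leq_eqVlt => /orP[/eqP -> //|pq].
have [hq|hq] := ltnP q (size sv); last by rewrite nth_default//; have /andP[] := sv_list_bounds p.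
apply: ltW; apply: (sorted_ltn_nth _ _ hs _ _ _ _ pq); rewrite ?inE//.
- by move=> x y z /= h1 h2; exact: lt_trans h2 h1.
- exact: ltn_trans pq hq.
Qed.

Lemma sv_list_level i : (i < n)%N -> exists2 q, (q < size sv)%N &
  (rank_trunc q mult <= i < rank_trunc q.+1 mult)%N /\ (repeat_seq sv mult)`_i = sv`_q.
Proof.
have [_ _ hs _ <-] := svP; move=> /repeat_seq_level[q]; rewrite hs => qs h.
by exists q => //; split=> //; exact: nth_repeat_seq.
Qed.

Lemma rank_trunc_mono p q : (p <= q)%N -> (rank_trunc p mult <= rank_trunc q mult)%N.
Proof.
move=> /subnK <-; elim: (q - p)%N => [//|k IH].
by rewrite addSn rank_truncS (leq_trans IH) ?leq_addr.
Qed.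

Lemma sv_list_bounds_nth i : 0 <= (repeat_seq sv mult)`_i <= 1.
Proof.
have [hs _ hm _ hn] := svP; have [hi|hi] := ltnP i n.
  by have [q _ [_ ->]] := sv_list_level hi; exact: sv_list_bounds.
by rewrite nth_default ?lexx ?ler01// size_repeat_seq// hn.
Qed.

Lemma sv_list_head q i : (0 < q)%N -> (i < rank_trunc q mult)%N ->
  0 < sv`_q.-1 -> 0 < (repeat_seq sv mult)`_i.
Proof.
have [_ _ hm _ hn] := svP; move=> q0 iq /lt_le_trans; apply.
have hi : (i < n)%N by rewrite (leq_trans iq)// -hn rank_trunc_le.
have [p _ [/andP[h1 h2] ->]] := sv_list_level hi; apply: sv_list_anti.
rewrite -ltnS prednK//; rewrite ltnNge; apply/negP => qp.
by have := leq_trans iq (leq_trans (rank_trunc_mono qp) h1); rewrite ltnn.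
Qed.

Lemma sv_list_tail q i : (rank_trunc q mult <= i)%N -> sv`_q = 0 ->
  (repeat_seq sv mult)`_i = 0.
Proof.
have [_ _ hm _ hn] := svP => qi q0; have [hi|hi] := ltnP i n; last first.
  by rewrite nth_default// size_repeat_seq// hn.
have [p _ [/andP[h1 h2] ->]] := sv_list_level hi; apply/eqP; rewrite eq_le.
have /andP[-> _] := sv_list_bounds p; rewrite andbT -[leRHS]q0; apply: sv_list_anti.
rewrite -ltnS ltnNge; apply/negP => pq.
by have := leq_trans h2 (leq_trans (rank_trunc_mono pq) qi); rewrite ltnn.
Qed.

End RepeatSeq.

Section DiagMask.
Variable R : realType.

Definition mask_mx N (J : pred 'I_N) : 'M[R]_N := diag_mx (\row_i (J i)%:R).

Lemma mask_mxM N (J J' : pred 'I_N) : mask_mx J *m mask_mx J' = mask_mx (predI J J').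
Proof.
rewrite /mask_mx mulmx_diag; congr diag_mx; apply/rowP => i; rewrite !mxE /=.
by case: (J i); case: (J' i); rewrite ?mulr0 ?mulr1.
Qed.

Lemma eq_mask_mx N (J J' : pred 'I_N) : J =1 J' -> mask_mx J = mask_mx J'.
Proof. by move=> h; congr diag_mx; apply/rowP => i; rewrite !mxE h. Qed.

Lemma psd_diag N (v : 'rV[R]_N) : (forall i, 0 <= v 0 i) -> psdmx (diag_mx v).
Proof.
move=> v0; apply/psdmx_dot; split=> [|x]; first exact: diag_mx_tr.
rewrite dotE; apply: sumr_ge0 => i _; rewrite mul_diag_mx mxE mulrCA.
by rewrite mulr_ge0// -expr2 sqr_ge0.
Qed.

(** On the coordinates in [J] the entries of [d] are nonzero, so the squared [inv_sqrt_diag d] is a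
    true inverse there; this gives the condition on [s ^+ 2] in [masked_gain]. *)
Lemma mask_gain N m (A : 'M[R]_N) (B : 'M[R]_(N, m)) (d : 'rV[R]_N) (J J' : pred 'I_N) s :
  (forall i, 0 <= d 0 i) ->
  dissipative (diag_mx d) A -> dissipative (inv_sqrt_diag d *m inv_sqrt_diag d) A ->
  diag_mx d *m B = B -> inv_sqrt_diag d *m inv_sqrt_diag d *m B = B ->
  (forall i, J' i -> J i) -> (forall i, J i -> d 0 i != 0) ->
  (forall i, J i -> ~~ J' i -> d 0 i = s) ->
  gain_le (masked_loop A B (mask_mx J) - masked_loop A B (mask_mx J')) s.
Proof.
move=> d0 dS dT SB TB J'J Jd Js.
have dif i : ((J i)%:R - (J' i)%:R : R) = (J i && ~~ J' i)%:R.
  by have := J'J i; case: (J i); case: (J' i) => //= h; rewrite ?subrr ?subr0//; have := h isT.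
apply: (masked_gain (Sg := diag_mx d) (Th := inv_sqrt_diag d *m inv_sqrt_diag d)) => //.
- exact: psd_diag.
- rewrite mulmx_diag; apply: psd_diag => i; rewrite !mxE -expr2; exact: sqr_ge0.
- exact: diag_mx_tr.
- exact: diag_mxC.
- by rewrite mulmx_diag; exact: diag_mxC.
- apply/matrixP => i j; rewrite mul_diag_mx !mxE -mulrnBl dif.
  have [_|_] := eqVneq i j; last by rewrite !mulr0n !mulr0.
  by case: andP => [[h1 h2]|_]; rewrite ?mulr0// (Js _ h1 h2).
- apply/matrixP => i j; rewrite mulmx_diag mul_diag_mx !mxE -mulrnBl dif.
  have [_|_] := eqVneq i j; last by rewrite !mulr0n !mulr0.
  case: andP => [[h1 h2]|_]; rewrite ?mulr0// -(Js _ h1 h2) !mulr1n !mulr1.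
  have := Jd _ h1; have := d0 i; rewrite le_eqVlt => /orP[/eqP <-|dp _]; first by rewrite eqxx.
  rewrite -{1}(sqr_sqrtr (ltW dp)) -[RHS](sqr_sqrtr (ltW dp)).
  have : Num.sqrt (d 0 i) != 0 by rewrite gt_eqF ?sqrtr_gt0.
  by move: (Num.sqrt _) => r r0; field.
- by rewrite mask_mxM; apply: eq_mask_mx => i /=; rewrite andbb.
- by rewrite mask_mxM; apply: eq_mask_mx => i /=; rewrite andbb.
- rewrite mask_mxM; apply: eq_mask_mx => i /=; apply/idP/idP => [/andP[]//|h].
  by rewrite h J'J.
- exact: diag_mx_tr.
Qed.

End DiagMask.

(** * Passivity *)

Section SquareRule.
Variable R : realType.
Notation mu := (@lebesgue_measure R).
Variables (f : R -> R) (T : R).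
Notation D := `[0, T]%classic.
Hypothesis intf : mu.-integrable D (EFin \o f).
Let h x := \int[mu]_(s in `[0, x]) f s.
Let g := f \_ D.
Let phi (z : R * R) : R := if z.1 <= z.2 then g z.1 * g z.2 else 0.

Let mD : measurable (D : set R). Proof. exact: measurable_itv. Qed.

Let ig : mu.-integrable setT (EFin \o g).
Proof.
have := (integrable_mkcond (mu := mu) (EFin \o f) mD).1 intf.
by rewrite restrict_EFin.
Qed.

Let mg : measurable_fun setT g.
Proof. by have /integrableP[/measurable_EFinP] := ig. Qed.

Let mprod : measurable_fun setT (fun z : R * R => g z.1 * g z.2).
Proof.
apply: measurable_funM; exact: measurableT_comp.
Qed.

Let mphi : measurable_fun setT phi.
Proof.
apply: measurable_fun_ifT => //; exact: measurable_fun_ler.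
Qed.

Let iprod : (mu \x mu)%E.-integrable setT (EFin \o (fun z : R * R => g z.1 * g z.2)).
Proof.
apply/integrable12ltyP; first exact/measurable_EFinP.
have mag : measurable_fun setT (fun y => (`|g y|)%:E).
  by apply/measurable_EFinP; exact: measurableT_comp.
have J0 : (\int[mu]_y (`|g y|)%:E \is a fin_num)%E.
  by apply: integrable_fin_num => //; have := integrable_abse ig.
under eq_integral => x _.
  under eq_integral => y _ do rewrite /= normrM EFinM.
  rewrite ge0_integralZl//.
  over.
rewrite -(fineK J0) ge0_integralZr//; last first.
  by rewrite lee_fin fine_ge0// integral_ge0// => y _; rewrite lee_fin.
by rewrite -(fineK J0) -EFinM ltry.
Qed.

Let iphi : (mu \x mu)%E.-integrable setT (EFin \o phi).
Proof.
apply: le_integrable iprod => //; first exact/measurable_EFinP.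
move=> z _; rewrite /= lee_fin /phi; case: ifP => // _.
by rewrite normr0.
Qed.

Let sub_int (a b : R) : 0 <= a -> b <= T -> mu.-integrable `[a, b] (EFin \o f).
Proof.
move=> a0 bT; apply: integrableS intf => // x /=.
by rewrite !in_itv /= => /andP[h1 h2]; rewrite (le_trans a0 h1) (le_trans h2 bT).
Qed.

Let inner (c a b : R) : 0 <= a -> b <= T ->
  (\int[mu]_y ((fun y => c * f y) \_ `[a, b] y)%:E = (c * \int[mu]_(y in `[a, b]) f y)%:E)%E.
Proof.
move=> a0 bT; have i := sub_int a0 bT.
rewrite EFinM /Rintegral fineK ?integrable_fin_num// -integralZl// integral_mkcond.
by apply: eq_integral => y _; rewrite !patchE; case: ifP.
Qed.

Let inner1 x : (\int[mu]_y (phi (x, y))%:E = ((fun x => f x * (h T - h x)) \_ D x)%:E)%E.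
Proof.
rewrite patchE; case: ifPn => [|xD].
  rewrite inE /= in_itv /= => /andP[x0 xT].
  have -> : h T - h x = \int[mu]_(y in `[x, T]) f y.
    rewrite /h Rintegral_itvB ?bnd_simp// Rintegral_itv_obnd_cbnd//.
    by apply: integrableS (sub_int x0 (lexx T)) => //; exact: subset_itv_oc_cc.
  rewrite -(inner (f x) x0 (lexx T)); apply: eq_integral => y _; congr EFin.
  rewrite /phi /= /g !patchE !mem_setE /= !in_itv /= x0 xT /=.
  have [xy|xy] := leP x y; last by [].
  by rewrite (le_trans x0 xy) /=; case: ifP; rewrite ?mulr0.
under eq_integral => y _.
  have -> : phi (x, y) = 0 by rewrite /phi /= /g patchE (negbTE xD) mul0r; case: ifP.
  over.
exact: integral0.
Qed.

Let inner2 y : (\int[mu]_x (phi (x, y))%:E = ((fun y => f y * h y) \_ D y)%:E)%E.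
Proof.
rewrite patchE; case: ifPn => [|yD].
  rewrite inE /= in_itv /= => /andP[y0 yT].
  rewrite -(inner (f y) (lexx 0) yT); apply: eq_integral => x _; congr EFin.
  rewrite /phi /= /g !patchE !mem_setE /= !in_itv /= y0 yT /= mulrC.
  have [xy|xy] := leP x y; last by rewrite andbF.
  by rewrite (le_trans xy yT) /= andbT; case: ifP; rewrite ?mulr0.
under eq_integral => x _.
  have -> : phi (x, y) = 0 by rewrite /phi /= /g [X in _ * X]patchE (negbTE yD) mulr0; case: ifP.
  over.
exact: integral0.
Qed.

Lemma integrable_mul_primitive : mu.-integrable D (EFin \o (fun x => f x * h x)).
Proof.
have ih : mu.-integrable D (EFin \o (fun x => f x * (h T - h x))).
  apply: (integrable_mkcond (mu := mu) _ mD).2; rewrite restrict_EFin.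
  have := integrable_fubini_F iphi; rewrite /fubini_F.
  by congr (integrable mu _ _); apply/funext => y; exact: inner1.
have i1 : mu.-integrable D (fun x => (h T)%:E * (f x)%:E)%E by exact: integrableZl.
have : mu.-integrable D (fun x => (h T)%:E * (f x)%:E - (f x * (h T - h x))%:E)%E.
  exact: integrableB.
apply: eq_integrable => // x _; rewrite /= -EFinM -EFinB; congr EFin.
by rewrite mulrBr [h T * _]mulrC opprB addrC subrK.
Qed.

(** Fubini for [f z.1 * f z.2] on the triangle [z.1 <= z.2]: the two orders of integration give the
    integrals of [f (h T - h)] and of [f h]. This is integration by parts for a primitive of a
    function that is merely integrable. *)
Lemma primitive_sqr : h T ^+ 2 = 2 * \int[mu]_(x in D) (f x * h x).
Proof.
have ifh := integrable_mul_primitive.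
have := Fubini iphi.
under eq_integral do rewrite inner1.
under [in RHS]eq_integral do rewrite inner2.
move=> /(congr1 fine); rewrite -!/(Rintegral _ _ _) -!Rintegral_mkcond.
have -> : \int[mu]_(x in D) (f x * (h T - h x)) =
    h T * \int[mu]_(x in D) f x - \int[mu]_(x in D) (f x * h x).
  rewrite -RintegralZl// -RintegralB//; last first.
    have i1 : mu.-integrable D (fun x => (h T)%:E * (f x)%:E)%E by exact: integrableZl.
    by apply: eq_integrable i1.
  by apply: eq_Rintegral => x _; rewrite mulrBr [h T * _]mulrC.
rewrite -/(h T); lra.
Qed.

End SquareRule.

Section Passivity.
Variable R : realType.
Notation mu := (@lebesgue_measure R).
Notation itg T f := (mu.-integrable `[0, T]%classic (EFin \o f)).

Lemma itgD (T : R) f g : itg T f -> itg T g -> itg T (fun s => f s + g s).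
Proof.
move=> hf hg.
have h : mu.-integrable `[0, T]%classic (fun s => (f s)%:E + (g s)%:E)%E by exact: integrableD.
by apply: eq_integrable h.
Qed.

Lemma itgZ (T a : R) f : itg T f -> itg T (fun s => a * f s).
Proof.
move=> hf.
have h : mu.-integrable `[0, T]%classic (fun s => a%:E * (f s)%:E)%E by exact: integrableZl.
by apply: eq_integrable h.
Qed.

Lemma itg0 (T : R) : itg T (fun=> 0).
Proof. exact: integrable0. Qed.

Lemma itg_sum (T : R) (I : Type) (r : seq I) (f : I -> R -> R) :
  (forall i, itg T (f i)) -> itg T (fun s => \sum_(i <- r) f i s).
Proof.
move=> h; elim: r => [|i r IH].
  by apply: eq_integrable (itg0 T) => // x _ /=; rewrite big_nil.
apply: eq_integrable (itgD (h i) IH) => // x _ /=; by rewrite big_cons.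
Qed.

Lemma Rint_sum (T : R) (I : Type) (r : seq I) (f : I -> R -> R) :
  (forall i, itg T (f i)) ->
  \int[mu]_(s in `[0, T]) (\sum_(i <- r) f i s) = \sum_(i <- r) \int[mu]_(s in `[0, T]) f i s.
Proof.
move=> h; elim: r => [|i r IH].
  rewrite big_nil; under eq_Rintegral do rewrite big_nil.
  by rewrite Rintegral_cst// mul0r.
under eq_Rintegral do rewrite big_cons.
by rewrite RintegralD// ?IH ?big_cons//; exact: itg_sum.
Qed.

(** Chain rule for the square of an absolutely continuous function given in integrated form. *)
Lemma solution_sqr (X f : R -> R) (T : R) : 0 <= T -> itg T f ->
  (forall s, 0 <= s <= T -> X s = X 0 + \int[mu]_(r in `[0, s]) f r) ->
  itg T (fun s => X s * f s) /\
  X T ^+ 2 = X 0 ^+ 2 + 2 * \int[mu]_(s in `[0, T]) (X s * f s).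
Proof.
move=> T0 hf hX; pose h s := \int[mu]_(r in `[0, s]) f r.
have ih : itg T (fun s => f s * h s) := integrable_mul_primitive hf.
have XE : {in `[0, T]%classic, (fun s => X s * f s) =1 (fun s => X 0 * f s + f s * h s)}.
  by move=> s; rewrite inE /= in_itv /= => /hX ->; rewrite mulrDl [f s * _]mulrC.
have iX : itg T (fun s => X 0 * f s + f s * h s) by exact: itgD (itgZ _ hf) ih.
split; first by apply: eq_integrable iX => // s /XE /= ->.
rewrite (eq_Rintegral mu XE) RintegralD//; last exact: itgZ.
rewrite RintegralZl// hX ?T0 ?lexx//= -/(h T).
have := primitive_sqr hf; rewrite -/(h T) => e; rewrite mulrDr -e; ring.
Qed.

Variables (N m : nat).
Implicit Types (x : R -> 'cV[R]_N).

Lemma L2_measurable k (x : R -> 'cV[R]_k) (T : R) i : locally_L2 x -> 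
  measurable_fun `[0, T]%classic (fun t => x t i 0).
Proof.
move=> /(_ i)[hm _]; apply: measurable_funS hm => //.
by move=> s /=; rewrite !in_itv /= => /andP[->].
Qed.

Lemma L2_sqr k (x : R -> 'cV[R]_k) (T : R) i : 0 < T -> locally_L2 x ->
  itg T (fun t => x t i 0 ^+ 2).
Proof.
move=> T0 hx; have [_ /(_ T T0) h] := hx i; apply/integrableP; split.
  by apply/measurable_EFinP; apply: measurable_funX; exact: L2_measurable.
by under eq_integral do rewrite /= ger0_norm ?sqr_ge0//.
Qed.

Lemma L2_mul k l (x : R -> 'cV[R]_k) (y : R -> 'cV[R]_l) (T : R) i j :
  0 < T -> locally_L2 x -> locally_L2 y -> itg T (fun t => x t i 0 * y t j 0).
Proof.
move=> T0 hx hy; apply: le_integrable (itgD (L2_sqr i T0 hx) (L2_sqr j T0 hy)) => //.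
  by apply/measurable_EFinP; apply: measurable_funM; exact: L2_measurable.
move=> s _; rewrite /= lee_fin [leRHS]ger0_norm ?addr_ge0 ?sqr_ge0//.
rewrite ler_norml; have := sqr_ge0 (x s i 0 + y s j 0); have := sqr_ge0 (x s i 0 - y s j 0).
by have := sqr_ge0 (x s i 0); have := sqr_ge0 (y s j 0); move: (x s i 0) (y s j 0) => a b; nra.
Qed.

Lemma L2_itg k (x : R -> 'cV[R]_k) (T : R) i : 0 < T -> locally_L2 x -> itg T (fun t => x t i 0).
Proof.
move=> T0 hx.
have i1 : itg T (fun=> 1).
  apply/integrableP; split; first exact/measurable_EFinP.
  under eq_integral do rewrite /= normr1.
  by rewrite integral_cst// mul1e /= lebesgue_measure_itv /=; case: ifP => _; rewrite ltry.
have : itg T (fun t => 1 + x t i 0 ^+ 2) by exact: itgD (L2_sqr i T0 hx).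
apply: le_integrable => //; first by apply/measurable_EFinP; exact: L2_measurable.
move=> s _; rewrite /= lee_fin [leRHS]ger0_norm ?addr_ge0 ?sqr_ge0//.
rewrite ler_norml; move: (x s i 0) => a; have := sqr_ge0 (a - 1); have := sqr_ge0 (a + 1); nra.
Qed.

Lemma itg_mulmx k l (M : 'M[R]_(l, k)) (x : R -> 'cV[R]_k) (T : R) i :
  0 < T -> locally_L2 x -> itg T (fun t => (M *m x t) i 0).
Proof.
move=> T0 hx.
have := @itg_sum T _ (index_enum 'I_k) (fun j s => M i j * x s j 0) (fun j => itgZ _ (L2_itg j T0 hx)).
by apply: eq_integrable => // s _ /=; rewrite mxE.
Qed.

(** For a diagonal storage matrix the scalar rule [solution_sqr] suffices, coordinate by coordinate.
    The factor 1/2 cancels the 2 from the derivative of a square. *)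
Lemma passive_diag (A : 'M[R]_N) (B : 'M[R]_(N, m)) (C : 'M[R]_(m, N)) (v : 'rV[R]_N) :
  pdmx (diag_mx v) -> dissipative (diag_mx v) A -> diag_mx v *m B = C^T ->
  passive A B C 0.
Proof.
move=> pd dA BC; exists (2^-1 *: diag_mx v).
  have /pdmx_dot[sP P0] := pd; apply/pdmx_dot; split=> [|x x0].
    by rewrite linearZ /= sP.
  by rewrite -scalemxAl dotZr mulr_gt0 ?invr_gt0// P0.
move=> x u y [[hx hu hy] sol yE] T T0.
pose f s := A *m x s + B *m u s.
have fi i : itg T (fun s => f s i 0).
  have := itgD (itg_mulmx A i T0 hx) (itg_mulmx B i T0 hu).
  by apply: eq_integrable => // s _ /=; rewrite /f [in RHS]mxE.
have sq i : itg T (fun s => x s i 0 * f s i 0) /\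
    x T i 0 ^+ 2 = x 0 i 0 ^+ 2 + 2 * \int[mu]_(s in `[0, T]) (x s i 0 * f s i 0).
  apply: (@solution_sqr (fun s => x s i 0) (fun s => f s i 0) T (ltW T0) (fi i)) 
    => s /andP[s0 _]; have /colP/(_ i) := sol s s0.
  by rewrite mxE [X in _ + X]mxE.
have qE (z : 'cV[R]_N) : (z^T *m (2^-1 *: diag_mx v) *m z) 0 0 = \sum_i 2^-1 * v 0 i * z i 0 ^+ 2.
  rewrite qfE -scalemxAl dotZr dotE mulr_sumr; apply: eq_bigr => i _.
  by rewrite mul_diag_mx mxE; ring.
have -> : \int[mu]_(s in `[0, T]) ((y s)^T *m u s) 0 0 =
    \int[mu]_(s in `[0, T]) \sum_i (C *m x s) i 0 * u s i 0.
  transitivity (\int[mu]_(s in `[0, T]) \sum_i y s i 0 * u s i 0).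
    by apply: eq_Rintegral => s _; exact: dotE.
  (* The output equation holds almost everywhere only, which is enough under the integral. *)
  congr fine; apply: ae_eq_integral => //.
  - apply/measurable_EFinP; apply: measurable_sum => i.
    by apply: measurable_funM; exact: L2_measurable.
  - apply/measurable_EFinP; apply: measurable_sum => i; apply: measurable_funM.
      by have /integrableP[/measurable_EFinP] := itg_mulmx C i T0 hx.
    exact: L2_measurable.
  - apply: negligibleS yE => s /= ns ys; apply: ns; rewrite in_itv /= => /andP[s0 _].
    by rewrite ys// mul0mx addr0.
have iC : itg T (fun s => \sum_i (C *m x s) i 0 * u s i 0).
  apply: itg_sum => i.
  have := @itg_sum T _ (index_enum 'I_N) (fun j s => C i j * (x s j 0 * u s i 0))
    (fun j => itgZ _ (L2_mul j i T0 hx hu)).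
  apply: eq_integrable => // s _ /=; congr EFin; rewrite mxE mulr_suml.
  by apply: eq_bigr => j _; rewrite mulrA.
have iS : itg T (fun s => \sum_i v 0 i * (x s i 0 * f s i 0)).
  by apply: itg_sum => i; apply: itgZ; exact: (sq i).1.
have -> : ((x T)^T *m (2^-1 *: diag_mx v) *m x T) 0 0 =
    ((x 0)^T *m (2^-1 *: diag_mx v) *m x 0) 0 0 +
    \int[mu]_(s in `[0, T]) \sum_i v 0 i * (x s i 0 * f s i 0).
  rewrite !qE Rint_sum => [|i]; last by apply: itgZ; exact: (sq i).1.
  rewrite -big_split; apply: eq_bigr => i _ /=; rewrite (sq i).2 RintegralZl//; last exact: (sq i).1.
  by move: (Rintegral _ _ _) => r; field.
rewrite lerD2l; apply: le_Rintegral => // s _.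
have -> : \sum_i v 0 i * (x s i 0 * f s i 0) = dot (x s) (diag_mx v *m f s).
  by rewrite dotE; apply: eq_bigr => i _; rewrite mul_diag_mx [in RHS]mxE; ring.
rewrite -dotE mulmxDr dotDr [diag_mx v *m (B *m _)]mulmxA BC [dot _ (C^T *m _)]dot_mulr trmxK.
by have := dA (x s); lra.
Qed.

End Passivity.

(** * Minimality of the reduced system *)

Section KypMinimal.
Variable R : realType.

Lemma kyp_minP N m (A P : 'M[R]_N) (B : 'M[R]_(N, m)) (C : 'M[R]_(m, N)) :
  is_kyp_min A B C 0 P <->
  [/\ psdmx P, dissipative P A, P *m B = C^T &
    forall P', psdmx P' -> dissipative P' A -> P' *m B = C^T ->
      forall x, dot x (P *m x) <= dot x (P' *m x)].
Proof.
split=> [[pP kP minP]|[pP dP BC minP]].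
  have [sP _] := pP; have [d b] := (nsd_kypP _ _ _ sP).1 kP; split=> // P' pP' d' b'.
  have [sP' _] := pP'; apply/(mxle_dot sP sP').
  by apply: minP => //; apply/(nsd_kypP _ _ _ sP').
have [sP _] := pP; split=> //; first exact/(nsd_kypP _ _ _ sP).
move=> P' pP' kP'; have [sP' _] := pP'; have [d' b'] := (nsd_kypP _ _ _ sP').1 kP'.
by apply/(mxle_dot sP sP'); exact: minP.
Qed.

Lemma psdmx_congr N (P S : 'M[R]_N) : S^T = S -> psdmx P -> psdmx (S *m P *m S).
Proof.
move=> sS /psdmx_dot[sP P0]; apply/psdmx_dot; split.
  by rewrite !trmx_mul sS sP mulmxA.
by move=> x; rewrite -!mulmxA dot_mulr sS.
Qed.

(** Conjugation by [S] carries solutions of the dual inequality to solutions of the primal one and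
    fixes [P], which commutes with [S]. *)
Lemma kyp_min_dual N m (A P S : 'M[R]_N) (B : 'M[R]_(N, m)) (C : 'M[R]_(m, N)) :
  S^T = S -> S *m S = 1%:M -> S *m P = P *m S -> S *m A *m S = A^T ->
  S *m B = B -> B = C^T -> is_kyp_min A B C 0 P -> is_kyp_min A^T C^T B^T 0 P.
Proof.
move=> sS SS SP SAS SB BC /kyp_minP[pP dP PB minP].
have SSr p (X : 'M[R]_(N, p)) : S *m (S *m X) = X by rewrite mulmxA SS mul1mx.
apply/kyp_minP; split=> //.
- move=> x; have := dP (S *m x); rewrite dot_mull sS -SAS.
  by rewrite !mulmxA SP -!mulmxA.
- by rewrite trmxK -BC PB.
move=> P' pP' dP'; rewrite trmxK -BC => PB' x.
have := minP (S *m P' *m S) (psdmx_congr sS pP') _ _ (S *m x).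
rewrite -!mulmxA SSr !dot_mull sS !SSr [S *m (P *m _)]mulmxA SP -[P *m S *m _]mulmxA SSr.
apply.
- move=> y; have := dP' (S *m y); rewrite -SAS -!mulmxA SSr.
  by rewrite [dot (S *m y) _]dot_mull sS.
- by rewrite SB PB' SB.
Qed.

(* The available storage of the large system is computed by trajectories that
   stay in the invariant subspace [range Q], on which [W] intertwines both
   systems. *)
Lemma kyp_min_intertwine N r m (A P Q : 'M[R]_N) (B : 'M[R]_(N, m)) (C : 'M[R]_(m, N))
    (A' : 'M[R]_r) (B' : 'M[R]_(r, m)) (C' : 'M[R]_(m, r))
    (W : 'M[R]_(r, N)) (V : 'M[R]_(N, r)) :
  1%:M - A \in unitmx -> 1%:M - A' \in unitmx -> is_kyp_min A B C 0 P ->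
  (exists D, A *m Q = Q *m D) -> (exists D, B = Q *m D) -> (exists D, V = Q *m D) ->
  (forall z : 'cV[R]_N, W *m (A *m (Q *m z)) = A' *m (W *m (Q *m z))) -> W *m B = B' ->
  (forall z : 'cV[R]_N, C *m (Q *m z) = C' *m (W *m (Q *m z))) -> W *m V = 1%:M ->
  forall P', psdmx P' -> dissipative P' A' -> P' *m B' = C'^T ->
    forall x, dot x (V^T *m P *m V *m x) <= dot x (P' *m x).
Proof.
move=> uA uA' minP [D AQ] [Db BQ] [Dv VQ] WA WB WC WV P' pP' dP' PB' x.
have /psdmx_dot[sP' P'0] := pP'.
(* [1 - A] is injective and maps the range of [Q] into itself, hence onto it by rank. So its
   inverse, and with it the midpoint step, preserves this range. *)
have [D' QE] : exists D', Q = (1%:M - A) *m Q *m D'.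
  have sub : (((1%:M - A) *m Q)^T <= Q^T)%MS.
    by rewrite mulmxBl mul1mx AQ -{1}[Q]mulmx1 -mulmxBr trmx_mul submxMl.
  have /submxP[X hX] : (Q^T <= ((1%:M - A) *m Q)^T)%MS.
    have := mxrank_leqif_sup sub; rewrite /leqif => -[_ <-].
    by rewrite !mxrank_tr -[X in _ == X]mxrank_tr -[X in X == _]mxrank_tr trmx_mul
       mxrankMfree// row_free_unit unitmx_tr.
  by exists X^T; apply: trmx_inj; rewrite hX [RHS]trmx_mul trmxK.
pose S z := exists w : 'cV[R]_N, z = Q *m w.
pose g z := dot (W *m z) (P' *m (W *m z)).
have VS : S (V *m x) by exists (Dv *m x); rewrite mulmxA -VQ.
have := @kyp_min_le _ _ _ _ _ _ _ uA minP S g _ _ _ VS.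
rewrite /g [W *m (V *m x)]mulmxA WV mul1mx.
have -> : dot (V *m x) (P *m (V *m x)) = dot x (V^T *m P *m V *m x).
  by rewrite dot_mull !mulmxA.
apply.
  by move=> z _; exact: P'0.
move=> z v [w zE].
have [xi xiE] : exists xi, cayley_mid A B z v = Q *m xi.
  exists (D' *m (2 *: w + Db *m v)); apply: cayley_mid_eq uA _.
  by rewrite [Q *m _]mulmxA !mulmxA -QE mulmxDr -scalemxAr -zE mulmxA -BQ.
have nextE : cayley_next A B z v = Q *m (xi - w).
  by rewrite /cayley_next xiE zE mulmxBr.
split; first by exists (xi - w).
have aE : cayley_mid A' B' (W *m z) v = W *m (Q *m xi).
  have eq : (1%:M - A) *m (Q *m xi) = 2 *: z + B *m v.
    by rewrite -xiE /cayley_mid mulKVmx.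
  apply: cayley_mid_eq; first exact: uA'.
  have := congr1 (mulmx W) eq; rewrite mulmxBl mul1mx mulmxBr WA mulmxDr -scalemxAr.
  by rewrite [W *m (B *m v)]mulmxA WB mulmxBl mul1mx.
have nE : cayley_next A' B' (W *m z) v = W *m cayley_next A B z v.
  by rewrite /cayley_next aE xiE mulmxBr.
have := cayley_incr B' (W *m z) v uA' sP'; rewrite nE aE => inc.
rewrite xiE WC; move: inc; rewrite mulmxDr dotDr [P' *m (B' *m v)]mulmxA PB'.
rewrite [dot _ (C'^T *m v)]dot_mulr trmxK [dot (C' *m _) v]dotC.
have := dP' (W *m (Q *m xi)).
by move: (dot _ _) (dot _ _) (dot _ _) (dot _ _) => p q t u; lra.
Qed.

(* If [K] spans an unobservable subspace, compressing [P] to its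
   [P]-orthogonal complement yields a smaller solution that vanishes on [K]. *)
Lemma kyp_min_observable N m k (A P : 'M[R]_N) (B : 'M[R]_(N, m)) (C : 'M[R]_(m, N))
    (K : 'M[R]_(N, k)) (D : 'M[R]_k) :
  is_kyp_min A B C 0 P -> pdmx P -> A *m K = K *m D -> C *m K = 0 -> row_free K^T -> K = 0.
Proof.
move=> /kyp_minP[_ dP PB minP] /pdmx_dot[sP P0] AK CK fK.
pose M := K^T *m P *m K.
have inj (c : 'cV[R]_k) : K *m c = 0 -> c = 0.
  move=> h; apply: trmx_inj; apply/eqP; rewrite trmx0 -(mulmx_free_eq0 _ fK) -trmx_mul h.
  by rewrite trmx0.
have uM : M \in unitmx.
  apply: inj_unitmx => c Mc; apply: inj; apply/eqP; apply: contraT => /P0.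
  have -> : dot (K *m c) (P *m (K *m c)) = dot c (M *m c).
    by rewrite dot_mull /M !mulmxA.
  by rewrite Mc dot0r ltxx.
pose Pi : 'M[R]_N := 1%:M - K *m invmx M *m K^T *m P.
have PiK : Pi *m K = 0.
  rewrite mulmxBl mul1mx -!mulmxA [K^T *m (P *m K)]mulmxA -/M mulVmx// mulmx1.
  exact: subrr.
have CPi : C *m Pi = C.
  by rewrite mulmxBr mulmx1 !mulmxA CK !mul0mx subr0.
have sM : M^T = M by rewrite /M !trmx_mul trmxK sP mulmxA.
have PPi : P *m Pi = Pi^T *m P.
  rewrite /Pi mulmxBr mulmx1 linearB /= trmx1 mulmxBl mul1mx !trmx_mul trmxK sP.
  by rewrite trmx_inv sM !mulmxA.
have PiPi : Pi *m Pi = Pi.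
  by rewrite {2}/Pi mulmxBr mulmx1 !mulmxA PiK !mul0mx subr0.
have PPPi : Pi^T *m P *m Pi = P *m Pi by rewrite -PPi -mulmxA PiPi.
have PAPi : Pi *m A *m Pi = Pi *m A.
  rewrite {2}/Pi mulmxBr mulmx1 !mulmxA -[Pi *m A *m K]mulmxA AK mulmxA PiK.
  by rewrite !mul0mx subr0.
have psdPi : psdmx (P *m Pi).
  apply/psdmx_dot; split; first by rewrite trmx_mul sP -PPi.
  move=> x; rewrite -PPPi -!mulmxA dot_mulr trmxK.
  have [->|/P0/ltW//] := eqVneq (Pi *m x) 0; by rewrite dot0l.
have := minP (P *m Pi) psdPi.
have d' : dissipative (P *m Pi) A.
  have e : P *m Pi *m A = Pi^T *m P *m A *m Pi.
    by rewrite -PPi -!mulmxA [Pi *m (A *m Pi)]mulmxA PAPi.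
  by move=> x; have := dP (Pi *m x); rewrite dot_mull !mulmxA e.
have b' : P *m Pi *m B = C^T.
  by rewrite PPi -mulmxA PB -trmx_mul CPi.
move=> /(_ d' b') h; have K0 (c : 'cV[R]_k) : K *m c = 0.
  apply/eqP; apply: contraT => /P0; have := h (K *m c).
  rewrite -[P *m Pi *m _]mulmxA [Pi *m (K *m c)]mulmxA PiK mul0mx mulmx0 dot0r.
  by move=> h1 h2; have := lt_le_trans h2 h1; rewrite ltxx.
by apply/matrixP => i j; have /colP/(_ i) := K0 (delta_mx j 0); rewrite -colE !mxE.
Qed.

End KypMinimal.

(** * Unobservable Krylov subspaces *)

Section Kalman.
Variable R : realType.

Lemma krylov_dependent N (A : 'M[R]_N) (z : 'cV[R]_N) : exists c : nat -> R,
  iter N (mulmx A) z = \sum_(i < N) c i *: iter i (mulmx A) z.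
Proof.
case: N A z => [|n] A z; first by exists (fun=> 0); apply/colP => -[].
have pow i : A ^+ i *m z = iter i (mulmx A) z.
  elim: i => [|i IH]; first by rewrite expr0 mul1mx.
  by rewrite exprS -mulmxE -mulmxA IH.
have := Cayley_Hamilton A; rewrite /horner_mx /horner_morph (@horner_coef_wide _ n.+2).
  move=> /(congr1 (mulmx^~ z)); rewrite mul0mx mulmx_suml big_ord_recr /=.
  have lc : (char_poly A)`_n.+1 = 1.
    by have /monicP := char_poly_monic A; rewrite /lead_coef size_char_poly.
  rewrite coef_map lc /= mul1r pow => /eqP; rewrite addrC addr_eq0 => /eqP h.
  exists (fun i => - (char_poly A)`_i); rewrite [LHS]h -sumrN; apply: eq_bigr => i _.
  by rewrite coef_map /= -mulmxE -mulmxA pow mul_scalar_mx scaleNr.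
by rewrite (leq_trans (size_poly _ _))// size_char_poly.
Qed.

(** By Cayley-Hamilton the vectors [A^k z] with [k < N] span an invariant subspace inside the kernel
    of [C]. Passing to [row_base] supplies the linearly independent columns that
    [kyp_min_observable] requires. *)
Lemma kyp_min_kalman N m (A P : 'M[R]_N) (B : 'M[R]_(N, m)) (C : 'M[R]_(m, N)) (z : 'cV[R]_N) :
  is_kyp_min A B C 0 P -> pdmx P ->
  (forall k, (k < N)%N -> C *m iter k (mulmx A) z = 0) -> z = 0.
Proof.
move=> minP pP Cz; case: N A P B C z minP pP Cz => [|n] A P B C z minP pP Cz.
  by apply/colP => -[].
pose X : 'M[R]_n.+1 := \matrix_(i < n.+1) (iter i (mulmx A) z)^T.
have rowX i : row i X = (iter i (mulmx A) z)^T by rewrite rowK.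
have invX : (X *m A^T <= X)%MS.
  apply/row_subP => i; rewrite row_mul rowX -trmx_mul -[A *m _]/(iter i.+1 (mulmx A) z).
  have [lt|ge] := ltnP i.+1 n.+1; first by rewrite -(rowX (Ordinal lt)) row_sub.
  have -> : i.+1 = n.+1 by apply/eqP; rewrite eqn_leq ge ltn_ord.
  have [c ->] := krylov_dependent A z; rewrite linear_sum /=; apply: summx_sub => j _.
  by rewrite linearZ /= -rowX scalemx_sub ?row_sub.
have XC : X *m C^T = 0.
  by apply/row_matrixP => i; rewrite row_mul rowX -trmx_mul Cz ?ltn_ord ?trmx0 ?row0.
pose K := (row_base X)^T.
have K0 : K = 0.
  have /submxP[D hD] : (row_base X *m A^T <= row_base X)%MS.
    have e := eq_row_base X; have le : (row_base X <= X)%MS by rewrite e.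
    by rewrite e; exact: submx_trans (submxMr _ le) invX.
  apply: (kyp_min_observable (D := D^T) minP pP).
  - by apply: trmx_inj; rewrite !trmx_mul !trmxK.
  - have /submxP[Y hY] : (row_base X <= X)%MS by rewrite eq_row_base.
    by apply: trmx_inj; rewrite trmx_mul trmxK hY -mulmxA XC mulmx0 trmx0.
  - by rewrite trmxK row_base_free.
have X0 : X = 0.
  apply/eqP; rewrite -submx0; have := eq_row_base X => h.
  by rewrite -h -[row_base X]trmxK -/K K0 trmx0 sub0mx.
by apply: trmx_inj; rewrite -[z]/(iter (@ord0 n) (mulmx A) z) -rowX X0 row0 trmx0.
Qed.

End Kalman.

(** * Observability of trajectories with data equal almost everywhere *)

Section Observability.
Variable R : realType.
Notation mu := (@lebesgue_measure R).
Notation itg T f := (mu.-integrable `[0, T]%classic (EFin \o f)).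
Variable T : R.
Hypothesis T0 : 0 < T.

(* [X f = 0] makes [X ^+ 2] constant. *)
Lemma ae_zero_solution (X f : R -> R) : itg T f ->
  (forall s, 0 <= s <= T -> X s = X 0 + \int[mu]_(r in `[0, s]) f r) ->
  {ae mu, forall t, 0 <= t <= T -> X t = 0} ->
  forall s, 0 <= s <= T -> X s = 0.
Proof.
move=> hf hX X0.
have cst s : 0 <= s <= T -> X s ^+ 2 = X 0 ^+ 2.
  move=> /andP[s0 sT].
  have hfs : itg s f.
    by apply: integrableS hf => // r /=; rewrite !in_itv /= => /andP[-> /le_trans ->].
  have [|iXf ->] := @solution_sqr _ X f s s0 hfs.
    by move=> r /andP[r0 rs]; apply: hX; rewrite r0 (le_trans rs sT).
  rewrite (_ : Rintegral _ _ _ = 0) ?mulr0 ?addr0//.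
  rewrite /Rintegral (@ae_eq_integral _ _ _ mu _ (cst 0%E)) ?integral0//.
    by have /integrableP[] := iXf.
  apply: negligibleS X0 => t /= h1 h2; apply: h1; rewrite in_itv /= => /andP[t0 ts].
  by rewrite h2 ?mul0r// t0 (le_trans ts sT).
(* The interval is not negligible, so the function vanishes at some point of it. *)
have [t [tT Xt]] : exists t, 0 <= t <= T /\ X t = 0.
  apply: contrapT => h; have : mu.-negligible `[0, T]%classic.
    apply: negligibleS X0 => t /=; rewrite in_itv /= => tT h1.
    by apply: h; exists t; split=> //; exact: h1.
  move=> /negligibleP; rewrite /= => /(_ (measurable_itv _)).
  rewrite lebesgue_measure_itv /= lte_fin T0 => /eqP; rewrite -EFinB subr0 eqe.
  by rewrite gt_eqF.
move=> s /cst; rewrite -(cst _ tT) Xt expr0n /= => /eqP.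
by rewrite sqrf_eq0 => /eqP.
Qed.

(** As [X] vanishes identically, so does the primitive of [f]; hence both [g] and [f + g] serve as
    derivative of [f]. Comparing the two instances of [solution_sqr] leaves 0 for the integral of
    [f ^+ 2]. *)
Lemma ae_zero_derivative (X f g : R -> R) : itg T f -> itg T g ->
  (forall s, 0 <= s <= T -> X s = X 0 + \int[mu]_(r in `[0, s]) f r) ->
  (forall s, 0 <= s <= T -> f s = f 0 + \int[mu]_(r in `[0, s]) g r) ->
  (forall s, 0 <= s <= T -> X s = 0) ->
  {ae mu, forall t, 0 <= t <= T -> f t = 0}.
Proof.
move=> hf hg hX hfg X0.
have Xs0 : X 0 = 0 by apply: X0; rewrite lexx ltW.
have [i1 e1] := solution_sqr (ltW T0) hg hfg.
have [i2 e2] : itg T (fun s => f s * (f s + g s)) /\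
    f T ^+ 2 = f 0 ^+ 2 + 2 * \int[mu]_(s in `[0, T]) (f s * (f s + g s)).
  apply: solution_sqr; [exact: ltW|exact: itgD|] => s sT; rewrite hfg//; congr (_ + _).
  have sub k : itg T k -> itg s k.
    move=> hk; have /andP[s0 sT'] := sT; apply: integrableS hk => // r /=.
    by rewrite !in_itv /= => /andP[-> /le_trans ->].
  rewrite RintegralD//; [|exact: sub|exact: sub].
  by have := hX s sT; rewrite X0// Xs0 add0r => <-; rewrite add0r.
have i3 : itg T (fun s => f s ^+ 2).
  have : itg T (fun s => f s * (f s + g s) + - 1 * (f s * g s)) by exact: itgD i2 (itgZ _ i1).
  apply: eq_integrable => // s _ /=; congr EFin; ring.
have z : \int[mu]_(s in `[0, T]) (f s ^+ 2) = 0.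
  have : \int[mu]_(s in `[0, T]) (f s * (f s + g s)) =
      \int[mu]_(s in `[0, T]) (f s ^+ 2) + \int[mu]_(s in `[0, T]) (f s * g s).
    rewrite -RintegralD//; apply: eq_Rintegral => s _; ring.
  by move=> h; move: e2; rewrite e1 h; lra.
have : (\int[mu]_(s in `[0%R, T]) `|((f s ^+ 2)%R)%:E| = 0)%E.
  under eq_integral do rewrite /= ger0_norm ?sqr_ge0//.
  by rewrite -[LHS]fineK ?integrable_fin_num// -/(Rintegral _ _ _) z.
have /integrableP[m3 _] := i3.
move=> /(ae_eq_integral_abs mu (measurable_itv _) m3).
apply: negligibleS => t /= h1 h2; apply: h1 => tT; apply/eqP.
by rewrite -sqrf_eq0; apply/eqP/EFin_inj/h2; rewrite in_itv.
Qed.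

(** The difference [z] of the states solves the unforced equation. From equal outputs on, [C A^k z]
    vanishes by induction on [k], each function being the derivative of the previous one. *)
Theorem kalman_observable N m p (A : 'M[R]_N) (B : 'M[R]_(N, m)) (C : 'M[R]_(p, N)) :
  (forall z : 'cV[R]_N, (forall k, C *m iter k (mulmx A) z = 0) -> z = 0) ->
  forall x u y x' u' y', is_solution A B C 0 x u y -> is_solution A B C 0 x' u' y' ->
    {ae mu, forall t, 0 <= t <= T -> u t = u' t /\ y t = y' t} -> x 0 = x' 0.
Proof.
move=> obs x u y x' u' y' [[hx hu hy] sol yE] [[hx' hu' hy'] sol' yE'] same.
apply/eqP; rewrite -subr_eq0; apply/eqP/obs.
pose z t := x t - x' t.
have iz l (M : 'M[R]_(l, N)) i : itg T (fun t => (M *m z t) i 0).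
  have := itgD (itg_mulmx M i T0 hx) (itgZ (-1) (itg_mulmx M i T0 hx')).
  apply: eq_integrable => // s _ /=; rewrite /z mulmxBr mulN1r; congr EFin.
  by rewrite [RHS]mxE; congr (_ + _); rewrite [RHS]mxE.
have zE s : 0 <= s <= T -> z s = z 0 + \col_i \int[mu]_(r in `[0, s]) (A *m z r) i 0.
  move=> /andP[s0 sT]; apply/colP => i; rewrite /z sol// sol'//.
  rewrite !mxE; have sub k : itg T k -> itg s k.
    move=> hk; apply: integrableS hk => // r /=.
    by rewrite !in_itv /= => /andP[-> /le_trans ->].
  have if_ (v : R -> 'cV[R]_N) (w : R -> 'cV[R]_m) : locally_L2 v -> locally_L2 w ->
      itg T (fun t => (A *m v t + B *m w t) i 0).
    move=> hv hw; have := itgD (itg_mulmx A i T0 hv) (itg_mulmx B i T0 hw).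
    by apply: eq_integrable => // t _ /=; rewrite [in RHS]mxE.
  have -> : \int[mu]_(r in `[0, s]) (A *m (x r - x' r)) i 0 =
      \int[mu]_(r in `[0, s]) (A *m x r + B *m u r) i 0 -
      \int[mu]_(r in `[0, s]) (A *m x' r + B *m u' r) i 0.
    rewrite -RintegralB//; [|exact/sub/if_|exact/sub/if_].
    congr fine; apply: ae_eq_integral => //.
    - by have /integrableP[] := sub _ (iz _ A i).
    - have /integrableP[] : itg s (fun r => (A *m x r + B *m u r) i 0 +
          -1 * (A *m x' r + B *m u' r) i 0) by apply: itgD; [|apply: itgZ]; exact/sub/if_.
      by move=> h _; apply: eq_measurable_fun h => r _; rewrite /= mulN1r.
    - apply: negligibleS same => t /= h1 h2; apply: h1; rewrite in_itv /= => /andP[t0 ts].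
      have [|-> _] := h2; first by rewrite t0 (le_trans ts sT).
      by congr EFin; rewrite mulmxBr !mxE opprD addrACA subrr addr0.
  by rewrite opprD addrACA.
pose Ck k := iter k (fun M : 'M[R]_(p, N) => M *m A) C.
have CkE k (v : 'cV[R]_N) : Ck k *m v = C *m iter k (mulmx A) v.
  elim: k v => [//|k IH] v; rewrite [Ck _]/(Ck k *m A) -mulmxA IH.
  by rewrite -iterSr.
have step k a s : 0 <= s <= T ->
    (Ck k *m z s) a 0 = (Ck k *m z 0) a 0 + \int[mu]_(r in `[0, s]) (Ck k.+1 *m z r) a 0.
  move=> sT; rewrite zE// mulmxDr mxE; congr (_ + _); rewrite mxE.
  have sub f : itg T f -> itg s f.
    move=> hf; have /andP[s0 sT'] := sT; apply: integrableS hf => // r /=.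
    by rewrite !in_itv /= => /andP[-> /le_trans ->].
  transitivity (\int[mu]_(r in `[0, s]) \sum_j Ck k a j * (A *m z r) j 0).
    rewrite Rint_sum => [|j]; last by apply: itgZ; exact/sub/iz.
    by apply: eq_bigr => j _; rewrite mxE RintegralZl//; exact/sub/iz.
  by apply: eq_Rintegral => r _; rewrite [Ck k.+1]/(Ck k *m A) -mulmxA mxE.
have zero k : forall a s, 0 <= s <= T -> (Ck k *m z s) a 0 = 0.
  elim: k => [|k IH] a.
    apply: (ae_zero_solution (iz _ _ _) (step 0%N a)).
    have h1 := negligibleU yE yE'; apply: negligibleS (negligibleU h1 same) => t /= h.
    apply: contrapT => /not_orP[/not_orP[/contrapT e1 /contrapT e2] /contrapT e3].
    apply: h => /andP[t0 tT]; rewrite /z mulmxBr.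
    have [|_ e] := e3; first by rewrite t0.
    by move: (e1 t0) (e2 t0); rewrite !mul0mx !addr0 => <- <-; rewrite e subrr mxE.
  apply: (ae_zero_solution (iz _ _ _) (step k.+1 a)).
  exact: (ae_zero_derivative (iz _ _ _) (iz _ _ _) (step k a) (step k.+1 a) (IH a)).
move=> k; rewrite -CkE; apply/colP => a; rewrite [RHS]mxE; apply: (zero k a 0).
by rewrite lexx ltW.
Qed.

End Observability.

(** * Hermite interpolation at two points *)

Section Hermite.
Variable R : realType.
Implicit Types (p q : {poly R}) (a b : R).

Lemma derivn_taylor a k j : ((k`!%:R^-1 *: ('X - a%:P) ^+ k : {poly R})^`(j)).[a] = (j == k)%:R.
Proof.
elim: k j => [|k IH] [|j].
- by rewrite expr0 fact0 invr1 scale1r derivn0 hornerC.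
- by rewrite expr0 derivSn derivZ -polyC1 derivC scaler0 linear0 horner0.
- by rewrite derivn0 hornerZ horner_exp hornerXsubC subrr expr0n mulr0.
have -> : (k.+1`!%:R^-1 *: ('X - a%:P) ^+ k.+1 : {poly R})^`(j.+1) =
    (k`!%:R^-1 *: ('X - a%:P) ^+ k : {poly R})^`(j).
  rewrite derivSn; congr (_^`(j)); rewrite derivZ deriv_exp derivXsubC mul1r /=.
  rewrite -scalerMnr scalerMnl factS natrM invfM -[_ *+ k.+1]mulr_natl.
  by rewrite mulVKf// pnatr_eq0.
by rewrite IH eqSS.
Qed.

Lemma derivn_root q b n j : ('X - b%:P) ^+ n.+1 %| q -> (j <= n)%N -> (q^`(j)).[b] = 0.
Proof.
elim: j n q => [|j IH] n q /dvdpP[r ->] jn.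
  by rewrite derivn0 hornerM exprS hornerM hornerXsubC subrr mul0r mulr0.
case: n jn => // n jn; rewrite derivSn; apply: (IH n) => //.
rewrite derivM deriv_exp derivXsubC mul1r dvdp_add//.
  by rewrite dvdp_mull// dvdp_exp2l.
by rewrite mulrnAr -mulrnAl dvdp_mulIr.
Qed.

(** The Taylor monomial at [a] is multiplied by a multiple of [('X - b%:P) ^+ n.+1] that is 1 modulo
    [('X - a%:P) ^+ n.+1], obtained from Bezout. This keeps its derivatives at [a] and annihilates
    those at [b]. *)
Lemma hermite a b k n : a != b -> (k <= n)%N -> exists p, forall j, (j <= n)%N ->
  (p^`(j)).[a] = (j == k)%:R /\ (p^`(j)).[b] = 0.
Proof.
move=> ab kn.
have : coprimep (('X - a%:P) ^+ n.+1) (('X - b%:P) ^+ n.+1).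
  by apply/coprimep_expl/coprimep_expr/coprimep_XsubC2; rewrite subr_eq0 eq_sym.
move=> /Bezout_coprimepP[[u v] /eqpf_eq[c c0 /= e]].
pose s : {poly R} := k`!%:R^-1 *: ('X - a%:P) ^+ k.
exists (c^-1 *: (s * (v * ('X - b%:P) ^+ n.+1))) => j jn; split; last first.
  by apply: (derivn_root _ jn); rewrite dvdpZr ?invr_eq0// mulrA dvdp_mulIr.
have -> : c^-1 *: (s * (v * ('X - b%:P) ^+ n.+1)) =
    s - c^-1 *: (s * u * ('X - a%:P) ^+ n.+1).
  have -> : v * ('X - b%:P) ^+ n.+1 = c *: 1 - u * ('X - a%:P) ^+ n.+1 by rewrite -e [RHS]addrC addKr.
  by rewrite mulrBr -scalerAr mulr1 scalerBr scalerA mulVf// scale1r mulrA.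
rewrite linearB /= hornerD hornerN derivn_taylor (derivn_root _ jn) ?subr0//.
by rewrite dvdpZr ?invr_eq0// dvdp_mulIr.
Qed.

End Hermite.

(** * Controllability by polynomial trajectories *)

Section Controllability.
Variable R : realType.
Notation mu := (@lebesgue_measure R).

Lemma poly_locally_L2 k (X : 'I_k -> {poly R}) : locally_L2 (fun t => \col_i (X i).[t]).
Proof.
move=> i; have E : (fun t => (\col_i (X i).[t]) i 0) = horner (X i).
  by apply/funext => t; rewrite mxE.
split=> [|t t0]; first by rewrite E; apply: measurable_funTS;
  apply: continuous_measurable_fun; exact: continuous_horner.
under eq_integral do rewrite mxE -horner_exp.
have : mu.-integrable `[0, t]%classic (EFin \o horner (X i ^+ 2)).
  apply: continuous_compact_integrable; first exact: segment_compact.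
  by apply: continuous_subspaceT; exact: continuous_horner.
move=> /integrableP[_]; apply: le_lt_trans; apply: ge0_le_integral => //.
- by move=> s _; rewrite lee_fin horner_exp sqr_ge0.
- apply/measurable_EFinP; apply: measurable_funTS.
  by apply: continuous_measurable_fun; exact: continuous_horner.
- apply/measurable_EFinP; apply: measurable_funTS; apply: measurableT_comp => //.
  by apply: continuous_measurable_fun; exact: continuous_horner.
- by move=> s _; rewrite lee_fin ler_norm.
Qed.

Lemma poly_FTC (p : {poly R}) (t : R) : 0 <= t ->
  p.[t] = p.[0] + \int[mu]_(s in `[0, t]) (p^`()).[s].
Proof.
rewrite le_eqVlt => /orP[/eqP <-|t0].
  by rewrite set_itv1 Rintegral_set1 addr0.
rewrite /Rintegral (@continuous_FTC2 _ _ (horner p))//.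
- by rewrite /= [RHS]addrC subrK.
- by apply: continuous_subspaceT; exact: continuous_horner.
- split.
  + by move=> x _; exact: derivable_horner.
  + by apply: cvg_at_right_filter; exact: continuous_horner.
  + by apply: cvg_at_left_filter; exact: continuous_horner.
- by move=> x _; rewrite derivE.
Qed.

Lemma poly_solution N m p (A : 'M[R]_N) (B : 'M[R]_(N, m)) (C : 'M[R]_(p, N))
    (X : 'I_N -> {poly R}) (U : 'I_m -> {poly R}) :
  (forall s, A *m (\col_j (X j).[s]) + B *m (\col_j (U j).[s]) = \col_j ((X j)^`()).[s]) ->
  is_solution A B C 0 (fun t => \col_j (X j).[t]) (fun t => \col_j (U j).[t])
    (fun t => C *m \col_j (X j).[t]).
Proof.
move=> h; split.
- split; [exact: poly_locally_L2|exact: poly_locally_L2|].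
  pose Y i : {poly R} := \sum_j C i j *: X j.
  have -> : (fun t => C *m \col_j (X j).[t]) = (fun t => \col_i (Y i).[t]).
    apply/funext => t; apply/colP => i; rewrite !mxE horner_sum; apply: eq_bigr => j _.
    by rewrite mxE hornerZ.
  exact: poly_locally_L2.
- move=> t t0; apply/colP => i; rewrite !mxE [LHS](poly_FTC _ t0); congr (_ + _).
  by apply: eq_Rintegral => s _; rewrite h mxE.
- by apply: aeW => t _; rewrite mul0mx addr0.
Qed.

Variables (N m : nat) (A : 'M[R]_N) (B : 'M[R]_(N, m)).
Hypothesis kalman : forall z : 'cV[R]_N,
  (forall k, (k < N)%N -> B^T *m iter k (mulmx A^T) z = 0) -> z = 0.

(** Least-norm steering with the discrete controllability Gramian [Gr], which the dual Kalman
    condition makes invertible. *)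
Lemma discrete_reach (a b : 'cV[R]_N) : exists (y : nat -> 'cV[R]_N) (w : nat -> 'cV[R]_m),
  [/\ y 0%N = a, y N = b & forall i, y i.+1 = A *m y i + B *m w i].
Proof.
pose Phi i : 'M[R]_N := iter i (mulmx A) 1%:M.
pose Gr := \sum_(j < N) Phi (N - j.+1)%N *m B *m B^T *m (Phi (N - j.+1)%N)^T.
have uG : Gr \in unitmx.
  apply: inj_unitmx => z Gz.
  have /psumr_eq0P h : \sum_(j < N) dot (B^T *m ((Phi (N - j.+1)%N)^T *m z))
      (B^T *m ((Phi (N - j.+1)%N)^T *m z)) = 0.
    transitivity (dot z (Gr *m z)); last by rewrite Gz dot0r.
    rewrite /dot /Gr mulmx_suml mulmx_sumr summxE; apply: eq_bigr => j _.
    by rewrite !trmx_mul !trmxK !mulmxA.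
  apply: kalman => k kN.
  have lt : (N - k.+1 < N)%N by lia.
  have := h (fun i _ => dot_ge0 _) (Ordinal lt) isT; rewrite /=.
  have -> : (N - (N - k.+1).+1 = k)%N by lia.
  move=> /dot_eq0 <-; congr (_ *m _).
  elim: k z {Gz h kN lt} => [|k IH] z; first by rewrite /Phi /= trmx1 mul1mx.
  by rewrite iterSr IH [Phi k.+1]iterS trmx_mul mulmxA.
pose xi := invmx Gr *m (b - iter N (mulmx A) a).
pose w j := B^T *m (Phi (N - j.+1)%N)^T *m xi.
pose y := fix y i := if i is i'.+1 then A *m y i' + B *m w i' else a.
have yE i : y i = iter i (mulmx A) a + \sum_(j < i) Phi (i - j.+1)%N *m (B *m w j).
  elim: i => [|i IH]; first by rewrite big_ord0 addr0.
  rewrite [y _]/(A *m y i + B *m w i) IH big_ord_recr /= subnn mul1mx mulmxDr addrA.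
  congr (_ + _ + _); rewrite mulmx_sumr; apply: eq_bigr => j _.
  by rewrite subSn ?mulmxA// ltn_ord.
exists y, w; split=> //; rewrite yE.
have -> : \sum_(j < N) Phi (N - j.+1)%N *m (B *m w j) = Gr *m xi.
  by rewrite mulmx_suml; apply: eq_bigr => j _; rewrite /w !mulmxA.
by rewrite mulKVmx// addrC subrK.
Qed.

(* Take a discrete-time path [y] from [0] through [xi] back to [0] in [2 N]
   steps; then [x = \sum_i p^(2N - i) y_i] is a continuous-time trajectory for
   every polynomial [p]. *)
Lemma poly_trajectory (a b : R) (xi : 'cV[R]_N) : a != b ->
  exists (X : 'I_N -> {poly R}) (U : 'I_m -> {poly R}),
  [/\ forall s, A *m (\col_j (X j).[s]) + B *m (\col_j (U j).[s]) = \col_j ((X j)^`()).[s],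
     \col_j (X j).[a] = xi & \col_j (X j).[b] = 0].
Proof.
move=> ab; have [y1 [w1 [y10 y1N y1S]]] := discrete_reach 0 xi.
have [y2 [w2 [y20 y2N y2S]]] := discrete_reach xi 0.
pose y i := if (i < N)%N then y1 i else y2 (i - N)%N.
pose w i := if (i < N)%N then w1 i else w2 (i - N)%N.
have yS i : y i.+1 = A *m y i + B *m w i.
  rewrite /y /w; have [iN|Ni] := ltnP i N; last first.
    by rewrite ltnNge leqW//= subSn.
  have [_|le] := ltnP i.+1 N; first exact: y1S.
  have e : i.+1 = N by apply/eqP; rewrite eqn_leq iN le.
  by rewrite e subnn y20 -y1S e y1N.
have yN : y N = xi by rewrite /y ltnn subnn.
have y0 : y 0%N = 0.
  rewrite /y; case: ifP => // /negbT; rewrite -leqNgt leqn0 => /eqP e.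
  by rewrite sub0n y20 -y1N -[RHS]y10; exact: congr1 e.
have yNN : y (N + N)%N = 0 by rewrite /y ltnNge leq_addr /= addnK.
(* Among the derivatives of [p] up to order [2 N] only the one of order [N] survives at [a], and
   none at [b]. The sum therefore takes the value [y N = xi] at [a] and 0 at [b]. *)
have [p hp] := hermite (k := N) (n := (N + N)%N) ab (leq_addr _ _).
pose c i : {poly R} := p^`(N + N - i).
pose X (j : 'I_N) : {poly R} := \sum_(i < (N + N).+1) y i j 0 *: c i.
pose U (j : 'I_m) : {poly R} := \sum_(i < N + N) w i j 0 *: c i.
have XE s : \col_j (X j).[s] = \sum_(i < (N + N).+1) (c i).[s] *: y i.
  apply/colP => j; rewrite mxE horner_sum summxE; apply: eq_bigr => i _.
  by rewrite hornerZ mxE mulrC.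
have UE s : \col_j (U j).[s] = \sum_(i < N + N) (c i).[s] *: w i.
  apply/colP => j; rewrite mxE horner_sum summxE; apply: eq_bigr => i _.
  by rewrite hornerZ mxE mulrC.
have dXE s : \col_j ((X j)^`()).[s] = \sum_(i < N + N) (c i).[s] *: y i.+1.
  apply/colP => j; rewrite mxE linear_sum horner_sum summxE big_ord_recl /=.
  rewrite y0 mxE scale0r deriv0 horner0 add0r; apply: eq_bigr => i _.
  rewrite derivZ hornerZ mxE mulrC; congr (_.[s] * _).
  by rewrite /c /bump add1n -derivnS -subSn ?ltn_ord ?subSS.
have val s (z : 'cV[R]_N) : (forall i, (i <= N + N)%N -> (c i).[s] *: y i = (i == N)%:R *: z) ->
    \col_j (X j).[s] = z.
  move=> h; rewrite XE; have lt : (N < (N + N).+1)%N by rewrite ltnS leq_addr.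
  rewrite (bigD1 (Ordinal lt))//= h ?leq_addr// eqxx scale1r big1 ?addr0// => i /negbTE iN.
  rewrite h; first by rewrite -[_ == N]/(i == Ordinal lt) iN scale0r.
  by rewrite -ltnS.
exists X, U; split=> [s||].
- rewrite XE UE dXE big_ord_recr /= yNN scaler0 addr0 !mulmx_sumr -big_split.
  by apply: eq_bigr => i _ /=; rewrite yS scalerDr -!scalemxAr.
- apply: val => i iNN; have [-> _] := hp (N + N - i)%N (leq_subr _ _).
  have -> : (N + N - i == N)%N = (i == N)%N by apply/eqP/eqP; lia.
  by case: eqP => [->|_]; rewrite ?scale0r ?yN.
- apply: val => i iNN; have [_ ->] := hp (N + N - i)%N (leq_subr _ _).
  by rewrite scale0r scaler0.
Qed.

(** Superposition of a trajectory from [x0] to 0 and one from 0 to [x1]. *)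
Theorem kalman_controllable p (C : 'M[R]_(p, N)) : controllable A B C 0.
Proof.
move=> x0 x1 T T0; have n0 : 0 != T by rewrite lt_eqF.
have [X [U [h e0 e1]]] := poly_trajectory x0 n0; rewrite eq_sym in n0.
have [X' [U' [h' e1' e0']]] := poly_trajectory x1 n0.
have colD k (Y Y' : 'I_k -> {poly R}) s :
    \col_j (Y j + Y' j).[s] = \col_j (Y j).[s] + \col_j (Y' j).[s].
  by apply/colP => j; rewrite !mxE hornerD.
have := @poly_solution _ _ _ A B C (fun j => X j + X' j) (fun j => U j + U' j).
move=> /(_ _)/wrap[s|sol].
  rewrite !colD !mulmxDr addrACA h h'; apply/colP => j.
  by rewrite !mxE derivD hornerD.
do 3 eexists; split; first exact: sol.
- by rewrite /= colD e0 e0' addr0.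
- by rewrite /= colD e1 e1' add0r.
Qed.

End Controllability.

(** * Selection of coordinates *)

Section Selection.
Variable R : realType.
Variables (N r : nat) (sel : 'I_r -> 'I_N).

Definition sel_mx : 'M[R]_(N, r) := \matrix_(i, j) (i == sel j)%:R.

Lemma mul_sel_mx p (M : 'M[R]_(p, N)) : M *m sel_mx = colsub sel M.
Proof.
apply/matrixP => i j; rewrite !mxE (bigD1 (sel j))//= mxE eqxx mulr1 big1 ?addr0//.
by move=> k /negbTE h; rewrite mxE h mulr0.
Qed.

Lemma diag_mul_sel (v : 'rV[R]_N) :
  diag_mx v *m sel_mx = sel_mx *m diag_mx (\row_j v 0 (sel j)).
Proof.
apply/matrixP => i j; rewrite mul_diag_mx mul_mx_diag !mxE mulrC.
by have [->|] := eqVneq i (sel j); rewrite ?mul0r.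
Qed.

Lemma tr_sel_mul_diag (v : 'rV[R]_N) :
  sel_mx^T *m diag_mx v = diag_mx (\row_j v 0 (sel j)) *m sel_mx^T.
Proof. by apply: trmx_inj; rewrite !trmx_mul !trmxK !diag_mx_tr diag_mul_sel. Qed.

Hypothesis sel_inj : injective sel.

Lemma tr_sel_mul : sel_mx^T *m sel_mx = 1%:M.
Proof.
apply/matrixP => i j; rewrite mul_sel_mx !mxE; congr (_%:R); congr nat_of_bool.
by rewrite eq_sym (inj_eq sel_inj).
Qed.

Lemma sel_mul_tr : sel_mx *m sel_mx^T = mask_mx R (fun i => i \in codom sel).
Proof.
apply/matrixP => i j; rewrite !mxE.
have [/codomP[k ->]|ni] := boolP (i \in codom sel).
  rewrite (bigD1 k)//= !mxE eqxx mul1r big1 ?addr0; first by rewrite eq_sym.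
  by move=> l lk; rewrite !mxE (inj_eq sel_inj) eq_sym (negbTE lk) mul0r.
rewrite mul0rn big1// => k _; rewrite !mxE; case: eqP => [e|_]; last by rewrite mul0r.
by case/negP: ni; rewrite e codom_f.
Qed.

End Selection.

Lemma pdmx_1 (R : realType) N : pdmx (1%:M : 'M[R]_N).
Proof.
apply/pdmx_dot; split=> [|x x0]; first exact: trmx1.
by rewrite mul1mx lt_neqAle dot_ge0 andbT eq_sym; apply: contraNneq x0 => /dot_eq0 ->.
Qed.

(** [L] and [L^T *m L] have the same kernel, hence the same row space. *)
Lemma gram_range (R : realType) p q (L : 'M[R]_(p, q)) : exists D, L^T = L^T *m L *m D.
Proof.
suff /submxP[D hD] : (L <= L^T *m L)%MS.
  by exists D^T; rewrite [in LHS]hD !trmx_mul trmxK.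
rewrite submxE; apply/eqP/matrixP => i j; set Z := cokermx _.
have h : L *m col j Z = 0.
  apply: dot_eq0; rewrite dot_mull [L^T *m _]mulmxA colE [_ *m (Z *m _)]mulmxA.
  by rewrite mulmx_coker mul0mx dot0r.
by move: h; rewrite colE mulmxA -colE => /colP/(_ i); rewrite !mxE.
Qed.

(** * The reduced system as a compression of the balanced one *)

Section Reduction.
Variable R : realType.
Variables (n m : nat) (A L U P : 'M[R]_(n + n)) (B : 'M[R]_(n + n, m)).
Variables (svm svp : seq R) (nm np : seq nat) (qm qp : nat).
Local Notation rm := (rank_trunc qm nm).
Local Notation rp := (rank_trunc qp np).
Hypothesis SAS : sgnmx R n n *m A *m sgnmx R n n = A^T.
Hypothesis SB : sgnmx R n n *m B = B.
Hypothesis dA1 : dissipative 1%:M A.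
Hypothesis dA : dissipative P A.
Hypothesis PB : P *m B = B.
Hypothesis PL : P = L^T *m L.
Hypothesis eigU : is_eigendecomposition L U svm svp nm np.
Hypothesis adm : admissible svm svp qm qp.

Definition sgn_row a b : 'rV[R]_(a + b) := row_mx (const_mx (-1)) (const_mx 1).
(** The values of the second half increase along the diagonal, hence [rev]: its entry [i] sits at
    index [n - i.+1] of the list. *)
Definition sv_row : 'rV[R]_(n + n) :=
  row_mx (\row_i (repeat_seq svm nm)`_i) (\row_i (rev (repeat_seq svp np))`_i).
Local Notation s := (sgn_row n n).
Local Notation d := sv_row.

Lemma sgnmxE a b : sgnmx R a b = diag_mx (sgn_row a b).
Proof.
rewrite /sgn_row diag_mx_row /sgnmx; congr block_mx.
- by apply/matrixP => i j; rewrite !mxE mulNrn.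
- by rewrite diag_const_mx.
Qed.

Lemma sgn_row_sign a b (i : 'I_(a + b)) : sgn_row a b 0 i = 1 \/ sgn_row a b 0 i = -1.
Proof. by rewrite !mxE; case: fintype.split_ordP => j _; rewrite mxE; [right|left]. Qed.

Lemma svmP : is_sv_list n svm nm. Proof. by have [] := eigU. Qed.
Lemma svpP : is_sv_list n svp np. Proof. by have [] := eigU. Qed.

Lemma rm_le : (rm <= n)%N. Proof. by have [_ _ _ _ <-] := svmP; exact: rank_trunc_le. Qed.
Lemma rp_le : (rp <= n)%N. Proof. by have [_ _ _ _ <-] := svpP; exact: rank_trunc_le. Qed.

Lemma size_svp : size (repeat_seq svp np) = n.
Proof. by have [_ _ h _ <-] := svpP; exact: size_repeat_seq. Qed.

Lemma sv_row_l (i : 'I_n) : d 0 (lshift n i) = (repeat_seq svm nm)`_i.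
Proof. by rewrite row_mxEl mxE. Qed.

Lemma sv_row_r (i : 'I_n) : d 0 (rshift n i) = (repeat_seq svp np)`_(n - i.+1).
Proof. by rewrite row_mxEr mxE nth_rev size_svp. Qed.

Lemma sv_row_ge0 i : 0 <= d 0 i.
Proof.
case: (fintype.split_ordP i) => j ->; rewrite ?sv_row_l ?sv_row_r.
  by have /andP[] := sv_list_bounds_nth svmP j.
by have /andP[] := sv_list_bounds_nth svpP (n - j.+1).
Qed.

Lemma plus_lt (j : 'I_rp) : (n - rp + j < n)%N.
Proof. by have h := rp_le; have h' := ltn_ord j; lia. Qed.

Definition sel (j : 'I_(rm + rp)) : 'I_(n + n) :=
  match fintype.split j with
  | inl a => lshift n (widen_ord rm_le a)
  | inr b => rshift n (Ordinal (plus_lt b))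
  end.
Local Notation T := (sel_mx R sel).

Lemma sel_l a : sel (lshift rp a) = lshift n (widen_ord rm_le a).
Proof. by rewrite /sel; case: fintype.split_ordP => j /eqP; rewrite ?eq_shift => // /eqP ->. Qed.

Lemma sel_r b : sel (rshift rm b) = rshift n (Ordinal (plus_lt b)).
Proof. by rewrite /sel; case: fintype.split_ordP => j /eqP; rewrite ?eq_shift => // /eqP ->. Qed.

Lemma sel_inj : injective sel.
Proof.
move=> i j; case: (fintype.split_ordP i) => a ->; case: (fintype.split_ordP j) => b ->;
  rewrite ?sel_l ?sel_r => /eqP; rewrite eq_shift => // /eqP/(congr1 val) /= e.
- by congr lshift; apply: val_inj.
- by congr rshift; apply: val_inj; apply/eqP; rewrite -(eqn_add2l (n - rp)) e.
Qed.

(** The coordinates of the first [a] values on the minus side and the first [b] on the plus side.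
    The indices vary separately, so that a step removes one value of one side; zero values are
    excluded, so that [Sigma] is invertible on the kept coordinates. *)
Definition keep a b : pred 'I_(n + n) := fun i =>
  (d 0 i != 0) && match fintype.split i with
  | inl j => (j < rank_trunc a nm)%N
  | inr j => (n - j.+1 < rank_trunc b np)%N
  end.

Lemma keep_l a b (j : 'I_n) : keep a b (lshift n j) =
  (d 0 (lshift n j) != 0) && (j < rank_trunc a nm)%N.
Proof.
rewrite /keep; congr (_ && _).
by case: fintype.split_ordP => k /eqP; rewrite ?eq_shift => // /eqP ->.
Qed.

Lemma keep_r a b (j : 'I_n) : keep a b (rshift n j) =
  (d 0 (rshift n j) != 0) && (n - j.+1 < rank_trunc b np)%N.
Proof.
rewrite /keep; congr (_ && _).
by case: fintype.split_ordP => k /eqP; rewrite ?eq_shift => // /eqP ->.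
Qed.

Lemma sel_gt0 j : 0 < d 0 (sel j).
Proof.
have [[/andP[qm0 _] /andP[qp0 _]] [pm pp] _ _] := adm.
case: (fintype.split_ordP j) => k ->; rewrite ?sel_l ?sel_r ?sv_row_l ?sv_row_r /=.
  exact: (sv_list_head svmP qm0 (ltn_ord k) pm).
apply: (sv_list_head svpP qp0 _ pp); have h := rp_le; have h' := ltn_ord k; lia.
Qed.

Lemma keep_sel : mask_mx R (keep qm qp) = mask_mx R (fun i => i \in codom sel).
Proof.
apply: eq_mask_mx => i; apply/idP/codomP => [|[j ->]].
  case: (fintype.split_ordP i) => k ->; rewrite ?keep_l ?keep_r => /andP[_ h].
    by exists (lshift rp (Ordinal h)); rewrite sel_l; congr lshift; apply: val_inj.
  have h1 : (k - (n - rp) < rp)%N by move: h (ltn_ord k) rp_le => /=; lia.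
  exists (rshift rm (Ordinal h1)); rewrite sel_r; congr rshift; apply: val_inj => /=.
  by move: h (ltn_ord k) rp_le => /=; lia.
have := sel_gt0 j; case: (fintype.split_ordP j) => k ->; rewrite ?sel_l ?sel_r.
  by rewrite keep_l => /gt_eqF ->; rewrite /= ltn_ord.
by rewrite keep_r => /gt_eqF ->; rewrite /=; move: (ltn_ord k) rp_le; lia.
Qed.

Lemma keep_full : mask_mx R (keep (size svm) (size svp)) = bal_supp d.
Proof.
rewrite /bal_supp /mask_mx; congr diag_mx; apply/rowP => i; rewrite [LHS]mxE [RHS]mxE; congr (_%:R).
have [_ _ hm _ sm] := svmP; have [_ _ hp _ sp] := svpP.
case: (fintype.split_ordP i) => k ->; rewrite ?keep_l ?keep_r.
  by rewrite -hm rank_trunc_size sm ltn_ord andbT.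
rewrite -hp rank_trunc_size sp; have -> : (n - k.+1 < n)%N by move: (ltn_ord k); lia.
by rewrite andbT.
Qed.

Lemma keep_exact : svm`_qm = 0 -> svp`_qp = 0 -> mask_mx R (keep qm qp) = bal_supp d.
Proof.
move=> m0 p0; rewrite /bal_supp /mask_mx; congr diag_mx; apply/rowP => i; rewrite [LHS]mxE [RHS]mxE.
congr (_%:R); case: (fintype.split_ordP i) => k ->; rewrite ?keep_l ?keep_r.
  have [//|h] := ltnP k rm; first by rewrite andbT.
  by rewrite sv_row_l (sv_list_tail svmP h m0) eqxx.
have [//|h] := ltnP (n - k.+1) rp; first by rewrite andbT.
by rewrite sv_row_r (sv_list_tail svpP h p0) eqxx.
Qed.

Lemma keep_diff_l a b i : keep a.+1 b i -> ~~ keep a b i -> d 0 i = svm`_a.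
Proof.
have [_ _ hm _ _] := svmP.
case: (fintype.split_ordP i) => k ->; rewrite ?keep_l ?keep_r => /andP[-> h] /=; last by rewrite h.
rewrite -leqNgt => h'; rewrite sv_row_l; apply: nth_repeat_seq => //.
by rewrite h' h.
Qed.

Lemma keep_diff_r a b i : keep a b.+1 i -> ~~ keep a b i -> d 0 i = svp`_b.
Proof.
have [_ _ hm _ _] := svpP.
case: (fintype.split_ordP i) => k ->; rewrite ?keep_l ?keep_r => /andP[-> h] /=; first by rewrite h.
rewrite -leqNgt => h'; rewrite sv_row_r; apply: nth_repeat_seq => //.
by rewrite h' h.
Qed.

Lemma keep_mono a b a' b' i : (a <= a')%N -> (b <= b')%N -> keep a b i -> keep a' b' i.
Proof.
move=> aa bb; case: (fintype.split_ordP i) => k ->; rewrite ?keep_l ?keep_r => /andP[-> h] /=;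
  exact: leq_trans h (rank_trunc_mono _ _).
Qed.

Lemma Sigma1E : Sigma1 svm svp nm np qm qp = diag_mx (\row_j d 0 (sel j)).
Proof.
have [_ _ hm _ sm] := svmP; have [_ _ hp _ sp] := svpP.
rewrite /Sigma1 /Sigma_minus /Sigma_plus /diag_seq -diag_mx_row; congr diag_mx.
apply/rowP => i; case: (fintype.split_ordP i) => k ->;
  rewrite ?row_mxEl ?row_mxEr [LHS]mxE [RHS]mxE.
  by rewrite sel_l sv_row_l take_repeat_seq// nth_take.
rewrite sel_r sv_row_r /= take_repeat_seq//.
have sz : size (take rp (repeat_seq svp np)) = rp.
  by rewrite size_takel// size_svp rp_le.
rewrite nth_rev sz// nth_take; last by move: (ltn_ord k); lia.
by congr nth; move: (ltn_ord k) rp_le; lia.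
Qed.

Lemma sgn_selE : sgnmx R rm rp = diag_mx (\row_j s 0 (sel j)).
Proof.
rewrite sgnmxE; congr diag_mx; apply/rowP => i.
case: (fintype.split_ordP i) => k ->; rewrite [RHS]mxE ?sel_l ?sel_r.
  by rewrite !row_mxEl !mxE.
by rewrite !row_mxEr !mxE.
Qed.

Lemma Sigma1_invsqrtE :
  Sigma1_invsqrt svm svp nm np qm qp = diag_mx (\row_j (Num.sqrt (d 0 (sel j)))^-1).
Proof.
rewrite /Sigma1_invsqrt Sigma1E; apply/matrixP => i j; rewrite !mxE.
by case: eqVneq => _; rewrite ?mulr0n ?sqrtr0 ?invr0.
Qed.

Lemma U1E : U1 U nm np qm qp = U *m T.
Proof.
rewrite mul_sel_mx; apply/matrixP => i j; rewrite [RHS]mxE.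
case: (fintype.split_ordP j) => k ->; rewrite /U1 ?row_mxEl ?row_mxEr !mxE ?sel_l ?sel_r.
  have kn : (0 + k < n)%N by exact: leq_trans (ltn_ord k) rm_le.
  by rewrite insubT /= mxE; congr (U _ (lshift _ _)); apply: val_inj.
by rewrite insubT ?plus_lt// => h /=; rewrite mxE; congr (U _ (rshift _ _)); apply: val_inj.
Qed.

(** [WTE] and [VmxE] exhibit the two projections of the reduction as compressions of the balancing
    transformation by [T]. *)
Lemma WTE : WT L U svm svp nm np qm qp = T^T *m bal_W L U s d.
Proof.
rewrite /WT /bal_W U1E trmx_mul Sigma1_invsqrtE sgn_selE !mulmxA.
rewrite /inv_sqrt_diag tr_sel_mul_diag -[X in _ = X *m _ *m _]mulmxA tr_sel_mul_diag !mulmxA.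
by do 4 congr (_ *m _); congr diag_mx; apply/rowP => j; rewrite !mxE.
Qed.

Lemma VmxE : Vmx L U svm svp nm np qm qp = bal_V L U s d *m T.
Proof.
rewrite /Vmx /bal_V U1E Sigma1_invsqrtE sgnmxE -!mulmxA; do 3 congr (_ *m _).
rewrite /inv_sqrt_diag diag_mul_sel; congr (_ *m _).
by congr diag_mx; apply/rowP => j; rewrite !mxE.
Qed.

Local Notation rA := (WT L U svm svp nm np qm qp *m A *m Vmx L U svm svp nm np qm qp).
Local Notation rB := (WT L U svm svp nm np qm qp *m B).
Local Notation rC := (B^T *m Vmx L U svm svp nm np qm qp).
Local Notation S1 := (Sigma1 svm svp nm np qm qp).
Local Notation Ah := (bal_A A L U s d).
Local Notation Bh := (bal_B L U B s d).

Let oU : U^T *m U = 1%:M. Proof. by have [] := eigU. Qed.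
Let eig : L *m diag_mx s *m L^T = U *m diag_mx s *m diag_mx d *m U^T.
Proof.
have -> : diag_mx d = block_mx (Sigma_minus n svm nm) 0 0 (Sigma_plus n svp np).
  by rewrite /sv_row diag_mx_row.
by rewrite -sgnmxE; have [_ _ _] := eigU.
Qed.
Let s_sign := @sgn_row_sign n n.
Let d_ge0 := sv_row_ge0.
Let SAS' : diag_mx s *m A *m diag_mx s = A^T. Proof. by rewrite -sgnmxE. Qed.
Let SB' : diag_mx s *m B = B. Proof. by rewrite -sgnmxE. Qed.

Lemma reduced_AE : rA = T^T *m Ah *m T.
Proof. by rewrite WTE VmxE /bal_A !mulmxA. Qed.

Lemma reduced_BE : rB = T^T *m Bh.
Proof. by rewrite WTE /bal_B !mulmxA. Qed.

Lemma reduced_CE : rC = Bh^T *m T.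
Proof.
rewrite VmxE -(bal_V_B s_sign d_ge0 SB' PL PB oU eig) trmx_mul trmxK.
by rewrite !mulmxA.
Qed.

Lemma reduced_sgn_A : sgnmx R rm rp *m rA *m sgnmx R rm rp = rA^T.
Proof.
have := bal_SAS L U d s_sign SAS'.
rewrite reduced_AE sgn_selE; move: Ah => a e.
rewrite !mulmxA -tr_sel_mul_diag -[LHS]mulmxA -diag_mul_sel !trmx_mul trmxK -e.
by rewrite !mulmxA.
Qed.

Lemma reduced_sgn_B : sgnmx R rm rp *m rB = rB.
Proof.
have := bal_S_B s_sign d_ge0 SB' PL PB oU eig.
by rewrite reduced_BE sgn_selE; move: Bh => b e; rewrite mulmxA -tr_sel_mul_diag -mulmxA e.
Qed.

Lemma reduced_B_C : rB = rC^T.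
Proof. by rewrite reduced_BE reduced_CE; move: Bh => b; rewrite trmx_mul trmxK. Qed.

Lemma Sigma1_B : S1 *m rB = rB.
Proof.
have := bal_Sg_B s_sign d_ge0 SB' PL PB oU eig.
by rewrite reduced_BE Sigma1E; move: Bh => b e; rewrite mulmxA -tr_sel_mul_diag -mulmxA e.
Qed.

Lemma Sigma1_pd : pdmx S1.
Proof.
have [sS S0] : psdmx S1 by rewrite Sigma1E; apply: psd_diag => i; rewrite mxE ltW ?sel_gt0.
split=> // x x0; rewrite qfE dotE Sigma1E lt_neqAle; apply/andP; split; last first.
  by move: (S0 x); rewrite qfE dotE Sigma1E.
apply: contraNneq x0 => e; apply/eqP/colP => i; rewrite mxE; apply/eqP.
have h : forall j, true -> 0 <= x j 0 * (diag_mx (\row_k d 0 (sel k)) *m x) j 0.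
  by move=> j _; rewrite mul_diag_mx 2!mxE mulrCA mulr_ge0 -?expr2 ?sqr_ge0.
have /(_ i isT) := psumr_eq0P h (esym e).
by rewrite mul_diag_mx 2!mxE => /eqP; rewrite mulf_eq0 mulf_eq0 (gt_eqF (sel_gt0 _)) /= orbb.
Qed.

Lemma Sigma1_dissipative : dissipative S1 rA.
Proof.
have := bal_dissipative PL dA oU eig.
rewrite reduced_AE Sigma1E; move: Ah => a h x.
rewrite -!mulmxA [_ *m (T^T *m _)]mulmxA -tr_sel_mul_diag -mulmxA dot_mulr trmxK.
exact: h.
Qed.

Lemma Sigma1_dissipative_dual : dissipative S1 rA^T.
Proof.
rewrite -reduced_sgn_A => x.
have := Sigma1_dissipative (sgnmx R rm rp *m x).
have c : sgnmx R rm rp *m S1 = S1 *m sgnmx R rm rp by rewrite Sigma1E sgn_selE diag_mxC.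
have sS : (sgnmx R rm rp)^T = sgnmx R rm rp by rewrite sgn_selE diag_mx_tr.
by rewrite dot_mull sS !mulmxA c.
Qed.

Lemma reduced_kyp : nsdmx (kyp rA rB rC 0 S1).
Proof.
have [sS _] := Sigma1_pd; apply/(nsd_kypP _ _ _ sS); split; first exact: Sigma1_dissipative.
by rewrite Sigma1_B reduced_B_C.
Qed.

Lemma reduced_kyp_dual : nsdmx (kyp rA^T rC^T rB^T 0 S1).
Proof.
have [sS _] := Sigma1_pd; apply/(nsd_kypP _ _ _ sS); split; first exact: Sigma1_dissipative_dual.
by rewrite -reduced_B_C Sigma1_B trmxK.
Qed.

Let SgB := bal_Sg_B s_sign d_ge0 SB' PL PB oU eig.
Let Sgd := bal_dissipative PL dA oU eig.
Local Notation Kl a b := (masked_loop Ah Bh (mask_mx R (keep a b))).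

Lemma mask_RHinf (J : pred 'I_(n + n)) : RHinf (masked_loop Ah Bh (mask_mx R J)).
Proof.
apply: (masked_RHinf (Sg := diag_mx d)) => //.
- by apply: psd_diag; exact: sv_row_ge0.
- exact: diag_mx_tr.
- exact: diag_mxC.
- by rewrite mask_mxM; apply: eq_mask_mx => i /=; rewrite andbb.
Qed.

Lemma keep_gain (J J' : pred 'I_(n + n)) (k : R) :
  (forall i, J' i -> J i) -> (forall i, J i -> d 0 i != 0) ->
  (forall i, J i -> ~~ J' i -> d 0 i = k) ->
  gain_le (masked_loop Ah Bh (mask_mx R J) - masked_loop Ah Bh (mask_mx R J')) k.
Proof.
apply: mask_gain => //.
- exact: (bal_dissipative_inv s_sign d_ge0 SAS' PL dA oU eig).
- exact: (bal_inv_B s_sign d_ge0 SB' PL PB oU eig).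
Qed.

Lemma keep_supp a b i : keep a b i -> d 0 i != 0.
Proof. by case/andP. Qed.

(** Two chains: the values of [Sigma^-] are removed while all of [Sigma^+] is kept, then those of
    [Sigma^+]. A value common to both tails is removed in two steps and counted twice, as in the
    bound. *)
Lemma truncation_gain :
  gain_le (Kl (size svm) (size svp) - Kl qm qp)
    (\sum_(qm <= i < size svm) svm`_i + \sum_(qp <= i < size svp) svp`_i).
Proof.
have [[/andP[_ qms] /andP[_ qps]] _ _ _] := adm.
have nm0 i : 0 <= svm`_i by have /andP[] := sv_list_bounds svmP i.
have np0 i : 0 <= svp`_i by have /andP[] := sv_list_bounds svpP i.
have -> : Kl (size svm) (size svp) - Kl qm qp =
  (Kl (size svm) (size svp) - Kl qm (size svp)) + (Kl qm (size svp) - Kl qm qp).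
  by rewrite addrA subrK.
apply: gain_leD; [exact: sumr_ge0|exact: sumr_ge0| |].
- apply: (gain_le_telescope (K := fun a => Kl a (size svp))) => // i _.
  apply: keep_gain => [j|j|j]; [exact: keep_mono|exact: keep_supp|exact: keep_diff_l].
- apply: (gain_le_telescope (K := fun b => Kl qm b)) => // i _.
  apply: keep_gain => [j|j|j]; [exact: keep_mono|exact: keep_supp|exact: keep_diff_r].
Qed.

Lemma transfer_full :
  transfer (mask_mx R (keep (size svm) (size svp)) *m Ah *m mask_mx R (keep (size svm) (size svp)))
    (mask_mx R (keep (size svm) (size svp)) *m Bh)
    (Bh^T *m mask_mx R (keep (size svm) (size svp))) 0 = transfer A B B^T 0.
Proof. by rewrite keep_full; exact: (full_transfer s_sign d_ge0 SAS' SB' PL dA PB oU eig). Qed.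

Lemma transfer_reduced : transfer rA rB rC 0 =
  transfer (mask_mx R (keep qm qp) *m Ah *m mask_mx R (keep qm qp))
    (mask_mx R (keep qm qp) *m Bh) (Bh^T *m mask_mx R (keep qm qp)) 0.
Proof.
rewrite reduced_AE reduced_BE reduced_CE keep_sel.
by apply: selected_transfer; [exact: tr_sel_mul sel_inj|exact: sel_mul_tr sel_inj].
Qed.

Theorem reduced_gap :
  (gap_metric (transfer A B B^T 0) (transfer rA rB rC 0) <=
    (2 * (\sum_(qm <= i < size svm) svm`_i) + 2 * (\sum_(qp <= i < size svp) svp`_i))%:E)%E.
Proof.
have nm0 i : 0 <= svm`_i by have /andP[] := sv_list_bounds svmP i.
have np0 i : 0 <= svp`_i by have /andP[] := sv_list_bounds svpP i.
rewrite -mulrDr; apply: gap_metric_le truncation_gain; [ | | |exact: mask_RHinf|exact: mask_RHinf| |].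
- by rewrite addr_ge0 ?sumr_ge0.
- by rewrite -transfer_full; exact: (loopP _ _ _).1.
- by rewrite transfer_reduced; exact: (loopP _ _ _).1.
(* The identity is a positive definite storage matrix of the full system, whereas [P] may be
   singular. *)
- apply: (@ncf_exists _ _ _ _ 1%:M) => //; last by rewrite mul1mx trmxK.
  exact: pdmx_1.
- by apply: (ncf_exists Sigma1_pd Sigma1_dissipative); rewrite Sigma1_B reduced_B_C.
Qed.

Lemma transfer_exact : svm`_qm = 0 -> svp`_qp = 0 ->
  transfer rA rB rC 0 = transfer A B B^T 0.
Proof.
move=> m0 p0; have e := keep_exact m0 p0; rewrite transfer_reduced e.
exact: (full_transfer s_sign d_ge0 SAS' SB' PL dA PB oU eig).
Qed.

Section Exact.
Hypothesis minP : is_kyp_min A B B^T 0 P.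
Hypothesis svm0 : svm`_qm = 0.
Hypothesis svp0 : svp`_qp = 0.

Let TT : T^T *m T = 1%:M. Proof. exact: tr_sel_mul sel_inj. Qed.
Let TE : T *m T^T = bal_supp d.
Proof. by rewrite sel_mul_tr ?keep_exact -?keep_sel ?keep_exact//; exact: sel_inj. Qed.

(** Since [S1 = V^T P V] with [V] mapping into the range of [Q], every solution of the reduced
    inequality dominates [S1] by [kyp_min_intertwine]. *)
Lemma Sigma1_kyp_min : is_kyp_min rA rB rC 0 S1.
Proof.
apply/kyp_minP; split.
- exact: pdmx_psd Sigma1_pd.
- exact: Sigma1_dissipative.
- by rewrite Sigma1_B reduced_B_C.
have SQ : S1 = (Vmx L U svm svp nm np qm qp)^T *m P *m Vmx L U svm svp nm np qm qp.
  have SgW := bal_Sg_W PL oU eig; have WV := bal_W_V s_sign d_ge0 oU eig.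
  rewrite VmxE Sigma1E; move: SgW WV; move: (bal_V _ _ _ _) (bal_W _ _ _ _) => v w SgW WV.
  rewrite trmx_mul -[T^T *m v^T *m P]mulmxA -SgW -!mulmxA [w *m _]mulmxA WV -TE.
  by rewrite -!mulmxA TT mulmx1 mulmxA tr_sel_mul_diag -mulmxA TT mulmx1.
rewrite SQ; apply: (kyp_min_intertwine (Q := diag_mx s *m P *m diag_mx s)
  (W := WT L U svm svp nm np qm qp) _ _ minP).
- by apply: dissipative_unit1 dA1; exact: pdmx_1.
- exact: dissipative_unit1 Sigma1_pd Sigma1_dissipative.
- exact: (range_invariant s_sign SAS' PL dA).
- by exists B; exact: (range_B SB' PB).
- rewrite VmxE /bal_V; have [D0 LD] := gram_range L.
  exists (diag_mx s *m D0 *m U *m inv_sqrt_diag d *m T).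
  rewrite -!mulmxA [diag_mx s *m (diag_mx s *m _)]mulmxA bal_SS// mul1mx PL.
  by rewrite {1}LD !mulmxA.
- move=> z; have WA := range_WA s_sign d_ge0 PL dA oU eig z.
  have EW := supp_W L U s d; rewrite reduced_AE WTE.
  move: WA EW; move: (diag_mx s *m P *m diag_mx s *m z) => q; move: (bal_W _ _ _ _) Ah => w a WA EW.
  by rewrite -!mulmxA [T *m _]mulmxA TE [bal_supp d *m _]mulmxA EW -WA !mulmxA.
- by [].
- move=> z; have WB := range_WB s_sign d_ge0 SB' PL PB oU eig z.
  have EW := supp_W L U s d; rewrite reduced_CE WTE.
  move: WB EW; move: (diag_mx s *m P *m diag_mx s *m z) => q; move: (bal_W _ _ _ _) Bh => w b WB EW.
  by rewrite -!mulmxA [T *m _]mulmxA TE [bal_supp d *m _]mulmxA EW WB.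
- have WV := bal_W_V s_sign d_ge0 oU eig; rewrite VmxE WTE.
  move: WV; move: (bal_V _ _ _ _) (bal_W _ _ _ _) => v w WV.
  by rewrite -!mulmxA [w *m _]mulmxA WV -TE -!mulmxA TT mulmx1 TT.
Qed.

Lemma Sigma1_kyp_min_dual : is_kyp_min rA^T rC^T rB^T 0 S1.
Proof.
apply: (kyp_min_dual (S := sgnmx R rm rp)) Sigma1_kyp_min.
- by rewrite sgnmxE diag_mx_tr.
- by rewrite sgnmxE bal_SS//; exact: sgn_row_sign.
- by rewrite Sigma1E sgn_selE diag_mxC.
- exact: reduced_sgn_A.
- exact: reduced_sgn_B.
- exact: reduced_B_C.
Qed.

Lemma reduced_minimal : minimal rA rB rC 0.
Proof.
split.
  apply: kalman_controllable => z.
  exact: (kyp_min_kalman Sigma1_kyp_min_dual Sigma1_pd).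
move=> T0 x u y x' u' y' T0gt s1 s2 same.
apply: (kalman_observable T0gt _ s1 s2 same) => z h.
by apply: (kyp_min_kalman Sigma1_kyp_min Sigma1_pd) => k _; exact: h.
Qed.

Lemma reduced_balanced : pr_balanced rA rB rC 0.
Proof.
exists S1, S1; split=> //; [exact: Sigma1_kyp_min| |].
  by rewrite trmx0; exact: Sigma1_kyp_min_dual.
pose dd := [seq d 0 (sel j) | j <- enum 'I_(rm + rp)].
(* A value may occur in both [Sigma^-] and [Sigma^+], in separate blocks; hence the distinct values
   are listed with their counted multiplicities. *)
exists (undup dd), [seq count_mem x dd | x <- undup dd], dd; split.
- exact: undup_uniq.
- apply/allP => x; rewrite mem_undup => /mapP[j _ ->]; rewrite sel_gt0 /=.
  by case: (fintype.split_ordP (sel j)) => i ->; rewrite ?sv_row_l ?sv_row_r;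
    [have /andP[] := sv_list_bounds_nth svmP i|
     have /andP[] := sv_list_bounds_nth svpP (n - i.+1)].
- split; first by rewrite size_map.
  apply/allP => k /mapP[x]; rewrite mem_undup => xd ->.
  by rewrite -has_count has_pred1.
- have -> : repeat_seq (undup dd) [seq count_mem x dd | x <- undup dd] =
      flatten [seq nseq (count_mem x dd) x | x <- undup dd].
    by rewrite /repeat_seq; congr flatten; elim: (undup dd) => //= x l ->.
  by rewrite perm_sym perm_count_undup.
- split; first by rewrite size_map size_enum_ord.
  rewrite Sigma1E /diag_seq; congr diag_mx; apply/rowP => i; rewrite [LHS]mxE [RHS]mxE.
  by rewrite (nth_map i) ?size_enum_ord// nth_ord_enum.
Qed.

End Exact.

End Reduction.

(** * Structure of the given system and conclusion *)

Lemma sgn_port_hamiltonian (R : realType) n (G D : 'M[R]_n) : D^T = D ->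
  sgnmx R n n *m block_mx 0 G^T (- G) (- D) *m sgnmx R n n =
  (block_mx 0 G^T (- G) (- D))^T.
Proof.
move=> sD; have trN (M : 'M[R]_n) : (- M)^T = - M^T by apply/matrixP => i j; rewrite !mxE.
rewrite /sgnmx !mulmx_block tr_block_mx trmx0 trmxK !trN sD.
by congr block_mx; rewrite ?(mul0mx, mulmx0, addr0, add0r, mulmx1, mul1mx, mulNmx, mulmxN, opprK, oppr0).
Qed.

Lemma sgn_port (R : realType) n m (B : 'M[R]_(n, m)) :
  sgnmx R n n *m col_mx 0 B = col_mx 0 B.
Proof. by rewrite /sgnmx mul_block_col !mulmx0 !mul0mx !add0r mul1mx. Qed.

(** The terms with [G] cancel by skew-symmetry, and only the damping [- D] contributes. *)
Lemma port_hamiltonian_dissipative (R : realType) n (G D : 'M[R]_n) : psdmx D ->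
  dissipative 1%:M (block_mx 0 G^T (- G) (- D)).
Proof.
move=> /psdmx_dot[_ D0] x; rewrite mul1mx -[x]vsubmxK mul_block_col mul0mx add0r dot_col_mx.
rewrite dot_mulr trmxK !mulNmx dotDr !dotNr [dot (G *m _) _]dotC.
by have := D0 (dsubmx x); lra.
Qed.

Theorem theorem3p2 (R : realType) (n m : nat)
  (G D : 'M[R]_n) (B : 'M[R]_(n, m))
  (L U Pmin : 'M[R]_(n + n))
  (svm svp : seq R) (nm np : seq nat) (qm qp : nat) :
  let cA : 'M[R]_(n + n) := block_mx 0 G^T (- G) (- D) in
  let cB : 'M[R]_(n + n, m) := col_mx 0 B in
  let cC : 'M[R]_(m, n + n) := cB^T in
  let rm := rank_trunc qm nm in
  let rp := rank_trunc qp np in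
  let W_T : 'M[R]_(rm + rp, n + n) := WT L U svm svp nm np qm qp in
  let V : 'M[R]_(n + n, rm + rp) := Vmx L U svm svp nm np qm qp in
  let rA : 'M[R]_(rm + rp) := W_T *m cA *m V in
  let rB : 'M[R]_(rm + rp, m) := W_T *m cB in
  let rC : 'M[R]_(m, rm + rp) := cC *m V in
  let S1 : 'M[R]_(rm + rp) := Sigma1 svm svp nm np qm qp in
  G \in unitmx -> psdmx D -> \rank B = m ->
  stabilizable cA cB ->
  is_kyp_min cA cB cC 0 Pmin ->
  Pmin = L^T *m L ->
  is_eigendecomposition L U svm svp nm np ->
  admissible svm svp qm qp ->
  [/\ [/\ nsdmx (kyp rA rB rC 0 S1),
          nsdmx (kyp rA^T rC^T rB^T 0 S1) &
          passive rA rB rC 0],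
      [/\ sgnmx R rm rp *m rA *m sgnmx R rm rp = rA^T,
          rB = sgnmx R rm rp *m rB & rB = rC^T],
      (gap_metric (transfer cA cB cC 0) (transfer rA rB rC 0) <=
       (2 * (\sum_(qm <= i < size svm) svm`_i)
        + 2 * (\sum_(qp <= i < size svp) svp`_i))%:E)%E &
      svm`_qm = 0 -> svp`_qp = 0 ->
      [/\ minimal rA rB rC 0, pr_balanced rA rB rC 0 &
          transfer rA rB rC 0 = transfer cA cB cC 0]].
Proof.
move=> cA cB cC rm rp W_T V rA rB rC S1 _ psdD _ _ minP PL eigU adm.
have [pP dA PB minP'] := (kyp_minP _ _ _ _).1 minP; rewrite trmxK in PB.
have sD : D^T = D by case: psdD.
have SAS : sgnmx R n n *m cA *m sgnmx R n n = cA^T by exact: sgn_port_hamiltonian.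
have SB : sgnmx R n n *m cB = cB by exact: sgn_port.
have dA1 : dissipative 1%:M cA by exact: port_hamiltonian_dissipative.
split.
- split.
  + exact: (reduced_kyp SB dA PB PL eigU adm).
  + exact: (reduced_kyp_dual SAS SB dA PB PL eigU adm).
  + have pd : pdmx S1 := Sigma1_pd eigU adm.
    have dS : dissipative S1 rA by exact: Sigma1_dissipative.
    have SBC : S1 *m rB = rC^T.
      by rewrite (Sigma1_B _ _ SB PB PL eigU); exact: (reduced_B_C _ _ SB PB PL eigU).
    move: pd dS SBC; rewrite /S1 (Sigma1E _ _ eigU); exact: passive_diag.
- split; first exact: (reduced_sgn_A _ _ SAS eigU).
  + by rewrite (reduced_sgn_B _ _ SB PB PL eigU).
  + exact: (reduced_B_C _ _ SB PB PL eigU).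
- exact: (reduced_gap SAS SB dA1 dA PB PL eigU adm).
- move=> m0 p0; split.
  + exact: (reduced_minimal SAS SB dA1 dA PB PL eigU adm minP m0 p0).
  + exact: (reduced_balanced SAS SB dA1 dA PB PL eigU adm minP m0 p0).
  + exact: (transfer_exact SAS SB dA PB PL eigU adm m0 p0).
Qed.
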